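(* For every $\epsilon$ with $0<\epsilon\le 6$ there is an algorithm that, given a set ${\cal P}$ of $n$ points and a set ${\cal D}$ of $m$ unit disks in the Euclidean plane with ${\cal P}\subseteq\bigcup{\cal D}$, computes a subset of ${\cal D}$ covering ${\cal P}$ whose cardinality is at most $(9+\epsilon)$ times the minimum cardinality of a subset of ${\cal D}$ covering ${\cal P}$, in $O(\max(m^6 n,\, m^{2(1+6/\epsilon)} n))$ time.
   Context: This is the discrete unit disk cover (DUDC) problem: given points ${\cal P}$ and unit disks ${\cal D}$, find a minimum-cardinality ${\cal D}^*\subseteq{\cal D}$ such that every point of ${\cal P}$ lies in some disk of ${\cal D}^*$. *)

(* Defs.v *)
From Stdlib Require Import Reals ZArith List.
Open Scope R_scope.

Definition point := (R * R)%type.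

Definition in_unit_disk (c p : point) : Prop :=
  (fst p - fst c) ^ 2 + (snd p - snd c) ^ 2 <= 1.

Definition covers (P D : list point) (S : list nat) : Prop :=
  (forall j, In j S -> (j < length D)%nat) /\
  forall p, In p P -> exists j c, In j S /\ nth_error D j = Some c /\ in_unit_disk c p.

(* Machine model: a unit-cost real RAM (no floor function), with      *)
(* unbounded memories of real registers and of integer registers,     *)
(* integer addition/subtraction only, real field operations, and      *)
(* indirect addressing through integer registers.                     *)
Inductive instr : Type :=
| IConst  (d : nat) (z : Z)          (* I[d] := z *)
| IAdd    (d a b : nat)              (* I[d] := I[a] + I[b] *)
| ISub    (d a b : nat)              (* I[d] := I[a] - I[b] *)
| ILoadI  (d a : nat)                (* I[d] := I[I[a]] *)
| IStoreI (a s : nat)                (* I[I[a]] := I[s] *)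
| RConst  (d : nat) (z : Z)          (* R[d] := z *)
| RAdd    (d a b : nat)              (* R[d] := R[a] + R[b] *)
| RSub    (d a b : nat)
| RMul    (d a b : nat)
| RDiv    (d a b : nat)              (* R[d] := R[a] / R[b] (0 if R[b]=0) *)
| RLoadI  (d a : nat)                (* R[d] := R[I[a]] *)
| RStoreI (a s : nat)                (* R[I[a]] := R[s] *)
| IToR    (d s : nat)                (* R[d] := I[s] *)
| JmpILt  (a b t : nat)              (* if I[a] < I[b] then goto t *)
| JmpRLt  (a b t : nat)              (* if R[a] < R[b] then goto t *)
| JmpRLe  (a b t : nat)              (* if R[a] <= R[b] then goto t *)
| Jmp     (t : nat)
| Halt.

Definition program := list instr.

Record mstate := MState { pc : nat; imem : nat -> Z; rmem : nat -> R }.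

Definition updZ (f : nat -> Z) (k : nat) (v : Z) : nat -> Z :=
  fun i => if Nat.eqb i k then v else f i.
Definition updR (f : nat -> R) (k : nat) (v : R) : nat -> R :=
  fun i => if Nat.eqb i k then v else f i.

Definition rdiv0 (x y : R) : R := if Req_EM_T y 0 then 0 else x / y.

Definition step (prg : program) (s : mstate) : mstate :=
  let '(MState p Im Rm) := s in
  let nx := S p in
  match nth_error prg p with
  | None | Some Halt => s
  | Some (IConst d z) => MState nx (updZ Im d z) Rm
  | Some (IAdd d a b) => MState nx (updZ Im d (Im a + Im b)%Z) Rm
  | Some (ISub d a b) => MState nx (updZ Im d (Im a - Im b)%Z) Rm
  | Some (ILoadI d a) => MState nx (updZ Im d (Im (Z.to_nat (Im a)))) Rm
  | Some (IStoreI a s') => MState nx (updZ Im (Z.to_nat (Im a)) (Im s')) Rm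
  | Some (RConst d z) => MState nx Im (updR Rm d (IZR z))
  | Some (RAdd d a b) => MState nx Im (updR Rm d (Rm a + Rm b))
  | Some (RSub d a b) => MState nx Im (updR Rm d (Rm a - Rm b))
  | Some (RMul d a b) => MState nx Im (updR Rm d (Rm a * Rm b))
  | Some (RDiv d a b) => MState nx Im (updR Rm d (rdiv0 (Rm a) (Rm b)))
  | Some (RLoadI d a) => MState nx Im (updR Rm d (Rm (Z.to_nat (Im a))))
  | Some (RStoreI a s') => MState nx Im (updR Rm (Z.to_nat (Im a)) (Rm s'))
  | Some (IToR d s') => MState nx Im (updR Rm d (IZR (Im s')))
  | Some (JmpILt a b t) => MState (if Z.ltb (Im a) (Im b) then t else nx) Im Rm
  | Some (JmpRLt a b t) => MState (if Rlt_dec (Rm a) (Rm b) then t else nx) Im Rm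
  | Some (JmpRLe a b t) => MState (if Rle_dec (Rm a) (Rm b) then t else nx) Im Rm
  | Some (Jmp t) => MState t Im Rm
  end.

Fixpoint run (prg : program) (t : nat) (s : mstate) : mstate :=
  match t with O => s | S t' => run prg t' (step prg s) end.

Definition halted (prg : program) (s : mstate) : Prop :=
  match nth_error prg (pc s) with None | Some Halt => True | _ => False end.

(* Input encoding: I[0] = n, I[1] = m; the point p_i is stored in
   R[2i], R[2i+1]; the centre of disk j in R[2n+2j], R[2n+2j+1];
   all other registers are 0. *)
Definition encode_real (P D : list point) (k : nat) : R :=
  let n := length P in
  if Nat.ltb k (2 * n) then
    match nth_error P (Nat.div k 2) with
    | Some q => if Nat.even k then fst q else snd q
    | None => 0 end
  else
    match nth_error D (Nat.div (k - 2 * n) 2) with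
    | Some q => if Nat.even k then fst q else snd q
    | None => 0 end.

Definition encode_int (P D : list point) (k : nat) : Z :=
  match k with
  | O => Z.of_nat (length P)
  | 1%nat => Z.of_nat (length D)
  | _ => 0%Z end.

Definition init_state (P D : list point) : mstate :=
  MState 0 (encode_int P D) (encode_real P D).

(* Output decoding: I[0] = k and the chosen disk indices (0-based) are
   I[1], ..., I[k]. *)
Definition output (s : mstate) : list Z :=
  map (fun i => imem s (S i)) (seq 0 (Z.to_nat (imem s 0))).

Definition outputs_within (prg : program) (P D : list point) (t : nat)
    (S : list nat) : Prop :=
  exists t', (t' <= t)%nat /\
    halted prg (run prg t' (init_state P D)) /\
    (0 <= imem (run prg t' (init_state P D)) 0)%Z /\
    Forall (fun z => 0 <= z)%Z (output (run prg t' (init_state P D))) /\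
    map Z.of_nat S = output (run prg t' (init_state P D)).

(* Main.v *)
Require Import Defs.
From Stdlib Require Import Reals ZArith List Lra Lia Psatz Permutation Bool Arith.
From Stdlib Require Import ClassicalEpsilon.
Import ListNotations.
Open Scope R_scope.

(** Local search: starting from all disks, exchange three chosen disks for at
    most two others as long as the result still covers the points.  There are
    at most [m] exchanges, and with the numbers of chosen disks covering each
    point at hand one of the [m^5] candidates is tested in time [O(n)], so that
    the running time is [O(m^6 n)].

    A local optimum [L] has at most [9 |O|] disks for every cover [O].  After
    removing the common disks, join, for every point [p], a centre of [L] to a
    centre of [O], both covering [p], as follows: move from [p] towards the
    nearest centre of the other colour up to a point [q] that has nearest
    centres of both colours.  The segments so obtained are chords of empty circles and
    form a plane bipartite graph.  Local optimality says that any [k <= 3]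
    vertices of [L] have at least [k] neighbours; by Euler's formula there are at
    most [|O|] vertices in [L] of degree 1, [2 * 3 |O|] of degree 2 (each pair of
    neighbours occurs at most twice) and [2 |O|] of higher degree. *)

(** The ratio 9 is below 9 + eps for every eps, so one program serves all eps and only the term m^6
    n of the time bound is used. Exchanges of three disks are enough because the counting needs
    Hall's condition only for one vertex (no isolated vertex), two vertices (sharing a single
    neighbour) and three vertices (sharing the same two neighbours); lower bounds 4 and 6 on the
    length of faces do the rest.

    The geometric obstacle is degeneracy: with cocircular centres several centres are nearest, and
    the chords of one empty circle may cross. A fixed tie-break makes each edge a function of the
    centre of its circle, so every circle contributes one chord.

    The topological obstacle is the notion of face. Here faces are numbers attached to the two sides
    of each edge, merged or created as a vertical line sweeps over the vertices. Euler's formula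
    becomes the inequality |E| <= F + |V| with F the number of bounded faces, which holds for
    disconnected graphs as well. *)

(** * Ordered lists, sums modulo 2 and chains of face labels *)

Lemma ForallOrdPairs_app {T} (r : T -> T -> Prop) (l1 l2 : list T) :
  ForallOrdPairs r (l1 ++ l2) <->
  ForallOrdPairs r l1 /\ ForallOrdPairs r l2 /\
  (forall x y, In x l1 -> In y l2 -> r x y).
Proof.
  induction l1 as [|a l1 IH]; simpl.
  - split; [intros H; repeat split; [constructor|exact H|easy]|tauto].
  - split.
    + intros H; inversion H as [|? ? Ha Hl]; subst.
      apply IH in Hl as (H1 & H2 & H3). rewrite Forall_app in Ha.
      destruct Ha as [Ha1 Ha2]. repeat split; auto.
      * constructor; auto.
      * intros x y [<-|Hx] Hy; auto. rewrite Forall_forall in Ha2; auto.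
    + intros (H1 & H2 & H3). inversion H1 as [|? ? Ha Hl]; subst.
      constructor.
      * rewrite Forall_app; split; auto. apply Forall_forall; auto.
      * apply IH; auto.
Qed.

Lemma ForallOrdPairs_impl {T} (r r' : T -> T -> Prop) (l : list T) :
  (forall x y, In x l -> In y l -> r x y -> r' x y) ->
  ForallOrdPairs r l -> ForallOrdPairs r' l.
Proof.
  induction l as [|a l IH]; intros Hi H; constructor; inversion H as [|? ? Ha Hl]; subst.
  - rewrite Forall_forall in *. intros y Hy; apply Hi; simpl; auto.
  - apply IH; auto. intros; apply Hi; simpl; auto.
Qed.

Lemma sort_by_key {T} (k : T -> R) (l : list T) :
  exists l', Permutation l l' /\ ForallOrdPairs (fun x y => k x <= k y) l'.
Proof.
  induction l as [|a l (l' & HP & HS)].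
  - exists []; split; constructor.
  - set (lt := fun y => if Rlt_dec (k y) (k a) then true else false).
    exists (filter lt l' ++ a :: filter (fun y => negb (lt y)) l'). split.
    + apply Permutation_cons_app. etransitivity; [exact HP|].
      clear. induction l' as [|b l' IH]; simpl; auto.
      destruct (lt b); simpl; [constructor; auto|].
      apply Permutation_cons_app; auto.
    + assert (Hf : forall g, ForallOrdPairs (fun x y => k x <= k y) (filter g l')).
      { intros g. clear -HS. induction HS as [|b l' Hb _ IH]; simpl; [constructor|].
        destruct (g b); auto. constructor; auto.
        rewrite Forall_forall in *; intros x Hx; apply filter_In in Hx; apply Hb; tauto. }
      apply ForallOrdPairs_app; repeat split; auto.
      * constructor; auto. apply Forall_forall. intros x Hx.
        apply filter_In in Hx as [_ Hx]. unfold lt in Hx.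
        destruct (Rlt_dec (k x) (k a)); simpl in Hx; [easy|lra].
      * intros x y Hx Hy. apply filter_In in Hx as [_ Hx]. unfold lt in Hx.
        destruct (Rlt_dec (k x) (k a)); [|easy].
        destruct Hy as [<-|Hy]; [lra|].
        apply filter_In in Hy as [_ Hy]. unfold lt in Hy.
        destruct (Rlt_dec (k y) (k a)); simpl in Hy; [easy|lra].
Qed.

(** Cuts the status of the sweep line at the height [c] of the next vertex: as the keys are sorted,
    the edges through that vertex form one contiguous block [M]. *)
Lemma sorted_split {T} (k : T -> R) (c : R) (l : list T) :
  ForallOrdPairs (fun x y => k x <= k y) l ->
  exists A M B, l = A ++ M ++ B /\ (forall e, In e A -> k e < c) /\
    (forall e, In e M -> k e = c) /\ (forall e, In e B -> c < k e).
Proof.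
  induction l as [|x l IH]; intros H.
  - exists [], [], []; repeat split; easy.
  - inversion H as [|? ? Hx Hl]; subst. rewrite Forall_forall in Hx.
    destruct (IH Hl) as (A & M & B & -> & HA & HM & HB).
    destruct (Rtotal_order (k x) c) as [Hc|[Hc|Hc]].
    + exists (x :: A), M, B; repeat split; auto. intros e [<-|He]; auto.
    + assert (A = []) as ->.
      { destruct A as [|a A]; auto. specialize (Hx a (or_introl eq_refl)).
        specialize (HA a (or_introl eq_refl)); lra. }
      exists [], (x :: M), B; repeat split; auto. intros e [<-|He]; auto.
    + assert (A = []) as ->.
      { destruct A as [|a A]; auto. specialize (Hx a (or_introl eq_refl)).
        specialize (HA a (or_introl eq_refl)); lra. }
      assert (M = []) as ->.
      { destruct M as [|a M]; auto. specialize (Hx a (or_introl eq_refl)).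
        specialize (HM a (or_introl eq_refl)); lra. }
      exists [], [], (x :: B); repeat split; auto. intros e [<-|He]; auto.
Qed.

(** The sum over the field with two elements, in which face boundaries are cycles. *)
Definition xsum {T} (f : T -> bool) (l : list T) : bool :=
  fold_right (fun e b => xorb (f e) b) false l.

Lemma xsum_app {T} (f : T -> bool) l1 l2 :
  xsum f (l1 ++ l2) = xorb (xsum f l1) (xsum f l2).
Proof.
  induction l1 as [|a l1 IH]; simpl; [now destruct (xsum f l2)|].
  rewrite IH. now rewrite xorb_assoc.
Qed.

Lemma xsum_perm {T} (f : T -> bool) l1 l2 :
  Permutation l1 l2 -> xsum f l1 = xsum f l2.
Proof.
  induction 1; simpl; auto; [congruence| |congruence].
  rewrite <- !xorb_assoc. now rewrite (xorb_comm (f y)).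
Qed.

Lemma xsum_ext {T} (f g : T -> bool) l :
  (forall e, In e l -> f e = g e) -> xsum f l = xsum g l.
Proof.
  induction l as [|a l IH]; simpl; intros H; auto. rewrite H, IH; auto.
Qed.

(** A single odd term would make the sum odd. Applied to the edges at a vertex, this forbids leaves
    in a face boundary. *)
Lemma xsum_other {T} (f : T -> bool) l e :
  NoDup l -> In e l -> f e = true -> xsum f l = false ->
  exists e', In e' l /\ e' <> e /\ f e' = true.
Proof.
  intros Hn He Hf Hx. apply NNPP; intros Hno.
  apply in_split in He as (l1 & l2 & ->).
  assert (H0 : forall l', incl l' (l1 ++ l2) -> xsum f l' = false).
  { induction l' as [|a l' IH]; simpl; intros Hi; auto.
    rewrite IH by (intros x Hx'; apply Hi; simpl; auto).
    destruct (f a) eqn:Ea; auto. exfalso; apply Hno. exists a.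
    assert (Ha : In a (l1 ++ l2)) by (apply Hi; simpl; auto).
    repeat split; auto.
    - rewrite in_app_iff in *; simpl; tauto.
    - intros ->. apply NoDup_remove_2 in Hn; auto. }
  rewrite xsum_app in Hx; simpl in Hx. rewrite Hf in Hx.
  rewrite !H0 in Hx; [easy| |]; intros x Hx'; apply in_app_iff; auto.
Qed.

(** Models a vertical line crossing the edges of [l] from bottom to top: it starts in face [a], ends
    in face [b], and consecutive edges share the face between them. *)
Fixpoint chain {T} (up dn : T -> nat) (a : nat) (l : list T) (b : nat) : Prop :=
  match l with
  | [] => a = b
  | e :: l' => dn e = a /\ chain up dn (up e) l' b
  end.

Lemma chain_app {T} (up dn : T -> nat) a l1 l2 b :
  chain up dn a (l1 ++ l2) b <->
  exists c, chain up dn a l1 c /\ chain up dn c l2 b.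
Proof.
  revert a; induction l1 as [|e l1 IH]; simpl; intros a.
  - split; [intros H; exists a; auto|intros (c & -> & H); auto].
  - rewrite IH. firstorder.
Qed.

Lemma chain_ext {T} (up dn up' dn' : T -> nat) a l b :
  (forall e, In e l -> up' e = up e /\ dn' e = dn e) ->
  chain up dn a l b -> chain up' dn' a l b.
Proof.
  revert a; induction l as [|e l IH]; simpl; intros a H; auto.
  destruct (H e (or_introl eq_refl)) as [-> ->]. intros [H1 H2]; split; auto.
Qed.

Lemma chain_map {T} (g : nat -> nat) (up dn : T -> nat) a l b :
  chain up dn a l b -> chain (fun e => g (up e)) (fun e => g (dn e)) (g a) l (g b).
Proof.
  revert a; induction l as [|e l IH]; simpl; intros a; [congruence|].
  intros [<- H]; auto.
Qed.

(** An edge lies on the boundary of the set [phi] of faces when its two sides disagree about [phi].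
    With [phi := Nat.eqb a] this is the boundary of face [a] modulo 2, in which edges with [a] on
    both sides do not occur. *)
Definition side_parity {T} (up dn : T -> nat) (phi : nat -> bool) (e : T) : bool :=
  xorb (phi (up e)) (phi (dn e)).

(** Telescoping modulo 2. *)
Lemma chain_xsum {T} (up dn : T -> nat) phi a l b :
  chain up dn a l b -> xsum (side_parity up dn phi) l = xorb (phi a) (phi b).
Proof.
  revert a; induction l as [|e l IH]; simpl; intros a.
  - intros ->. now rewrite xorb_nilpotent.
  - intros [<- H]. rewrite (IH _ H). unfold side_parity.
    destruct (phi (up e)), (phi (dn e)), (phi b); auto.
Qed.

(** The first edge through which the chain enters face [x] has another face below it. Hence a face
    met by the sweep line has a boundary that is not empty modulo 2, although the given [e] may have
    [x] on both sides. *)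
Lemma chain_change {T} (up dn : T -> nat) x a l b e :
  chain up dn a l b -> a <> x -> In e l -> up e = x \/ dn e = x ->
  exists e', In e' l /\ side_parity up dn (Nat.eqb x) e' = true.
Proof.
  revert a; induction l as [|e0 l IH]; simpl; intros a Hc Ha He Hx; [easy|].
  destruct Hc as [H0 H].
  destruct (Nat.eq_dec (up e0) x) as [Hu|Hu].
  - exists e0; split; auto. unfold side_parity. rewrite Hu, H0, Nat.eqb_refl.
    apply Nat.eqb_neq in Ha; rewrite Nat.eqb_sym in Ha; now rewrite Ha.
  - destruct He as [<-|He]; [exfalso; destruct Hx; congruence|].
    destruct (IH _ H Hu He Hx) as (e' & He' & Hs). eauto.
Qed.

Definition upd {T} (dec : forall x y : T, {x = y} + {x <> y})
    (f : T -> nat) (x : T) (v : nat) : T -> nat :=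
  fun y => if dec y x then v else f y.

(** The k edges leaving a vertex to the right open k - 1 wedges between the old faces [lo] and [hi];
    the wedges get fresh labels from [N] on. *)
Lemma chain_relabel {T} (dec : forall x y : T, {x = y} + {x <> y})
    (up dn : T -> nat) (hi : nat) (l : list T) :
  NoDup l -> l <> [] -> forall lo N,
  exists up' dn' Fn,
    (forall e, ~ In e l -> up' e = up e /\ dn' e = dn e) /\
    chain up' dn' lo l hi /\ NoDup Fn /\ (forall a, In a Fn -> (N <= a)%nat) /\
    S (length Fn) = length l /\
    (forall e, In e l -> In (up' e) (lo :: hi :: Fn) /\ In (dn' e) (lo :: hi :: Fn)) /\
    (forall a, In a Fn -> exists e, In e l /\ up' e = a).
Proof.
  induction l as [|x l IH]; [easy|]. intros Hn _ lo N.
  inversion Hn as [|? ? Hx Hl]; subst.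
  destruct l as [|y l].
  - exists (upd dec up x hi), (upd dec dn x lo), [].
    unfold upd. split; [|split; [|split; [|split; [|split; [|split]]]]]; simpl.
    + intros e He. destruct (dec e x) as [->|]; [tauto|auto].
    + destruct (dec x x); [auto|congruence].
    + constructor.
    + easy.
    + reflexivity.
    + intros e [->|[]]. destruct (dec e e); [auto|congruence].
    + easy.
  - destruct (IH Hl ltac:(discriminate) N (S N))
      as (up1 & dn1 & Fn & Ho & Hc & HnF & HF & Hlen & Hlab & Hus).
    exists (upd dec up1 x N), (upd dec dn1 x lo), (N :: Fn).
    assert (Hne : forall e, In e (y :: l) -> e <> x) by congruence.
    split; [|split; [|split; [|split; [|split; [|split]]]]].
    + intros e He. unfold upd. destruct (dec e x) as [->|]; [simpl in He; tauto|].
      apply Ho. simpl in *; tauto.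
    + assert (Hux : upd dec up1 x N x = N) by (unfold upd; destruct (dec x x); congruence).
      assert (Hdx : upd dec dn1 x lo x = lo) by (unfold upd; destruct (dec x x); congruence).
      split; [exact Hdx|]. rewrite Hux.
      revert Hc. apply chain_ext. intros e He. unfold upd.
      destruct (dec e x); [exfalso; eapply Hne; eauto|auto].
    + constructor; auto. intros Hin; apply HF in Hin; lia.
    + intros a [<-|Ha]; [lia|]. apply HF in Ha; lia.
    + simpl in *; lia.
    + intros e He. unfold upd. destruct (dec e x) as [->|Hex].
      * simpl; auto.
      * destruct He as [He|He]; [congruence|].
        destruct (Hlab e He) as [H1 H2]; simpl in *; tauto.
    + intros a [<-|Ha].
      * exists x; split; [simpl; auto|]. unfold upd; destruct (dec x x); congruence.
      * destruct (Hus a Ha) as (e & He & Hue). exists e. split; [now right|].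
        unfold upd. destruct (dec e x); [exfalso; eapply Hne; eauto|auto].
Qed.

(** * Plane graphs: Euler's formula by a sweep *)

Lemma point_eq_dec (p q : point) : {p = q} + {p <> q}.
Proof.
  destruct p as [x y], q as [x' y'].
  destruct (Req_EM_T x x') as [->|]; [|right; congruence].
  destruct (Req_EM_T y y') as [->|]; [now left|right; congruence].
Qed.

Definition pt_eqb (p q : point) : bool := if point_eq_dec p q then true else false.

Lemma pt_eqb_iff p q : pt_eqb p q = true <-> p = q.
Proof. unfold pt_eqb; destruct (point_eq_dec p q); intuition congruence. Qed.

Definition slope (l r : point) : R := (snd r - snd l) / (fst r - fst l).

Definition yat (l r : point) (x : R) : R := snd l + (x - fst l) * slope l r.

(** A straight-line drawing without vertical edges. Edges are abstract and carry their end points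
    through [lf] and [rg], so that the edges of the exchange graph can be drawn at sheared
    positions. Two edges are compared only over the interior of both x-ranges, which lets them share
    end points. *)
Record plane_graph {T} (lf rg : T -> point) (E : list T) (V : list point) : Prop := {
  pg_nodup : NoDup E;
  pg_ori : forall e, In e E -> fst (lf e) < fst (rg e);
  pg_lf : forall e, In e E -> In (lf e) V;
  pg_rg : forall e, In e E -> In (rg e) V;
  pg_cross : forall e f x, In e E -> In f E -> e <> f ->
    fst (lf e) < x < fst (rg e) -> fst (lf f) < x < fst (rg f) ->
    yat (lf e) (rg e) x <> yat (lf f) (rg f) x;
  pg_vert : forall e v, In e E -> In v V -> fst (lf e) < fst v < fst (rg e) ->
    yat (lf e) (rg e) (fst v) <> snd v }.

Lemma yat_left l r : yat l r (fst l) = snd l.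
Proof. unfold yat; ring. Qed.

Lemma yat_right l r : fst l < fst r -> yat l r (fst r) = snd r.
Proof. intros H; unfold yat, slope; field; lra. Qed.

(** The difference of the two heights is affine in the abscissa; a change of sign would put its
    zero, at parameter [t], strictly inside both ranges, where the edges would cross. *)
Lemma plane_graph_order {T} (lf rg : T -> point) E V e f x1 x2 :
  plane_graph lf rg E V -> In e E -> In f E -> e <> f ->
  fst (lf e) <= x1 -> fst (lf f) <= x1 -> x1 < x2 ->
  x2 <= fst (rg e) -> x2 <= fst (rg f) ->
  yat (lf e) (rg e) x1 < yat (lf f) (rg f) x1 ->
  yat (lf e) (rg e) x2 <= yat (lf f) (rg f) x2.
Proof.
  intros HG He Hf Hne He1 Hf1 Hx He2 Hf2 Hy.
  destruct (Rle_lt_dec (yat (lf e) (rg e) x2) (yat (lf f) (rg f) x2)) as [H|H]; auto.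
  exfalso.
  set (d1 := yat (lf f) (rg f) x1 - yat (lf e) (rg e) x1).
  set (d2 := yat (lf e) (rg e) x2 - yat (lf f) (rg f) x2).
  assert (D1 : 0 < d1) by (unfold d1; lra). assert (D2 : 0 < d2) by (unfold d2; lra).
  set (t := d1 / (d1 + d2)).
  assert (Ht : 0 < t < 1).
  { unfold t; split; [apply Rdiv_lt_0_compat; lra|].
    apply Rmult_lt_reg_r with (d1 + d2); [lra|]. field_simplify; lra. }
  set (x := x1 + t * (x2 - x1)).
  assert (Hxx : x1 < x < x2) by (unfold x; nra).
  apply (pg_cross _ _ _ _ HG e f x); auto; try lra.
  assert (Ee : forall g, yat (lf g) (rg g) x =
      (1 - t) * yat (lf g) (rg g) x1 + t * yat (lf g) (rg g) x2)
    by (intros g; unfold yat, x; ring).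
  rewrite !Ee.
  assert (Et : t * (d1 + d2) = d1) by (unfold t; field; lra).
  unfold d1, d2 in Et. lra.
Qed.

Definition star {T} (lf rg : T -> point) (E : list T) (v : point) : list T :=
  filter (fun e => pt_eqb (lf e) v || pt_eqb (rg e) v) E.

(* [V1] is the set of vertices already swept; [w] lists, bottom to top, the
   edges meeting the sweep line; [up e] and [dn e] are the labels of the faces
   above and below [e], [0] being the unbounded face; [Fl] lists the labels
   of the other faces in use. *)
Record sweep {T} (lf rg : T -> point) (E : list T) (V1 V2 : list point)
    (w : list T) (up dn : T -> nat) (Fl : list nat) : Prop := {
  sw_nodup : NoDup w;
  sw_w : forall e, In e w <-> In e E /\ In (lf e) V1 /\ In (rg e) V2;
  sw_sorted : ForallOrdPairs (fun e f => forall x, (forall v, In v V1 -> fst v < x) ->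
     x <= fst (rg e) -> x <= fst (rg f) ->
     yat (lf e) (rg e) x <= yat (lf f) (rg f) x) w;
  sw_chain : chain up dn 0%nat w 0%nat;
  sw_even : forall v phi, In v V1 ->
     xsum (side_parity up dn phi) (star lf rg E v) = false;
  sw_Fl : NoDup Fl;
  sw_Fl0 : ~ In 0%nat Fl;
  sw_lab : forall e, In e E -> In (lf e) V1 ->
     In (up e) (0%nat :: Fl) /\ In (dn e) (0%nat :: Fl);
  sw_bd : forall a, In a Fl -> exists e, In e E /\ In (lf e) V1 /\
     side_parity up dn (Nat.eqb a) e = true;
  sw_count : (length (filter (fun e => if in_dec point_eq_dec (lf e) V1 then true else false) E)
     <= length Fl + length V1)%nat }.

Lemma filter_perm_split {T} (f g h : T -> bool) (l : list T) :
  (forall e, In e l -> h e = f e || g e) ->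
  (forall e, In e l -> f e && g e = false) ->
  Permutation (filter h l) (filter f l ++ filter g l).
Proof.
  induction l as [|a l IH]; simpl; intros H1 H2; auto.
  rewrite H1 by auto. specialize (H2 a (or_introl eq_refl)) as Ha.
  assert (IH' := IH (fun e He => H1 e (or_intror He)) (fun e He => H2 e (or_intror He))).
  destruct (f a), (g a); simpl in *; try easy.
  - now constructor.
  - now apply Permutation_cons_app.
Qed.

Lemma sorted_strict_NoDup (V : list point) :
  ForallOrdPairs (fun u v => fst u < fst v) V -> NoDup V.
Proof.
  induction 1 as [|a l Ha Hl IH]; constructor; auto.
  intros Hin. rewrite Forall_forall in Ha. apply Ha in Hin. lra.
Qed.

Lemma NoDup_remove_nat (x : nat) l : NoDup l -> NoDup (remove Nat.eq_dec x l).
Proof.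
  induction 1 as [|a l Ha Hl IH]; simpl; [constructor|].
  destruct (Nat.eq_dec x a); auto. constructor; auto.
  intros H; apply in_remove in H; tauto.
Qed.

Lemma length_remove_nat (x : nat) l :
  NoDup l -> (length l <= S (length (remove Nat.eq_dec x l)))%nat.
Proof.
  induction 1 as [|a l Ha Hl IH]; simpl; [lia|].
  destruct (Nat.eq_dec x a) as [->|]; simpl; [|lia].
  now rewrite notin_remove.
Qed.

(** The count |E| <= F + |V| survives the vertex [v]. If k > 0 edges leave [v] to the right, there
    are k more edges, k - 1 more faces and one more vertex. If none does, the faces above and below
    [v] become one, so that at most one face is lost while one vertex is gained. *)
Lemma sweep_step {T} (dec : forall x y : T, {x = y} + {x <> y})
    (lf rg : T -> point) E V1 v V2 w up dn Fl :
  plane_graph lf rg E (V1 ++ v :: V2) ->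
  ForallOrdPairs (fun u v => fst u < fst v) (V1 ++ v :: V2) ->
  sweep lf rg E V1 (v :: V2) w up dn Fl ->
  exists w' up' dn' Fl', sweep lf rg E (V1 ++ [v]) V2 w' up' dn' Fl'.
Proof.
  intros HG HV [Hnd Hw Hsort Hchain Heven HFl HFl0 Hlab Hbd Hcount].
  assert (HND := sorted_strict_NoDup _ HV).
  apply ForallOrdPairs_app in HV as (HV1 & HV2 & HV12).
  assert (Hv1 : forall u, In u V1 -> fst u < fst v) by (intros; apply HV12; simpl; auto).
  inversion HV2 as [|? ? Hv2 HV2']; subst. rewrite Forall_forall in Hv2.
  destruct (sorted_split (fun e => yat (lf e) (rg e) (fst v)) (snd v) w)
    as (A & L & B & -> & HA & HL & HB).
  { revert Hsort. apply ForallOrdPairs_impl. intros e f He Hf H.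
    assert (Hr : forall g, In g w -> fst v <= fst (rg g)).
    { intros g Hg. apply Hw in Hg as (_ & _ & [<-|Hg]); [lra|].
      apply Hv2 in Hg; lra. }
    apply H; auto. }
  (* No edge has a vertex in its interior, so the edges at the height of [v] are exactly those that
     end in [v]. *)
  assert (HLv : forall e, In e (A ++ L ++ B) -> rg e = v <-> In e L).
  { intros e He. assert (He' := He). apply Hw in He' as (HeE & Hel & Her). split.
    - intros Hr. rewrite !in_app_iff in He.
      assert (Hy : yat (lf e) (rg e) (fst v) = snd v).
      { rewrite <- Hr. apply yat_right. eapply pg_ori; eauto. }
      destruct He as [He|[He|He]]; auto.
      + apply HA in He; lra.
      + apply HB in He; lra.
    - intros HeL. destruct Her as [Her|Her]; [auto|exfalso].
      apply HL in HeL. revert HeL. apply (pg_vert _ _ _ _ HG); auto.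
      apply in_app_iff; simpl; auto. }
  set (Rv0 := filter (fun e => pt_eqb (lf e) v) E).
  (* Edges with the common left end [v] lie in the order of their slopes to the right of it. *)
  destruct (sort_by_key (fun e => slope (lf e) (rg e)) Rv0) as (Rv & HRp & HRs).
  assert (HRv : forall e, In e Rv <-> In e E /\ lf e = v).
  { intros e. rewrite <- pt_eqb_iff. unfold Rv0 in HRp.
    rewrite <- filter_In with (f := fun e => pt_eqb (lf e) v).
    split; apply Permutation_in; auto. now apply Permutation_sym. }
  assert (HRnd : NoDup Rv).
  { eapply Permutation_NoDup; [exact HRp|]. apply NoDup_filter, (pg_nodup _ _ _ _ HG). }
  assert (HRr : forall e, In e Rv -> In (rg e) V2).
  { intros e He. apply HRv in He as (HeE & Hl).
    assert (H1 := pg_ori _ _ _ _ HG e HeE). assert (H2 := pg_rg _ _ _ _ HG e HeE).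
    rewrite Hl in H1. apply in_app_iff in H2 as [H2|[H2|H2]]; auto.
    - apply Hv1 in H2; lra.
    - rewrite <- H2 in H1; lra. }
  assert (Hold : forall e, In e (A ++ L ++ B) -> In e E /\ In (lf e) V1)
    by (intros e He; apply Hw in He; tauto).
  assert (Hvn1 : ~ In v V1) by (intros H; apply Hv1 in H; lra).
  assert (Hvn2 : ~ In v V2) by (intros H; apply Hv2 in H; lra).
  assert (Hdisj : forall e, In (lf e) V1 -> ~ In e Rv).
  { intros e He HR. apply HRv in HR as [_ HR]. congruence. }
  assert (HwA : forall e, In e (A ++ Rv ++ B) <->
      In e E /\ In (lf e) (V1 ++ [v]) /\ In (rg e) V2).
  { intros e. split.
    - intros He. rewrite !in_app_iff in He.
      assert (Hc : In e Rv \/ (In e (A ++ L ++ B) /\ ~ In e L)).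
      { destruct He as [He|[He|He]]; auto; right; rewrite !in_app_iff; split; auto.
        - intros H'; apply HL in H'; apply HA in He; lra.
        - intros H'; apply HL in H'; apply HB in He; lra. }
      destruct Hc as [Hc|[Hc Hc']].
      + assert (Hr := HRr e Hc). apply HRv in Hc as [H1 H2].
        rewrite H2, in_app_iff; simpl; auto.
      + assert (Hc2 := Hc). apply Hw in Hc as (H1 & H2 & [H3|H3]).
        * exfalso; apply Hc'. apply HLv; auto.
        * rewrite in_app_iff; auto.
    - intros (H1 & H2 & H3). rewrite in_app_iff in H2. rewrite !in_app_iff.
      destruct H2 as [H2|[H2|[]]].
      + assert (He : In e (A ++ L ++ B)) by (apply Hw; simpl; auto).
        assert (~ In e L) by (rewrite <- HLv by auto; congruence).
        rewrite !in_app_iff in He; tauto.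
      + right; left. apply HRv; auto. }
  assert (Hsort' : ForallOrdPairs (fun e f => forall x, (forall u, In u (V1 ++ [v]) -> fst u < x) ->
     x <= fst (rg e) -> x <= fst (rg f) ->
     yat (lf e) (rg e) x <= yat (lf f) (rg f) x) (A ++ Rv ++ B)).
  { assert (Hx0 : forall x, (forall u, In u (V1 ++ [v]) -> fst u < x) ->
       (forall u, In u V1 -> fst u < x) /\ fst v < x).
    { intros x Hx; split; [intros u Hu|]; apply Hx, in_app_iff; simpl; auto. }
    apply ForallOrdPairs_app in Hsort as (HsA & HsLB & HsALB).
    apply ForallOrdPairs_app in HsLB as (HsL & HsB & HsLB).
    apply ForallOrdPairs_app; repeat split; [|apply ForallOrdPairs_app; repeat split|].
    - revert HsA; apply ForallOrdPairs_impl. intros e f He Hf H x Hx.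
      apply Hx0 in Hx as [Hx _]; auto.
    - revert HRs; apply ForallOrdPairs_impl. intros e f He Hf H x Hx _ _.
      apply Hx0 in Hx as [_ Hx]. apply HRv in He as [_ He]. apply HRv in Hf as [_ Hf].
      unfold yat. rewrite He, Hf in *. nra.
    - revert HsB; apply ForallOrdPairs_impl. intros e f He Hf H x Hx.
      apply Hx0 in Hx as [Hx _]; auto.
    (* At the abscissa of [v], where [e] starts, [f] is strictly above [v]; edges of a plane drawing
       keep that order. *)
    - intros e f He Hf x Hx Hxe Hxf. apply Hx0 in Hx as [_ Hx].
      assert (Hf' : In f (A ++ L ++ B)) by (rewrite !in_app_iff; auto).
      apply HB in Hf as Hfy.
      assert (Hfo := Hold f Hf'). assert (He' := He). apply HRv in He as [HeE Hel].
      apply (plane_graph_order lf rg E (V1 ++ v :: V2)) with (x1 := fst v); auto; try tauto.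
      + intros ->. apply Hdisj in He'; tauto.
      + rewrite Hel; lra.
      + apply Rlt_le, Hv1; tauto.
      + rewrite Hel, yat_left. exact Hfy.
    - intros e f He Hf x Hx Hxe Hxf.
      assert (He' : In e (A ++ L ++ B)) by (rewrite !in_app_iff; auto).
      assert (Heo := Hold e He'). rewrite in_app_iff in Hf. destruct Hf as [Hf|Hf].
      + apply Hx0 in Hx as [_ Hx]. assert (Hf' := Hf). apply HRv in Hf as [HfE Hfl].
        apply (plane_graph_order lf rg E (V1 ++ v :: V2)) with (x1 := fst v); auto; try tauto.
        * intros ->. apply Hdisj in Hf'; tauto.
        * apply Rlt_le, Hv1; tauto.
        * rewrite Hfl; lra.
        * rewrite Hfl, yat_left. now apply HA.
      + apply Hx0 in Hx as [Hx _]. apply HsALB; auto. rewrite in_app_iff; auto. }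
  assert (Hstar : Permutation (star lf rg E v) (L ++ Rv)).
  { unfold star. etransitivity.
    { apply (filter_perm_split (fun e => pt_eqb (rg e) v) (fun e => pt_eqb (lf e) v)).
      - intros e _. apply orb_comm.
      - intros e He. apply andb_false_iff. apply (pg_ori _ _ _ _ HG) in He.
        destruct (pt_eqb (rg e) v) eqn:E1; auto. destruct (pt_eqb (lf e) v) eqn:E2; auto.
        apply pt_eqb_iff in E1, E2. rewrite E1, E2 in He; lra. }
    apply Permutation_app; [|exact HRp].
    apply NoDup_Permutation.
    - apply NoDup_filter, (pg_nodup _ _ _ _ HG).
    - apply NoDup_app_remove_l in Hnd. now apply NoDup_app_remove_r in Hnd.
    - intros e. rewrite filter_In, pt_eqb_iff. split.
      + intros [He Hr]. apply HLv; auto. apply Hw. split; [auto|split; [|simpl; auto]].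
        assert (H1 := pg_lf _ _ _ _ HG e He). assert (H2 := pg_ori _ _ _ _ HG e He).
        rewrite Hr in H2. apply in_app_iff in H1 as [H1|[H1|H1]]; auto.
        * rewrite <- H1 in H2; lra.
        * apply Hv2 in H1; lra.
      + intros He. assert (He' : In e (A ++ L ++ B)) by (rewrite !in_app_iff; auto).
        split; [apply Hold; auto|]. apply HLv; auto. }
  assert (Hnd' : NoDup (A ++ Rv ++ B)).
  { assert (HAR : forall e, In e (A ++ B) -> ~ In e Rv).
    { intros e He. apply Hdisj. apply Hold.
      rewrite in_app_iff in He; rewrite !in_app_iff; tauto. }
    assert (HAB : NoDup (A ++ B)).
    { clear -Hnd. induction L as [|a L IH]; auto. apply IH.
      simpl in Hnd. now apply NoDup_remove_1 in Hnd. }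
    apply (Permutation_NoDup (l := Rv ++ A ++ B)).
    - apply Permutation_app_swap_app.
    - apply NoDup_app; auto. intros e He HR. eapply HAR; eauto. }
  assert (HE1 : length (filter (fun e =>
       if in_dec point_eq_dec (lf e) (V1 ++ [v]) then true else false) E) =
     (length (filter (fun e => if in_dec point_eq_dec (lf e) V1 then true else false) E)
      + length Rv)%nat).
  { rewrite <- (Permutation_length HRp), <- length_app. apply Permutation_length.
    apply filter_perm_split; intros e _.
    - destruct (in_dec point_eq_dec (lf e) (V1 ++ [v])) as [i|i];
        rewrite in_app_iff in i; simpl in i;
        destruct (in_dec point_eq_dec (lf e) V1); simpl; try tauto;
        unfold pt_eqb; destruct (point_eq_dec (lf e) v); auto;
        exfalso; intuition congruence.
    - destruct (in_dec point_eq_dec (lf e) V1); auto.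
      unfold pt_eqb; destruct (point_eq_dec (lf e) v); auto. congruence. }
  assert (Hstar1 : forall u e, In u V1 -> In e (star lf rg E u) -> In e E /\ In (lf e) V1).
  { intros u e Hu He. unfold star in He. apply filter_In in He as [He Hi]. split; auto.
    apply orb_true_iff in Hi. rewrite !pt_eqb_iff in Hi.
    destruct Hi as [Hi|Hi]; [congruence|].
    assert (H1 := pg_lf _ _ _ _ HG e He). assert (H2 := pg_ori _ _ _ _ HG e He).
    apply in_app_iff in H1 as [H1|H1]; auto.
    specialize (HV12 _ _ Hu H1). rewrite Hi in H2; lra. }
  apply chain_app in Hchain as (lo & HcA & Hchain).
  apply chain_app in Hchain as (hi & HcL & HcB).
  assert (Hlohi : In lo (0%nat :: Fl) /\ In hi (0%nat :: Fl)).
  { assert (Haux : forall l a b, chain up dn a l b -> In a (0%nat :: Fl) ->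
       incl l (A ++ L ++ B) -> In b (0%nat :: Fl)).
    { induction l as [|e l IH]; simpl; intros a b.
      - intros -> H _; auto.
      - intros [_ H] _ Hi. apply (IH (up e)); auto.
        + apply Hlab; apply Hold; apply Hi; simpl; auto.
        + intros y Hy; apply Hi; simpl; auto. }
    assert (Hlo : In lo (0%nat :: Fl)).
    { apply (Haux A 0%nat); simpl; auto. intros y Hy; rewrite !in_app_iff; auto. }
    split; auto. apply (Haux L lo); auto. intros y Hy; rewrite !in_app_iff; auto. }
  destruct (list_eq_dec dec Rv []) as [HR0|HR0].
  - (* no edge leaves [v] to the right: the faces below and above [v] merge *)
    set (src := if Nat.eq_dec lo 0 then hi else lo).
    set (dst := if Nat.eq_dec lo 0 then lo else hi).
    set (g := fun a => if Nat.eq_dec a src then dst else a).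
    (* The unbounded face keeps its label: [src] is 0 only if both faces are the unbounded one. *)
    assert (Hg0 : g 0%nat = 0%nat).
    { unfold g, src, dst. destruct (Nat.eq_dec lo 0); destruct (Nat.eq_dec 0 _); congruence. }
    assert (Hglo : g lo = dst).
    { unfold g, src, dst. destruct (Nat.eq_dec lo 0); destruct (Nat.eq_dec lo _); congruence. }
    assert (Hghi : g hi = dst).
    { unfold g, src, dst. destruct (Nat.eq_dec lo 0); destruct (Nat.eq_dec hi _); congruence. }
    assert (Hdst : In dst (0%nat :: Fl)) by (unfold dst; destruct (Nat.eq_dec lo 0); tauto).
    (* If the two faces already coincide, as at an isolated vertex, no label is given up. *)
    set (Fl' := if Nat.eq_dec src dst then Fl else remove Nat.eq_dec src Fl).
    assert (HFl' : forall a, In a Fl' <-> In a Fl /\ (a = src -> src = dst)).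
    { intros a. unfold Fl'. destruct (Nat.eq_dec src dst) as [H|H]; [tauto|]. split.
      - intros Ha. apply in_remove in Ha. intuition congruence.
      - intros [Ha H']. apply in_in_remove; auto. }
    assert (Hgl : forall a, In a (0%nat :: Fl) -> In (g a) (0%nat :: Fl')).
    { intros a Ha. unfold g. destruct (Nat.eq_dec a src) as [->|Hn].
      - destruct Hdst as [<-|Hd]; [now left|]. right. apply HFl'. split; auto.
      - destruct Ha as [<-|Ha]; [now left|]. right. apply HFl'. split; auto. congruence. }
    set (up' := fun e => g (up e)). set (dn' := fun e => g (dn e)).
    assert (Hc' : chain up' dn' 0%nat (A ++ Rv ++ B) 0%nat).
    { rewrite HR0. simpl. apply chain_app. exists dst.
      apply (chain_map g) in HcA, HcB.
      rewrite Hg0 in HcA, HcB. rewrite Hglo in HcA. rewrite Hghi in HcB. auto. }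
    exists (A ++ Rv ++ B), up', dn', Fl'. split; auto.
    + intros u phi Hu.
      assert (Hsp : forall l, xsum (side_parity up' dn' phi) l =
                xsum (side_parity up dn (fun a => phi (g a))) l)
        by (intros l; apply xsum_ext; reflexivity).
      rewrite Hsp. apply in_app_iff in Hu as [Hu|[<-|[]]]; [now apply Heven|].
      (* Around [v] there is only [L], and after the merge its chain starts and ends in the same
         face. *)
      rewrite (xsum_perm _ _ _ Hstar), HR0, app_nil_r.
      rewrite (chain_xsum _ _ _ _ _ _ HcL), Hglo, Hghi. apply xorb_nilpotent.
    + unfold Fl'. destruct (Nat.eq_dec src dst); auto. now apply NoDup_remove_nat.
    + intros H. apply HFl' in H. tauto.
    + intros e He Hl. apply in_app_iff in Hl as [Hl|[Hl|[]]].
      * split; apply Hgl, Hlab; auto.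
      * assert (HeR : In e Rv) by (apply HRv; auto). rewrite HR0 in HeR. easy.
    + intros a Ha. apply HFl' in Ha as [Ha Has].
      assert (Ha0 : 0%nat <> a) by congruence.
      destruct (Nat.eq_dec a dst) as [->|Had].
      * (* the merged face still meets the sweep line *)
        destruct A as [|e0 A0] eqn:EA.
        { simpl in HcA. subst lo. unfold dst in Ha0. now destruct (Nat.eq_dec 0 0). }
        rewrite <- EA in *.
        assert (HeA : exists e, In e A /\ up e = lo).
        { clear -HcA EA. subst A. revert e0 HcA. generalize 0%nat.
          induction A0 as [|e1 A0 IH]; intros n e0 [_ H].
          - exists e0; simpl in *; auto.
          - destruct (IH _ _ H) as (e & He & Hu). exists e; simpl in *; tauto. }
        destruct HeA as (e & He & Hue).
        destruct (chain_change up' dn' dst _ _ _ e Hc' Ha0) as (e' & He' & Hs).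
        { apply in_app_iff; auto. }
        { left. unfold up'. congruence. }
        exists e'. apply HwA in He'. tauto.
      * destruct (Hbd a Ha) as (e & He & Hl & Hs). exists e. split; [auto|split].
        { apply in_app_iff; auto. }
        rewrite <- Hs. unfold side_parity, up', dn'.
        (* A face other than the merged one keeps its boundary. *)
        assert (Hga : forall b, Nat.eqb a (g b) = Nat.eqb a b).
        { intros b. unfold g. destruct (Nat.eq_dec b src) as [->|]; auto.
          transitivity false; [|symmetry]; apply Nat.eqb_neq; auto.
          intros ->. apply Had. now rewrite Has. }
        now rewrite !Hga.
    + rewrite HE1, HR0, length_app. simpl.
      assert (length Fl <= S (length Fl'))%nat; [|lia].
      unfold Fl'. destruct (Nat.eq_dec src dst); [lia|]. now apply length_remove_nat.
  (* Every label from [N] on is free; the faces [lo] and [hi] keep theirs. *)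
  - set (N := S (list_max (0%nat :: Fl))).
    assert (HN : forall a, In a (0%nat :: Fl) -> (a < N)%nat).
    { intros a Ha. unfold N. apply Nat.lt_succ_r.
      assert (H := proj1 (list_max_le (0%nat :: Fl) _) (Nat.le_refl _)).
      rewrite Forall_forall in H. auto. }
    destruct (chain_relabel dec up dn hi Rv HRnd HR0 lo N)
      as (up' & dn' & Fn & Ho & Hc & HnF & HF & Hlen & Hlb & Hus).
    assert (Ho1 : forall e, In (lf e) V1 -> up' e = up e /\ dn' e = dn e)
      by (intros e He; apply Ho, Hdisj, He).
    assert (Hc' : chain up' dn' 0%nat (A ++ Rv ++ B) 0%nat).
    { apply chain_app. exists lo. split.
      - revert HcA. apply chain_ext. intros e He. apply Ho1, Hold.
        rewrite !in_app_iff; auto.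
      - apply chain_app. exists hi. split; auto.
        revert HcB. apply chain_ext. intros e He. apply Ho1, Hold.
        rewrite !in_app_iff; auto. }
    assert (Hincl : incl (lo :: hi :: Fn) (0%nat :: Fl ++ Fn)).
    { intros a. simpl. rewrite in_app_iff. destruct Hlohi as [H1 H2].
      simpl in H1, H2. intuition (subst; auto). }
    exists (A ++ Rv ++ B), up', dn', (Fl ++ Fn). split; auto.
    + intros u phi Hu. apply in_app_iff in Hu as [Hu|[<-|[]]].
      * rewrite <- (Heven u phi Hu). apply xsum_ext. intros e He.
        apply (Hstar1 u) in He as [_ He]; auto. unfold side_parity.
        destruct (Ho1 e He) as [-> ->]. reflexivity.
      (* Both [L] and [Rv] lead from [lo] to [hi], so their sums cancel. *)
      * rewrite (xsum_perm _ _ _ Hstar), xsum_app.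
        rewrite (chain_xsum _ _ _ _ _ _ Hc).
        rewrite (chain_xsum up' dn' phi lo L hi).
        { apply xorb_nilpotent. }
        revert HcL. apply chain_ext. intros e He. apply Ho1, Hold.
        rewrite !in_app_iff; auto.
    + apply NoDup_app; auto. intros a Ha Ha'. apply HF in Ha'.
      specialize (HN a (or_intror Ha)). lia.
    + rewrite in_app_iff. intros [H|H]; auto. apply HF in H.
      specialize (HN 0%nat (or_introl eq_refl)). lia.
    + intros e He Hl. apply in_app_iff in Hl as [Hl|[Hl|[]]].
      * destruct (Ho1 e Hl) as [-> ->]. destruct (Hlab e He Hl) as [H1 H2].
        simpl in *; rewrite !in_app_iff; tauto.
      * assert (HeR : In e Rv) by (apply HRv; auto).
        destruct (Hlb e HeR). split; apply Hincl; auto.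
    + intros a Ha. apply in_app_iff in Ha as [Ha|Ha].
      * destruct (Hbd a Ha) as (e & He & Hl & Hs). exists e. split; [auto|split].
        { apply in_app_iff; auto. }
        unfold side_parity in *. destruct (Ho1 e Hl) as [-> ->]. auto.
      * destruct (Hus a Ha) as (e & He & Hue).
        assert (Ha0 : 0%nat <> a).
        { apply HF in Ha. specialize (HN 0%nat (or_introl eq_refl)). lia. }
        destruct (chain_change up' dn' a _ _ _ e Hc' Ha0) as (e' & He' & Hs); auto.
        { rewrite !in_app_iff; auto. }
        exists e'. apply HwA in He'. tauto.
    + rewrite HE1, !length_app. simpl. lia.
Qed.

Lemma sweep_all {T} (dec : forall x y : T, {x = y} + {x <> y})
    (lf rg : T -> point) E V :
  plane_graph lf rg E V -> ForallOrdPairs (fun u v => fst u < fst v) V ->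
  exists w up dn Fl, sweep lf rg E V [] w up dn Fl.
Proof.
  intros HG HV.
  assert (H : forall V2 V1, V = V1 ++ V2 ->
    (exists w up dn Fl, sweep lf rg E V1 V2 w up dn Fl) ->
    exists w up dn Fl, sweep lf rg E V [] w up dn Fl).
  { induction V2 as [|v V2 IH]; intros V1 HE (w & up & dn & Fl & Hs).
    - rewrite app_nil_r in HE; subst. eauto.
    - apply (IH (V1 ++ [v])); [now rewrite <- app_assoc|].
      subst V. eapply sweep_step; eauto. }
  apply (H V []); auto.
  exists [], (fun _ => 0%nat), (fun _ => 0%nat), [].
  split; simpl; try easy; try constructor; try (intros; easy); try tauto.
  clear. induction E; simpl; auto.
Qed.

(** What is kept of a face boundary: it is not empty and has no vertex of degree one. Such a set
    already contains a cycle. *)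
Definition even_set {T} (lf rg : T -> point) (E : list T) (Z : T -> bool) : Prop :=
  (exists e, In e E /\ Z e = true) /\
  forall v e, In e E -> Z e = true -> lf e = v \/ rg e = v ->
    exists e', In e' E /\ e' <> e /\ Z e' = true /\ (lf e' = v \/ rg e' = v).

(* Mac Lane's form of Euler's formula; the [Zs] are the boundaries of the bounded faces. *)
Lemma plane_graph_faces {T} (dec : forall x y : T, {x = y} + {x <> y})
    (lf rg : T -> point) E V :
  plane_graph lf rg E V -> NoDup V ->
  (forall u v, In u V -> In v V -> fst u = fst v -> u = v) ->
  exists Zs : list (T -> bool),
    (length E <= length Zs + length V)%nat /\
    (forall Z, In Z Zs -> even_set lf rg E Z) /\
    (forall e, In e E -> (length (filter (fun Z => Z e) Zs) <= 2)%nat).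
Proof.
  intros HG HN Hx.
  destruct (sort_by_key (fun v : point => fst v) V) as (V' & HP & HS).
  assert (HG' : plane_graph lf rg E V').
  { destruct HG as [? ? h3 h4 ? h6]; split; auto; intros.
    - eapply Permutation_in; eauto.
    - eapply Permutation_in; eauto.
    - apply h6; auto. eapply Permutation_in; [apply Permutation_sym|]; eauto. }
  assert (HS' : ForallOrdPairs (fun u v => fst u < fst v) V').
  { assert (HN' : NoDup V') by (eapply Permutation_NoDup; eauto).
    assert (Hx' : forall u v, In u V' -> In v V' -> fst u = fst v -> u = v).
    { intros; apply Hx; auto; eapply Permutation_in; try apply Permutation_sym; eauto. }
    clear -HS HN' Hx'. induction HS as [|a l Ha Hl IH]; constructor.
    - inversion HN'; subst. rewrite Forall_forall in *. intros y Hy.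
      destruct (Ha y Hy) as [H|H]; auto. exfalso.
      assert (a = y) by (apply Hx'; simpl; auto). congruence.
    - inversion HN'; subst. apply IH; auto. intros; apply Hx'; simpl; auto. }
  destruct (sweep_all dec lf rg E V' HG' HS') as (w & up & dn & Fl & Hs).
  exists (map (fun a => side_parity up dn (Nat.eqb a)) Fl).
  destruct Hs as [_ _ _ _ Hev HFl HFl0 Hlab Hbd Hc].
  split; [|split].
  - rewrite length_map. rewrite (Permutation_length HP).
    rewrite forallb_filter_id in Hc; auto. apply forallb_forall. intros e He.
    destruct (in_dec point_eq_dec (lf e) V') as [|n]; auto.
    exfalso; apply n. eapply pg_lf; eauto.
  - intros Z HZ. apply in_map_iff in HZ as (a & <- & Ha). split.
    + destruct (Hbd a Ha) as (e & He & _ & H); eauto.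
    + intros v e He HZ Hi.
      assert (Hin : forall e', In e' (star lf rg E v) <->
          In e' E /\ (lf e' = v \/ rg e' = v)).
      { intros e'. unfold star. rewrite filter_In, orb_true_iff, !pt_eqb_iff. tauto. }
      assert (Hv : In v V').
      { destruct Hi as [<-|<-]; [eapply pg_lf|eapply pg_rg]; eauto. }
      destruct (xsum_other _ (star lf rg E v) e
         (NoDup_filter _ (pg_nodup _ _ _ _ HG)) (proj2 (Hin e) (conj He Hi)) HZ
         (Hev v (Nat.eqb a) Hv))
        as (e' & He' & Hne & HZ').
      apply Hin in He'. exists e'; tauto.
  (* An edge can lie only on the boundaries of the faces on its two sides. *)
  - intros e He.
    transitivity (length (filter (fun a => side_parity up dn (Nat.eqb a) e) Fl)).
    { clear. induction Fl as [|a Fl IH]; simpl; auto.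
      destruct (side_parity up dn (Nat.eqb a) e); simpl; lia. }
    change 2%nat with (length [up e; dn e]).
    apply NoDup_incl_length; [now apply NoDup_filter|].
    intros a Ha. apply filter_In in Ha as [_ Ha]. unfold side_parity in Ha.
    destruct (Nat.eqb_spec a (up e)); [simpl; auto|].
    destruct (Nat.eqb_spec a (dn e)); [simpl; auto|easy].
Qed.

(** * Edge bounds from the length of faces *)

Lemma double_count {T U} (r : T -> U -> bool) (g h : nat) (l : list T) (k : list U) :
  (forall y, In y k -> (g <= length (filter (fun x => r x y) l))%nat) ->
  (forall x, In x l -> (length (filter (r x) k) <= h)%nat) ->
  (g * length k <= h * length l)%nat.
Proof.
  intros H1 H2.
  assert (E1 : (g * length k <= list_sum (map (fun y => length (filter (fun x => r x y) l)) k))%nat).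
  { clear H2. induction k as [|y k IH]; simpl; [lia|].
    specialize (IH (fun z Hz => H1 z (or_intror Hz))).
    specialize (H1 y (or_introl eq_refl)). lia. }
  assert (E2 : (list_sum (map (fun x => length (filter (r x) k)) l) <= h * length l)%nat).
  { clear H1 E1. induction l as [|y l IH]; simpl; [lia|].
    specialize (IH (fun z Hz => H2 z (or_intror Hz))).
    specialize (H2 y (or_introl eq_refl)). lia. }
  enough (list_sum (map (fun y => length (filter (fun x => r x y) l)) k) =
          list_sum (map (fun x => length (filter (r x) k)) l)) by lia.
  clear. induction l as [|x l IH]; simpl.
  - induction k; simpl; auto.
  - rewrite <- IH. clear. induction k as [|y k IH]; simpl; auto.
    destruct (r x y); simpl; lia.
Qed.

(** Euler's formula gives |E| - |V| <= F; every boundary has at least [g] edges and every edge lies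
    on at most two boundaries, so g F <= 2 |E|. *)
Lemma plane_graph_girth {T} (dec : forall x y : T, {x = y} + {x <> y})
    (lf rg : T -> point) E V g :
  plane_graph lf rg E V -> NoDup V ->
  (forall u v, In u V -> In v V -> fst u = fst v -> u = v) ->
  (forall Z, even_set lf rg E Z -> exists l, NoDup l /\ length l = g /\
     forall e, In e l -> In e E /\ Z e = true) ->
  (g * length E <= 2 * length E + g * length V)%nat.
Proof.
  intros HG HN Hx Hg.
  destruct (plane_graph_faces dec lf rg E V HG HN Hx) as (Zs & Hl & HZ & H2).
  assert (H := double_count (fun e (Z : T -> bool) => Z e) g 2 E Zs).
  assert (g * length Zs <= 2 * length E)%nat; [|nia].
  apply H; auto. intros Z HinZ.
  destruct (Hg Z (HZ Z HinZ)) as (l & Hnd & <- & Hin).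
  apply NoDup_incl_length; auto. intros e He. apply filter_In. auto.
Qed.

(** * Counting in sparse bipartite graphs *)

Definition bip (B R : list point) (E : list (point * point)) : Prop :=
  forall e, In e E -> In (fst e) B /\ In (snd e) R.

(** The bipartite form of [even_set], with the two sides separated so that a walk can alternate
    between them. *)
Definition leafless (E : list (point * point)) (Z : point * point -> bool) : Prop :=
  (exists e, In e E /\ Z e = true) /\
  (forall b o, In (b, o) E -> Z (b, o) = true ->
     exists o', In (b, o') E /\ Z (b, o') = true /\ o' <> o) /\
  (forall b o, In (b, o) E -> Z (b, o) = true ->
     exists b', In (b', o) E /\ Z (b', o) = true /\ b' <> b).

(** The trace of planarity that the counting uses, freed of the drawing: if every leafless set has
    [g] edges, then (g - 2) |E| <= g |V|. *)
Definition sparse (B R : list point) (E : list (point * point)) : Prop :=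
  forall g, (forall Z, leafless E Z -> exists l, NoDup l /\ length l = g /\
     forall e, In e l -> In e E /\ Z e = true) ->
  (g * length E <= 2 * length E + g * (length B + length R))%nat.

(** A walk inside a leafless set can always go on without turning back, and in a bipartite graph its
    first four edges are distinct; hence [g] is 4. *)
Lemma sparse_bipartite B R E :
  sparse B R E -> (length E <= 2 * (length B + length R))%nat.
Proof.
  intros Hs. enough (4 * length E <= 2 * length E + 4 * (length B + length R))%nat by lia.
  apply Hs. intros Z (([b o] & He & HZ) & Hb & Ho).
  destruct (Hb b o He HZ) as (o1 & He1 & HZ1 & N1).
  destruct (Ho b o1 He1 HZ1) as (b1 & He2 & HZ2 & N2).
  destruct (Hb b1 o1 He2 HZ2) as (o2 & He3 & HZ3 & N3).
  exists [(b, o); (b, o1); (b1, o1); (b1, o2)]. split; [|split].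
  - repeat constructor; simpl; intuition congruence.
  - reflexivity.
  - simpl. intuition (subst; auto).
Qed.

(** Here six edges of the walk are distinct: [o2 = o] would give [b] and [b1] two common neighbours,
    and [b2 = b] would give [b] a third neighbour. Hence [g] is 6. *)
Lemma sparse_hexagonal B R E :
  sparse B R E ->
  (forall b o1 o2 o3, In (b, o1) E -> In (b, o2) E -> In (b, o3) E ->
     o1 = o2 \/ o1 = o3 \/ o2 = o3) ->
  (forall b b' o o', b <> b' -> o <> o' -> In (b, o) E -> In (b, o') E ->
     In (b', o) E -> In (b', o') E -> False) ->
  (4 * length E <= 6 * (length B + length R))%nat.
Proof.
  intros Hs H2 Hd. enough (6 * length E <= 2 * length E + 6 * (length B + length R))%nat by lia.
  apply Hs. intros Z (([b o] & He & HZ) & Hb & Ho).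
  destruct (Hb b o He HZ) as (o1 & He1 & HZ1 & N1).
  destruct (Ho b o1 He1 HZ1) as (b1 & He2 & HZ2 & N2).
  destruct (Hb b1 o1 He2 HZ2) as (o2 & He3 & HZ3 & N3).
  assert (N4 : o2 <> o) by (intros ->; apply (Hd b b1 o o1); auto).
  destruct (Ho b1 o2 He3 HZ3) as (b2 & He4 & HZ4 & N5).
  assert (N6 : b2 <> b).
  { intros ->. destruct (H2 b o o1 o2 He He1 He4) as [|[|]]; congruence. }
  destruct (Hb b2 o2 He4 HZ4) as (o3 & He5 & HZ5 & N7).
  exists [(b, o); (b, o1); (b1, o1); (b1, o2); (b2, o2); (b2, o3)]. split; [|split].
  - repeat constructor; simpl; intuition congruence.
  - reflexivity.
  - simpl. intuition (subst; auto).
Qed.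

(** Every element is related to at most one other, so two classes can be filled greedily: an element
    refused by both would be related to a member of each. *)
Lemma no_triple_split {T}
    (eqv : T -> T -> Prop) (l : list T) :
  (forall x y, eqv x y -> eqv y x) -> NoDup l ->
  (forall x y z, In x l -> In y l -> In z l -> x <> y -> x <> z -> y <> z ->
     eqv x y -> eqv x z -> False) ->
  exists l1 l2, Permutation l (l1 ++ l2) /\
    (forall x y, In x l1 -> In y l1 -> x <> y -> ~ eqv x y) /\
    (forall x y, In x l2 -> In y l2 -> x <> y -> ~ eqv x y).
Proof.
  intros Hsym Hn H3. induction Hn as [|a l Ha Hn IH].
  - exists [], []; repeat split; auto.
  - destruct IH as (l1 & l2 & HP & H1 & H2).
    { intros x y z Hx Hy Hz; apply H3; simpl; auto. }
    assert (Hin1 : forall x, In x l1 \/ In x l2 -> In x l).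
    { intros x Hx. eapply Permutation_in; [apply Permutation_sym, HP|].
      apply in_app_iff; auto. }
    destruct (excluded_middle_informative (exists y, In y l1 /\ eqv a y)) as [(y & Hy & Ey)|N1].
    + destruct (excluded_middle_informative (exists z, In z l2 /\ eqv a z)) as [(z & Hz & Ez)|N2].
      * exfalso.
        assert (Hay : a <> y) by (intros ->; apply Ha; auto).
        assert (Haz : a <> z) by (intros ->; apply Ha; auto).
        assert (Hyz : y <> z).
        { intros ->. assert (Hn' : NoDup (l1 ++ l2)) by (eapply Permutation_NoDup; eauto).
          apply in_split in Hy as (u1 & u2 & ->). rewrite <- app_assoc in Hn'. simpl in Hn'.
          apply NoDup_remove_2 in Hn'. apply Hn'. rewrite !in_app_iff; auto. }
        apply (H3 a y z); simpl; auto.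
      * exists l1, (a :: l2). split; [now apply Permutation_cons_app|]. split; auto.
        intros x y' [<-|Hx] [<-|Hy'] Hne He; [easy| | |exact (H2 _ _ Hx Hy' Hne He)]; apply N2; eauto.
    + exists (a :: l1), l2. split; [now constructor|]. split; auto.
      intros x y [<-|Hx] [<-|Hy] Hne He; [easy| | |exact (H1 _ _ Hx Hy Hne He)]; apply N1; eauto.
Qed.

Definition nbrs (E : list (point * point)) (b : point) : list point :=
  map snd (filter (fun e => pt_eqb (fst e) b) E).

Lemma in_nbrs E b o : In o (nbrs E b) <-> In (b, o) E.
Proof.
  unfold nbrs. rewrite in_map_iff. split.
  - intros ([b' o'] & <- & H). apply filter_In in H as [H H'].
    apply pt_eqb_iff in H'. simpl in *; congruence.
  - intros H. exists (b, o). split; auto. apply filter_In. split; auto.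
    now apply pt_eqb_iff.
Qed.

Lemma NoDup_nbrs E b : NoDup E -> NoDup (nbrs E b).
Proof.
  intros H. unfold nbrs. apply NoDup_filter with (f := fun e => pt_eqb (fst e) b) in H as H'.
  assert (Hb : forall e, In e (filter (fun e => pt_eqb (fst e) b) E) -> fst e = b).
  { intros e He. apply filter_In in He as [_ He]. now apply pt_eqb_iff in He. }
  induction H' as [|[b1 o1] l Hx Hn IH]; simpl; constructor.
  - intros Hin. apply in_map_iff in Hin as ([b2 o2] & Eo & Hin). simpl in Eo; subst.
    assert (b1 = b) by (apply (Hb (b1, o1)); simpl; auto).
    assert (b2 = b) by (apply (Hb (b2, o1)); simpl; auto). congruence.
  - apply IH. intros; apply Hb; simpl; auto.
Qed.

Definition edges_from (E : list (point * point)) (B : list point) :=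
  filter (fun e => if in_dec point_eq_dec (fst e) B then true else false) E.

Lemma in_edges_from E B b o : In (b, o) (edges_from E B) <-> In (b, o) E /\ In b B.
Proof.
  unfold edges_from. rewrite filter_In. simpl.
  destruct (in_dec point_eq_dec b B); intuition congruence.
Qed.

Lemma length_edges_from E B d :
  NoDup B -> (forall b, In b B -> (d <= length (nbrs E b))%nat) ->
  (d * length B <= length (edges_from E B))%nat.
Proof.
  intros Hn Hd.
  assert (H := double_count (fun e b => pt_eqb (fst e) b) d 1 (edges_from E B) B).
  rewrite Nat.mul_1_l in H. apply H; clear H.
  - intros b Hb. specialize (Hd b Hb). unfold nbrs in Hd. rewrite length_map in Hd.
    enough (filter (fun e => pt_eqb (fst e) b) E =
            filter (fun e => pt_eqb (fst e) b) (edges_from E B)) as <- by auto.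
    clear -Hb. unfold edges_from. induction E as [|e E IH]; simpl; auto.
    destruct (in_dec point_eq_dec (fst e) B) as [i|i]; simpl.
    + destruct (pt_eqb (fst e) b); congruence.
    + destruct (pt_eqb (fst e) b) eqn:Eb; auto. apply pt_eqb_iff in Eb; congruence.
  - intros e _. change 1%nat with (length [fst e]).
    apply NoDup_incl_length; [now apply NoDup_filter|].
    intros b Hb. apply filter_In in Hb as [_ Hb]. apply pt_eqb_iff in Hb. simpl; auto.
Qed.

(** In the last hypothesis [Rs] stands for a set smaller than [Bs] that would contain all its
    neighbours; this is Hall's condition without naming neighbourhoods. Sparsity is assumed for
    subgraphs because it is applied to the vertices of each degree separately. *)
Lemma planar_hall B R E :
  NoDup B -> NoDup E -> bip B R E ->
  (forall E' B', incl E' E -> incl B' B -> NoDup E' -> NoDup B' -> bip B' R E' ->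
     sparse B' R E') ->
  (forall Bs Rs, NoDup Bs -> incl Bs B -> incl Rs R -> (length Bs <= 3)%nat ->
     (length Rs < length Bs)%nat ->
     exists b o, In b Bs /\ In (b, o) E /\ ~ In o Rs) ->
  (length B <= 9 * length R)%nat.
Proof.
  intros HB HE Hbip Hsp Hall.
  set (deg := fun b => length (nbrs E b)).
  set (B1 := filter (fun b => Nat.eqb (deg b) 1) B).
  set (B2 := filter (fun b => Nat.eqb (deg b) 2) B).
  set (B3 := filter (fun b => Nat.leb 3 (deg b)) B).
  assert (Hlen : (length B <= length B1 + length B2 + length B3)%nat).
  { assert (Hdeg : forall b, In b B -> (1 <= deg b)%nat).
    { intros b Hb. destruct (Hall [b] []) as (b' & o & Hb' & Ho & _); simpl; auto.
      - repeat constructor; auto.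
      - intros x [<-|[]]; auto.
      - easy.
      - destruct Hb' as [<-|[]]. apply in_nbrs in Ho. unfold deg.
        destruct (nbrs E b); [easy|simpl; lia]. }
    unfold B1, B2, B3. clear -Hdeg. induction B as [|b B IH]; cbn [filter length]; auto.
    specialize (IH (fun x Hx => Hdeg x (or_intror Hx))).
    specialize (Hdeg b (or_introl eq_refl)).
    destruct (Nat.eqb_spec (deg b) 1); destruct (Nat.eqb_spec (deg b) 2);
      destruct (Nat.leb_spec 3 (deg b)); cbn [length]; lia. }
  assert (Hsub : forall f, incl (filter f B) B)
    by (intros f x Hx; apply filter_In in Hx; tauto).
  assert (Hsparse : forall B', incl B' B -> NoDup B' -> sparse B' R (edges_from E B')).
  { intros B' Hi Hn. apply Hsp; auto.
    - intros e He. unfold edges_from in He. apply filter_In in He; tauto.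
    - now apply NoDup_filter.
    - intros [b o] He. apply in_edges_from in He as [He Hb]. split; auto.
      apply (Hbip _ He). }
  assert (H1 : (length B1 <= length R)%nat).
  { assert (Hnb : forall b, In b B1 -> exists o, nbrs E b = [o] /\ In o R).
    { intros b Hb. unfold B1 in Hb. apply filter_In in Hb as [Hb Hd].
      apply Nat.eqb_eq in Hd. unfold deg in Hd.
      destruct (nbrs E b) as [|o [|]] eqn:En; simpl in Hd; try lia.
      exists o; split; auto.
      assert (Ho : In (b, o) E) by (apply in_nbrs; rewrite En; simpl; auto).
      apply (Hbip _ Ho). }
    set (f := fun b => hd b (nbrs E b)).
    assert (Hf : NoDup (map f B1)).
    { apply NoDup_map_NoDup_ForallPairs; [|now apply NoDup_filter].
      intros b b' Hb Hb' Ef. apply NNPP; intros Hne.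
      destruct (Hnb b Hb) as (o & En & Ho). destruct (Hnb b' Hb') as (o' & En' & Ho').
      unfold f in Ef. rewrite En, En' in Ef. simpl in Ef. subst o'.
      destruct (Hall [b; b'] [o]) as (c & p & Hc & Hp & Hn); simpl; auto.
      - repeat constructor; simpl; intuition congruence.
      - intros x [<-|[<-|[]]]; eapply Hsub; eauto.
      - intros x [<-|[]]; auto.
      - apply in_nbrs in Hp. apply Hn. destruct Hc as [<-|[<-|[]]];
          [rewrite En in Hp|rewrite En' in Hp]; simpl in *; tauto. }
    rewrite <- (length_map f). apply NoDup_incl_length; auto.
    intros o Ho. apply in_map_iff in Ho as (b & <- & Hb).
    destruct (Hnb b Hb) as (o & En & Ho). unfold f; rewrite En; auto. }
  assert (H3 : (length B3 <= 2 * length R)%nat).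
  { assert (Hn3 : NoDup B3) by now apply NoDup_filter.
    assert (Hs := Hsparse B3 (Hsub _) Hn3). apply sparse_bipartite in Hs.
    assert (H := length_edges_from E B3 3 Hn3).
    (* Together with sparsity this reads 3 |B3| <= 2 (|B3| + |R|). *)
    assert (3 * length B3 <= length (edges_from E B3))%nat; [|lia].
    apply H. intros b Hb. unfold B3 in Hb. apply filter_In in Hb as [_ Hb].
    now apply Nat.leb_le in Hb. }
  assert (Hpair : forall B', incl B' B2 -> NoDup B' ->
     (forall x y, In x B' -> In y B' -> x <> y -> ~ incl (nbrs E x) (nbrs E y)) ->
     (length B' <= 3 * length R)%nat).
  { intros B' Hi Hn Hd.
    assert (HiB : incl B' B) by (intros x Hx; apply Hi in Hx; eapply Hsub; eauto).
    assert (Hdeg : forall b, In b B' -> length (nbrs E b) = 2%nat).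
    { intros b Hb. apply Hi, filter_In in Hb as [_ Hb]. now apply Nat.eqb_eq in Hb. }
    assert (Hs := Hsparse B' HiB Hn). apply sparse_hexagonal in Hs.
    - assert (H := length_edges_from E B' 2 Hn).
      (* Inserted into 4 |E| <= 6 (|B'| + |R|), this gives |B'| <= 3 |R|. *)
      assert (2 * length B' <= length (edges_from E B'))%nat; [|lia].
      apply H. intros b Hb. rewrite Hdeg; auto.
    - intros b o1 o2 o3 I1 I2 I3. apply in_edges_from in I1 as [I1 Hb].
      apply in_edges_from in I2 as [I2 _]. apply in_edges_from in I3 as [I3 _].
      apply in_nbrs in I1, I2, I3. specialize (Hdeg b Hb).
      destruct (nbrs E b) as [|p [|q [|]]]; simpl in *; try lia.
      intuition congruence.
    - intros b b' o o' Nb No I1 I2 I3 I4. apply in_edges_from in I1 as [I1 Hb].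
      apply in_edges_from in I2 as [I2 _]. apply in_edges_from in I3 as [I3 Hb'].
      apply in_edges_from in I4 as [I4 _]. apply in_nbrs in I1, I2, I3, I4.
      apply (Hd b b'); auto. specialize (Hdeg b Hb).
      destruct (nbrs E b) as [|p [|q [|]]]; simpl in *; try lia.
      intros x [<-|[<-|[]]]; intuition (subst; auto; congruence). }
  assert (H2 : (length B2 <= 6 * length R)%nat).
  { assert (Hn2 : NoDup B2) by now apply NoDup_filter.
    destruct (no_triple_split
      (fun x y => incl (nbrs E x) (nbrs E y) \/ incl (nbrs E y) (nbrs E x)) B2)
      as (l1 & l2 & HP & D1 & D2); auto.
    - tauto.
    - intros x y z Hx Hy Hz Nxy Nxz Nyz Exy Exz.
      assert (Hd : forall b, In b B2 -> length (nbrs E b) = 2%nat).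
      { intros b Hb. apply filter_In in Hb as [_ Hb]. now apply Nat.eqb_eq in Hb. }
      (* Between sets of two neighbours each, inclusion is equality, so related vertices have the
         same neighbours and three of them would violate Hall's condition. *)
      assert (Hrev : forall b b', In b B2 -> In b' B2 ->
         incl (nbrs E b) (nbrs E b') -> incl (nbrs E b') (nbrs E b)).
      { intros b b' Hb Hb' Hi. apply NoDup_length_incl; auto.
        - now apply NoDup_nbrs.
        - rewrite !Hd; auto. }
      destruct (Hall [x; y; z] (nbrs E x)) as (b & o & Hb & Ho & Hno).
      + repeat constructor; simpl; intuition congruence.
      + intros b [<-|[<-|[<-|[]]]]; eapply Hsub; eauto.
      + intros o Ho. apply in_nbrs in Ho. apply (Hbip _ Ho).
      + simpl; lia.
      + rewrite Hd by auto. simpl; lia.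
      + apply Hno. apply in_nbrs in Ho. destruct Hb as [<-|[<-|[<-|[]]]]; auto.
        * destruct Exy as [H|H]; [apply Hrev in H|]; auto.
        * destruct Exz as [H|H]; [apply Hrev in H|]; auto.
    - assert (Hn' : NoDup (l1 ++ l2)) by (eapply Permutation_NoDup; eauto).
      assert (Hin : incl (l1 ++ l2) B2)
        by (intros x Hx; eapply Permutation_in; [apply Permutation_sym|]; eauto).
      rewrite (Permutation_length HP), length_app.
      assert (length l1 <= 3 * length R)%nat.
      { apply Hpair.
        - intros x Hx; apply Hin, in_app_iff; auto.
        - now apply NoDup_app_remove_r in Hn'.
        - intros x y Hx Hy N Hi; apply (D1 x y); auto. }
      assert (length l2 <= 3 * length R)%nat; [|lia].
      apply Hpair.
      + intros x Hx; apply Hin, in_app_iff; auto.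
      + now apply NoDup_app_remove_l in Hn'.
      + intros x y Hx Hy N Hi; apply (D2 x y); auto. }
  lia.
Qed.

(** * The exchange graph of two covers *)

(** Squared, so that [in_unit_disk c p] unfolds to [sqdist c p <= 1] and comparisons of distances
    are polynomial. *)
Definition sqdist (c p : point) : R := (fst p - fst c) ^ 2 + (snd p - snd c) ^ 2.

Lemma sqdist_pos a b : a <> b -> 0 < sqdist a b.
Proof.
  destruct a as [x y], b as [x' y']. unfold sqdist; cbn [fst snd]. intros H.
  destruct (Req_EM_T x x') as [Hx|Hx]; [destruct (Req_EM_T y y') as [Hy|Hy]|].
  - congruence.
  - assert (0 < (y' - y) ^ 2) by (rewrite <- Rsqr_pow2; apply Rsqr_pos_lt; lra).
    assert (H1 := pow2_ge_0 (x' - x)). lra.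
  - assert (0 < (x' - x) ^ 2) by (rewrite <- Rsqr_pow2; apply Rsqr_pos_lt; lra).
    assert (H1 := pow2_ge_0 (y' - y)). lra.
Qed.

Lemma sqdist_nonneg a b : 0 <= sqdist a b.
Proof.
  unfold sqdist. assert (H1 := pow2_ge_0 (fst b - fst a)).
  assert (H2 := pow2_ge_0 (snd b - snd a)). lra.
Qed.

Fixpoint nearest_from (q c0 : point) (l : list point) : point :=
  match l with
  | [] => c0
  | c :: l' => let b := nearest_from q c l' in
               if Rle_dec (sqdist c0 q) (sqdist b q) then c0 else b
  end.

(** Ties are settled by the order of the list, so that the result is a function of [q]; this keeps
    cocircular centres from producing crossing edges. The value for the empty list is a dummy. *)
Definition nearest (q : point) (l : list point) : point :=
  match l with [] => (0, 0) | c :: l' => nearest_from q c l' end.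

Lemma nearest_spec q l : l <> [] ->
  In (nearest q l) l /\ forall c, In c l -> sqdist (nearest q l) q <= sqdist c q.
Proof.
  destruct l as [|c l]; [easy|intros _]. simpl.
  revert c; induction l as [|b l IH]; intros c; simpl.
  - split; auto. intros x [<-|[]]; lra.
  - destruct (IH b) as [H1 H2]. simpl in H1, H2.
    destruct (Rle_dec (sqdist c q) (sqdist (nearest_from q b l) q)) as [H|H].
    + split; auto. intros x [<-|Hx]; [lra|]. specialize (H2 x Hx); lra.
    + split; [tauto|]. intros x [<-|Hx]; [lra|]. specialize (H2 x Hx); lra.
Qed.

Lemma argmax {T} (k : T -> R) (l : list T) : l <> [] ->
  exists x, In x l /\ forall y, In y l -> k y <= k x.
Proof.
  induction l as [|a l IH]; [easy|intros _]. destruct l as [|b l].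
  - exists a; simpl; split; auto. intros y [<-|[]]; lra.
  - destruct IH as (x & Hx & Hm); [easy|].
    destruct (Rle_dec (k a) (k x)) as [H|H].
    + exists x; split; [now right|]. intros y [<-|Hy]; auto.
    + exists a; split; [now left|]. intros y [<-|Hy]; [lra|]. specialize (Hm y Hy); lra.
Qed.

(** At parameter [t] of the segment from [p] to [o], the difference [sqdist c q - sqdist o q] is
    affine in [t], with the value [sqdist c o] at the end. The point [q] is the last place where a
    centre of [X] that starts no farther than [o] ties with [o], so no centre of [X] is nearer
    there. A centre tied with [o] at [q] was at least as near to [p] as [o], hence covers [p]. *)
Lemma balance_point (X Y : list point) p x0 o :
  In x0 X -> (forall x, In x X -> x <> o) ->
  (forall y, In y Y -> sqdist o p <= sqdist y p) -> sqdist x0 p <= sqdist o p -> sqdist o p <= 1 ->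
  exists q l, In l X /\ sqdist l q = sqdist o q /\
    (forall x, In x X -> sqdist o q <= sqdist x q) /\ (forall y, In y Y -> sqdist o q <= sqdist y q) /\
    (forall c, sqdist c q = sqdist o q -> sqdist c p <= 1).
Proof.
  intros Hx0 Hne HY H0 H1.
  set (g0 := fun x => sqdist x p - sqdist o p).
  (* The parameter at which [x] and [o] are equally far; it lies in [0, 1) for the centres of
     [X']. *)
  set (tau := fun x => g0 x / (g0 x - sqdist x o)).
  set (X' := filter (fun x => if Rle_dec (sqdist x p) (sqdist o p) then true else false) X).
  assert (HX' : forall x, In x X' <-> In x X /\ sqdist x p <= sqdist o p).
  { intros x. unfold X'. rewrite filter_In. destruct (Rle_dec (sqdist x p) (sqdist o p)); intuition congruence. }
  destruct (argmax tau X') as (l & Hl & Hmax).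
  { intros E. assert (Hin : In x0 X') by (apply HX'; auto). now rewrite E in Hin. }
  assert (Ht : forall x, In x X' -> 0 <= tau x < 1 /\ tau x * (sqdist x o - g0 x) = - g0 x).
  { intros x Hx. apply HX' in Hx as [Hx Hd]. assert (Hp := sqdist_pos x o (Hne x Hx)).
    assert (Hg : g0 x <= 0) by (unfold g0; lra).
    assert (Et : tau x * (sqdist x o - g0 x) = - g0 x) by (unfold tau; field; lra).
    split; auto. split.
    - apply Rmult_le_reg_r with (sqdist x o - g0 x); lra.
    - apply Rmult_lt_reg_r with (sqdist x o - g0 x); lra. }
  set (t := tau l). destruct (Ht l Hl) as [Ht01 Htl]. fold t in Ht01, Htl.
  set (q := (fst p + t * (fst o - fst p), snd p + t * (snd o - snd p))).
  assert (Hq : forall c, sqdist c q - sqdist o q = (1 - t) * g0 c + t * sqdist c o).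
  { intros c. unfold q, g0, sqdist; cbn [fst snd]. ring. }
  assert (Hqo : sqdist o q = (1 - t) * (1 - t) * sqdist o p) by (unfold q, sqdist; cbn [fst snd]; ring).
  exists q, l. apply HX' in Hl as Hl'. split; [tauto|].
  split; [specialize (Hq l); lra|]. split; [|split].
  - intros x Hx. specialize (Hq x). assert (Hp := sqdist_pos x o (Hne x Hx)).
    destruct (Rle_dec (sqdist x p) (sqdist o p)) as [Hd|Hd].
    + assert (Hx' : In x X') by (apply HX'; auto).
      destruct (Ht x Hx') as [Hx01 Hxt]. specialize (Hmax x Hx'). fold t in Hmax.
      assert (g0 x <= 0) by (unfold g0; lra). nra.
    + assert (0 < g0 x) by (unfold g0; lra). nra.
  - intros y Hy. specialize (Hq y). specialize (HY y Hy).
    assert (0 <= g0 y) by (unfold g0; lra).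
    assert (0 <= sqdist y o) by apply sqdist_nonneg. nra.
  - intros c Hc. specialize (Hq c). rewrite Hc in Hq. unfold g0 in Hq.
    assert (0 <= sqdist c o) by apply sqdist_nonneg. nra.
Qed.

(** The circle about [q] through its nearest centres is empty and carries both colours. *)
Definition balanced (L O : list point) (q : point) : Prop :=
  L <> [] /\ O <> [] /\ sqdist (nearest q L) q = sqdist (nearest q O) q.

Lemma exchange_point (L O : list point) p l o :
  (forall c, In c L -> ~ In c O) ->
  In l L -> sqdist l p <= 1 -> In o O -> sqdist o p <= 1 ->
  exists q, balanced L O q /\ sqdist (nearest q L) p <= 1 /\ sqdist (nearest q O) p <= 1.
Proof.
  intros Hdisj Hl Hlp Ho Hop.
  assert (HL : L <> []) by (intros ->; easy).
  assert (HO : O <> []) by (intros ->; easy).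
  (* [X] is the colour nearer to [p], and the motion is towards the nearest centre of [Y]; either
     colour can be the nearer one. *)
  assert (Hgen : forall X Y, X <> [] -> Y <> [] -> (forall c, In c X -> ~ In c Y) ->
     sqdist (nearest p X) p <= sqdist (nearest p Y) p -> sqdist (nearest p Y) p <= 1 ->
     exists q, sqdist (nearest q X) q = sqdist (nearest q Y) q /\
       sqdist (nearest q X) p <= 1 /\ sqdist (nearest q Y) p <= 1).
  { intros X Y HX HY Hd Hle H1.
    destruct (nearest_spec p X HX) as [IX MX]. destruct (nearest_spec p Y HY) as [IY MY].
    destruct (balance_point X Y p (nearest p X) (nearest p Y)) as (q & c & Hc & E & QX & QY & QC); auto.
    { intros x Hx ->. eapply Hd; eauto. }
    destruct (nearest_spec q X HX) as [IX' MX']. destruct (nearest_spec q Y HY) as [IY' MY'].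
    assert (EX : sqdist (nearest q X) q = sqdist (nearest p Y) q).
    { specialize (QX _ IX'). specialize (MX' c Hc). lra. }
    assert (EY : sqdist (nearest q Y) q = sqdist (nearest p Y) q).
    { specialize (QY _ IY'). specialize (MY' _ IY). lra. }
    exists q. split; [lra|]. auto. }
  assert (NL := proj2 (nearest_spec p L HL) l Hl).
  assert (NO := proj2 (nearest_spec p O HO) o Ho).
  destruct (Rle_dec (sqdist (nearest p L) p) (sqdist (nearest p O) p)) as [H|H].
  - destruct (Hgen L O) as (q & E & H1 & H2); auto; [lra|].
    exists q. unfold balanced; auto.
  - destruct (Hgen O L) as (q & E & H1 & H2); auto; try lra.
    { intros c Hc Hc'. eapply Hdisj; eauto. }
    exists q. unfold balanced; auto.
Qed.

(** Stewart's theorem, for the point at parameter [s] of a segment. *)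
Lemma sqdist_convex s l o z q :
  fst z = (1 - s) * fst l + s * fst o -> snd z = (1 - s) * snd l + s * snd o ->
  sqdist z q = (1 - s) * sqdist l q + s * sqdist o q - s * (1 - s) * sqdist l o.
Proof. intros E1 E2. unfold sqdist. rewrite E1, E2. ring. Qed.

(** Points common to two circles with distinct centres lie on a line perpendicular to the line of
    centres, and a line meets a circle at most twice. *)
Lemma circles_meet_twice q q' a b c :
  q <> q' -> sqdist a q = sqdist b q -> sqdist a q = sqdist c q -> sqdist a q' = sqdist b q' -> sqdist a q' = sqdist c q' ->
  a = b \/ a = c \/ b = c.
Proof.
  intros Hq H1 H2 H3 H4.
  destruct q as [qx qy], q' as [rx ry], a as [ax ay], b as [bx by_], c as [cx cy].
  unfold sqdist in *; cbn [fst snd] in *.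
  assert (L1 : (qx - rx) * (bx - ax) + (qy - ry) * (by_ - ay) = 0) by nra.
  assert (L2 : (qx - rx) * (cx - ax) + (qy - ry) * (cy - ay) = 0) by nra.
  (* Both [b - a] and [c - a] are orthogonal to the nonzero vector [q - q'], hence parallel. *)
  assert (Cr : (bx - ax) * (cy - ay) - (by_ - ay) * (cx - ax) = 0).
  { destruct (Req_EM_T qx rx) as [Hx|Hx].
    - assert (Hy : qy - ry <> 0) by (intros Hy; apply Hq; f_equal; lra).
      rewrite Hx in L1, L2.
      assert (B1 : (qy - ry) * (by_ - ay) = 0) by lra.
      assert (B2 : (qy - ry) * (cy - ay) = 0) by lra.
      apply Rmult_integral in B1 as [B1|B1]; [contradiction|].
      apply Rmult_integral in B2 as [B2|B2]; [contradiction|].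
      rewrite B1, B2; ring.
    - apply Rmult_eq_reg_l with (qx - rx); [|lra].
      replace ((qx - rx) * ((bx - ax) * (cy - ay) - (by_ - ay) * (cx - ax))) with
        (((qx - rx) * (bx - ax) + (qy - ry) * (by_ - ay)) * (cy - ay) -
         ((qx - rx) * (cx - ax) + (qy - ry) * (cy - ay)) * (by_ - ay)) by ring.
      rewrite L1, L2; ring. }
  assert (A1 : (bx - ax) * (bx - ax) + (by_ - ay) * (by_ - ay)
     = 2 * ((qx - ax) * (bx - ax) + (qy - ay) * (by_ - ay))) by nra.
  assert (A2 : (cx - ax) * (cx - ax) + (cy - ay) * (cy - ay)
     = 2 * ((qx - ax) * (cx - ax) + (qy - ay) * (cy - ay))) by nra.
  destruct (Req_EM_T ((bx - ax) * (bx - ax) + (by_ - ay) * (by_ - ay)) 0) as [Z|Z].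
  { left. destruct (Rplus_sqr_eq_0 _ _ Z) as [Zx Zy].
    f_equal; lra. }
  right.
  set (u2 := (bx - ax) * (bx - ax) + (by_ - ay) * (by_ - ay)) in *.
  (* Now [c - a] is [k] times [b - a], and the equation of the circle leaves only [k = 0] or
     [k = 1]. *)
  set (k := ((cx - ax) * (bx - ax) + (cy - ay) * (by_ - ay)) / u2).
  assert (Ek : k * u2 = (cx - ax) * (bx - ax) + (cy - ay) * (by_ - ay)) by (unfold k; field; auto).
  assert (Ex : cx - ax = k * (bx - ax)).
  { apply Rmult_eq_reg_r with u2; auto.
    replace (k * (bx - ax) * u2) with (k * u2 * (bx - ax)) by ring. rewrite Ek. unfold u2.
    apply Rminus_diag_uniq. transitivity (- (by_ - ay) *
      ((bx - ax) * (cy - ay) - (by_ - ay) * (cx - ax))); [ring|rewrite Cr; ring]. }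
  assert (Ey : cy - ay = k * (by_ - ay)).
  { apply Rmult_eq_reg_r with u2; auto.
    replace (k * (by_ - ay) * u2) with (k * u2 * (by_ - ay)) by ring. rewrite Ek. unfold u2.
    apply Rminus_diag_uniq. transitivity ((bx - ax) *
      ((bx - ax) * (cy - ay) - (by_ - ay) * (cx - ax))); [ring|rewrite Cr; ring]. }
  rewrite Ex, Ey in A2.
  assert (Hk : k * (k - 1) * u2 = 0).
  { transitivity (k * (bx - ax) * (k * (bx - ax)) + k * (by_ - ay) * (k * (by_ - ay)) - k * u2);
      [unfold u2; ring|]. rewrite A2, A1. ring. }
  apply Rmult_integral in Hk as [Hk|Hk]; [|contradiction].
  apply Rmult_integral in Hk as [Hk|Hk].
  - left. rewrite Hk in Ex, Ey. f_equal; lra.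
  - right. assert (k = 1) by lra. rewrite H in Ex, Ey. f_equal; lra.
Qed.

Definition on_seg (e : point * point) (s : R) (z : point) : Prop :=
  fst z = (1 - s) * fst (fst e) + s * fst (snd e) /\
  snd z = (1 - s) * snd (fst e) + s * snd (snd e).

Definition exchange_edge (L O : list point) (q : point) : point * point :=
  (nearest q L, nearest q O).

Lemma balanced_min L O q c :
  balanced L O q -> In c L \/ In c O -> sqdist (nearest q L) q <= sqdist c q.
Proof.
  intros (HL & HO & E) [H|H].
  - now apply nearest_spec.
  - rewrite E. now apply nearest_spec.
Qed.

Lemma exchange_edge_ends L O q :
  (forall c, In c L -> ~ In c O) -> balanced L O q ->
  In (nearest q L) L /\ In (nearest q O) O /\ nearest q L <> nearest q O.
Proof.
  intros Hd (HL & HO & E). destruct (nearest_spec q L HL) as [H1 _].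
  destruct (nearest_spec q O HO) as [H2 _]. split; [auto|split; [auto|]].
  intros H; rewrite H in H1. eapply Hd; eauto.
Qed.

(** By Stewart's theorem an interior point of a chord is strictly nearer to [q] than its ends, so it
    lies in the open disk that contains no centre. *)
Lemma exchange_edge_vertex L O q s c :
  (forall c, In c L -> ~ In c O) -> balanced L O q -> In c L \/ In c O ->
  0 < s < 1 -> on_seg (exchange_edge L O q) s c -> False.
Proof.
  intros Hd Hq Hc Hs [E1 E2]. assert (M := balanced_min L O q c Hq Hc).
  destruct (exchange_edge_ends L O q Hd Hq) as (_ & _ & N).
  assert (D := sqdist_convex s _ _ c q E1 E2). cbn [exchange_edge fst snd] in D.
  destruct Hq as (_ & _ & E). rewrite <- E in D.
  assert (P : 0 < s * (1 - s) * sqdist (nearest q L) (nearest q O)).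
  { apply Rmult_lt_0_compat; [nra|now apply sqdist_pos]. }
  lra.
Qed.

(* Both edges are chords of empty circles; at an interior crossing the four
   end points are cocircular for both centres, so the centres coincide. *)
Lemma exchange_edge_cross L O q q' s t z :
  (forall c, In c L -> ~ In c O) -> balanced L O q -> balanced L O q' ->
  0 < s < 1 -> 0 < t < 1 ->
  on_seg (exchange_edge L O q) s z -> on_seg (exchange_edge L O q') t z ->
  exchange_edge L O q = exchange_edge L O q'.
Proof.
  intros Hd Hq Hq' Hs Ht [E1 E2] [E3 E4].
  destruct (exchange_edge_ends L O q Hd Hq) as (Il & Io & N).
  destruct (exchange_edge_ends L O q' Hd Hq') as (Il' & Io' & N').
  assert (M1 := balanced_min L O q (nearest q' L) Hq (or_introl Il')).
  assert (M2 := balanced_min L O q (nearest q' O) Hq (or_intror Io')).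
  assert (M3 := balanced_min L O q' (nearest q L) Hq' (or_introl Il)).
  assert (M4 := balanced_min L O q' (nearest q O) Hq' (or_intror Io)).
  destruct Hq as (_ & _ & Eq). destruct Hq' as (_ & _ & Eq').
  unfold exchange_edge in *; cbn [fst snd] in *.
  set (l := nearest q L) in *. set (o := nearest q O) in *.
  set (l' := nearest q' L) in *. set (o' := nearest q' O) in *.
  assert (D1 := sqdist_convex s l o z q E1 E2). assert (D2 := sqdist_convex t l' o' z q E3 E4).
  assert (D3 := sqdist_convex s l o z q' E1 E2). assert (D4 := sqdist_convex t l' o' z q' E3 E4).
  (* With [r] the radius at [q], [D1] makes [sqdist z q] equal to r^2 - s (1 - s) |lo|^2, and [D2]
     bounds it below by r^2 - t (1 - t) |l'o'|^2, since [l'] and [o'] are not inside. The same at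
     [q'] gives the reverse inequality; equality then forces all four points onto both circles. *)
  assert (K : s * (1 - s) * sqdist l o = t * (1 - t) * sqdist l' o') by (apply Rle_antisym; nra).
  assert (P1 : (1 - t) * (sqdist l' q - sqdist l q) + t * (sqdist o' q - sqdist l q) = 0) by nra.
  assert (P2 : (1 - s) * (sqdist l q' - sqdist l' q') + s * (sqdist o q' - sqdist l' q') = 0) by nra.
  assert (A1 : sqdist l' q = sqdist l q) by nra. assert (A2 : sqdist o' q = sqdist l q) by nra.
  assert (A3 : sqdist l q' = sqdist l' q') by nra. assert (A4 : sqdist o q' = sqdist l' q') by nra.
  (* The same [q] yields the same nearest centres. Distinct circles have at most two common points,
     and the colours tell which of the four agree. *)
  destruct (point_eq_dec q q') as [Hqq|Hqq].
  { unfold l, o, l', o'. now rewrite Hqq. }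
  f_equal.
  - destruct (circles_meet_twice q q' l o l') as [H|[H|H]]; try lra; try contradiction; auto.
    exfalso. apply (Hd l'); [exact Il'|now rewrite <- H].
  - destruct (circles_meet_twice q q' l o o') as [H|[H|H]]; try lra; try contradiction; auto.
    exfalso. apply (Hd l); [exact Il|now rewrite H].
Qed.

(** * Removing vertical alignments and drawing the exchange graph *)

Lemma exists_notin (l : list R) : exists r, ~ In r l.
Proof.
  destruct l as [|a l]; [exists 0; easy|].
  destruct (argmax (fun x => x) (a :: l)) as (x & _ & Hx); [easy|].
  exists (x + 1). intros H. apply Hx in H. lra.
Qed.

(** Each pair of points at different heights excludes one value of [lam], so only finitely many
    values are excluded. *)
Lemma exists_generic_shear (V : list point) :
  exists lam, forall u v, In u V -> In v V ->
    fst u + lam * snd u = fst v + lam * snd v -> u = v.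
Proof.
  destruct (exists_notin (map (fun w => - (fst (fst w) - fst (snd w)) / (snd (fst w) - snd (snd w)))
     (list_prod V V))) as [lam Hlam].
  exists lam. intros u v Hu Hv E.
  destruct (Req_EM_T (snd u) (snd v)) as [Hs|Hs].
  - rewrite Hs in E. destruct u, v; simpl in *. f_equal; lra.
  - exfalso; apply Hlam. apply in_map_iff. exists (u, v). split; [|now apply in_prod].
    simpl. field_simplify_eq; lra.
Qed.

(** The sweep needs distinct abscissae. A shear is linear and invertible, so it preserves segments
    and crossings; it does not preserve circles, so crossings are pulled back to the original plane
    before they are refuted. *)
Definition shear (lam : R) (c : point) : point := (fst c + lam * snd c, snd c).

Definition left_end (lam : R) (e : point * point) : point :=
  if Rlt_dec (fst (shear lam (fst e))) (fst (shear lam (snd e)))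
  then shear lam (fst e) else shear lam (snd e).

Definition right_end (lam : R) (e : point * point) : point :=
  if Rlt_dec (fst (shear lam (fst e))) (fst (shear lam (snd e)))
  then shear lam (snd e) else shear lam (fst e).

(** Pulls a point of the sheared edge back to the original segment, where the empty circles are
    available; if the shear interchanges left and right, the parameter becomes [1 - s]. *)
Lemma shear_seg lam e x :
  fst (left_end lam e) < x < fst (right_end lam e) ->
  exists s, 0 < s < 1 /\
    on_seg e s (x - lam * yat (left_end lam e) (right_end lam e) x,
                yat (left_end lam e) (right_end lam e) x).
Proof.
  intros Hx. set (l := left_end lam e) in *. set (r := right_end lam e) in *.
  set (s := (x - fst l) / (fst r - fst l)).
  assert (Es : s * (fst r - fst l) = x - fst l) by (unfold s; field; lra).
  assert (Hs : 0 < s < 1).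
  { split; apply Rmult_lt_reg_r with (fst r - fst l); lra. }
  assert (Ey : yat l r x = (1 - s) * snd l + s * snd r).
  { unfold yat, slope, s. field. lra. }
  assert (Ex : x = (1 - s) * fst l + s * fst r) by lra.
  rewrite Ey. rewrite Ex.
  unfold on_seg; cbn [fst snd]. unfold l, r, left_end, right_end, shear in *.
  cbn [fst snd] in *. destruct (Rlt_dec _ _).
  - exists s. cbn [fst snd]. repeat split; try lra; ring.
  - exists (1 - s). cbn [fst snd]. repeat split; try lra; ring.
Qed.

Lemma NoDup_map_inj {T U} (f : T -> U) l :
  (forall x y, In x l -> In y l -> f x = f y -> x = y) -> NoDup l -> NoDup (map f l).
Proof.
  intros H Hn. apply NoDup_map_NoDup_ForallPairs; auto.
Qed.

Lemma exchange_plane_graph L O B R E lam :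
  (forall c, In c L -> ~ In c O) ->
  (forall u v, In u (L ++ O) -> In v (L ++ O) ->
     fst u + lam * snd u = fst v + lam * snd v -> u = v) ->
  NoDup E -> (forall e, In e E -> exists q, balanced L O q /\ e = exchange_edge L O q) ->
  incl B L -> incl R O -> bip B R E ->
  plane_graph (left_end lam) (right_end lam) E (map (shear lam) (B ++ R)).
Proof.
  intros Hd Hlam Hn HE HB HR Hbip.
  assert (Hends : forall e, In e E ->
     In (fst e) (B ++ R) /\ In (snd e) (B ++ R)).
  { intros e He. destruct (Hbip e He). rewrite !in_app_iff; auto. }
  assert (Hlr : forall e, In e E -> fst (left_end lam e) < fst (right_end lam e)).
  { intros e He. destruct (HE e He) as (q & Hq & Ee).
    destruct (exchange_edge_ends L O q Hd Hq) as (H1 & H2 & H3).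
    assert (Hne : fst (shear lam (fst e)) <> fst (shear lam (snd e))).
    { rewrite Ee. simpl. intros H; apply H3, Hlam; auto; apply in_app_iff; auto. }
    unfold left_end, right_end. destruct (Rlt_dec _ _); lra. }
  split; auto.
  - intros e He. destruct (Hends e He). unfold left_end.
    destruct (Rlt_dec _ _); now apply in_map.
  - intros e He. destruct (Hends e He). unfold right_end.
    destruct (Rlt_dec _ _); now apply in_map.
  - intros e f x He Hf Hne Hxe Hxf Hy.
    destruct (HE e He) as (q & Hq & Ee). destruct (HE f Hf) as (q' & Hq' & Ef).
    destruct (shear_seg lam e x Hxe) as (s & Hs & Ss).
    destruct (shear_seg lam f x Hxf) as (t & Ht & St).
    rewrite <- Hy in St. apply Hne. rewrite Ee in Ss. rewrite Ef in St. rewrite Ee, Ef.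
    rewrite Ee in St.
    exact (exchange_edge_cross L O q q' s t _ Hd Hq Hq' Hs Ht Ss St).
  - intros e v He Hv Hx Hy. apply in_map_iff in Hv as (c & <- & Hc).
    destruct (HE e He) as (q & Hq & Ee).
    destruct (shear_seg lam e _ Hx) as (s & Hs & Ss).
    rewrite Hy in Ss. unfold shear in Ss; cbn [fst snd] in Ss.
    rewrite Ee in Ss.
    apply (exchange_edge_vertex L O q s c Hd Hq); auto.
    + apply in_app_iff in Hc as [H|H]; auto.
    + destruct c as [cx cy]; cbn [fst snd] in Ss.
      replace cx with (cx + lam * cy - lam * cy) by ring. exact Ss.
Qed.

(** The shear is injective on the vertices and the two colours are disjoint, so incidence in the
    drawing is incidence in the bipartite graph and its even sets are leafless. *)
Lemma exchange_sparse L O B R E :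
  (forall c, In c L -> ~ In c O) ->
  NoDup E -> (forall e, In e E -> exists q, balanced L O q /\ e = exchange_edge L O q) ->
  incl B L -> incl R O -> NoDup B -> NoDup R -> bip B R E -> sparse B R E.
Proof.
  intros Hd Hn HE HB HR HnB HnR Hbip g Hg.
  destruct (exists_generic_shear (L ++ O)) as [lam Hlam].
  assert (HG := exchange_plane_graph L O B R E lam Hd Hlam Hn HE HB HR Hbip).
  assert (Hinc : incl (B ++ R) (L ++ O)).
  { intros c Hc. rewrite in_app_iff in *. destruct Hc; auto. }
  assert (Hinj : forall u v, In u (B ++ R) -> In v (B ++ R) ->
     fst (shear lam u) = fst (shear lam v) -> u = v).
  { intros u v Hu Hv Huv. apply Hlam; auto. }
  rewrite <- length_app, <- (length_map (shear lam) (B ++ R)).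
  assert (edec : forall x y : point * point, {x = y} + {x <> y}).
  { decide equality; apply point_eq_dec. }
  apply (plane_graph_girth edec _ _ _ _ g HG).
  - apply NoDup_map_inj.
    + intros x y Hx Hy Hxy. apply Hinj; auto. now rewrite Hxy.
    + apply NoDup_app; auto. intros c Hc Hc'. apply (Hd c); auto.
  - intros u v Hu Hv Huv. apply in_map_iff in Hu as (u0 & <- & Hu).
    apply in_map_iff in Hv as (v0 & <- & Hv). f_equal. apply Hinj; auto.
  - intros Z [Hne Hev]. apply Hg.
    assert (Hinc2 : forall e v, In e E -> In v (B ++ R) ->
      (left_end lam e = shear lam v \/ right_end lam e = shear lam v) <-> (fst e = v \/ snd e = v)).
    { intros e v He Hv. destruct (Hbip e He) as [H1 H2].
      assert (Hs : forall u, In u (B ++ R) -> shear lam u = shear lam v <-> u = v).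
      { intros u Hu. split; [|congruence]. intros H. apply Hinj; auto. now rewrite H. }
      assert (I1 : In (fst e) (B ++ R)) by (apply in_app_iff; auto).
      assert (I2 : In (snd e) (B ++ R)) by (apply in_app_iff; auto).
      unfold left_end, right_end. destruct (Rlt_dec _ _); rewrite !Hs by auto; tauto. }
    assert (Hdisj : forall c, In c B -> ~ In c R) by (intros c Hc Hc'; apply (Hd c); auto).
    split; [auto|split].
    + intros b o He HZ. destruct (Hbip _ He) as [Ib Io]. simpl in Ib, Io.
      assert (Ib' : In b (B ++ R)) by (apply in_app_iff; auto).
      destruct (Hev (shear lam b) (b, o) He HZ) as ([b' o'] & He' & Hne' & HZ' & Hi).
      { apply Hinc2; auto. }
      apply Hinc2 in Hi; auto. destruct (Hbip _ He') as [Jb Jo]. simpl in *.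
      destruct Hi as [->|Hi]; [|subst o'; destruct (Hdisj b Ib Jo)].
      exists o'. repeat split; auto. congruence.
    + intros b o He HZ. destruct (Hbip _ He) as [Ib Io]. simpl in Ib, Io.
      assert (Io' : In o (B ++ R)) by (apply in_app_iff; auto).
      destruct (Hev (shear lam o) (b, o) He HZ) as ([b' o'] & He' & Hne' & HZ' & Hi).
      { apply Hinc2; auto. }
      apply Hinc2 in Hi; auto. destruct (Hbip _ He') as [Jb Jo]. simpl in *.
      destruct Hi as [Hi| ->]; [subst b'; destruct (Hdisj o Jb Io)|].
      exists b'. repeat split; auto. congruence.
Qed.

(** One balanced point for each [p] yields finitely many edges; duplicates are removed, since
    different points may give the same edge. *)
Lemma exchange_graph (L O P : list point) :
  (forall c, In c L -> ~ In c O) ->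
  (forall p, In p P -> exists l o, In l L /\ In o O /\ sqdist l p <= 1 /\ sqdist o p <= 1) ->
  exists E, NoDup E /\ bip L O E /\
    (forall e, In e E -> exists q, balanced L O q /\ e = exchange_edge L O q) /\
    (forall p, In p P -> exists l o, In (l, o) E /\ sqdist l p <= 1 /\ sqdist o p <= 1).
Proof.
  intros Hd Hc.
  assert (edec : forall x y : point * point, {x = y} + {x <> y}).
  { decide equality; apply point_eq_dec. }
  enough (exists Q, (forall q, In q Q -> balanced L O q) /\
    forall p, In p P -> exists q, In q Q /\ sqdist (nearest q L) p <= 1 /\ sqdist (nearest q O) p <= 1)
    as (Q & HQ & HP).
  { exists (nodup edec (map (exchange_edge L O) Q)). split; [apply NoDup_nodup|].
    assert (HE : forall e, In e (nodup edec (map (exchange_edge L O) Q)) ->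
       exists q, balanced L O q /\ e = exchange_edge L O q).
    { intros e He. apply nodup_In, in_map_iff in He as (q & <- & Hq). eauto. }
    split; [|split; auto].
    - intros e He. destruct (HE e He) as (q & Hq & ->).
      destruct (exchange_edge_ends L O q Hd Hq) as (H1 & H2 & _). auto.
    - intros p Hp. destruct (HP p Hp) as (q & Hq & H1 & H2).
      exists (nearest q L), (nearest q O). split; auto.
      apply nodup_In, in_map_iff. exists q; auto. }
  induction P as [|p P IH].
  - exists []; split; easy.
  - destruct IH as (Q & HQ & HP); [intros; apply Hc; simpl; auto|].
    destruct (Hc p (or_introl eq_refl)) as (l & o & Hl & Ho & Hlp & Hop).
    destruct (exchange_point L O p l o Hd Hl Hlp Ho Hop) as (q & Hq & H1 & H2).
    exists (q :: Q). split.
    + intros q' [<-|Hq']; auto.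
    + intros p' [<-|Hp']; [exists q; simpl; auto|].
      destruct (HP p' Hp') as (q' & Hq' & H'). exists q'; simpl; auto.
Qed.

Definition covered_by (Q : point -> Prop) (p : point) : Prop :=
  exists c, Q c /\ in_unit_disk c p.

(** A violation of Hall's condition, [Bs] with all neighbours in [Rs], would be an improving
    exchange: the edge of a point that relies on a disk of [Bs] leads to a disk of [Rs] covering
    that point. *)
Lemma local_optimum_ratio (P D L O : list point) :
  P <> [] -> NoDup L -> NoDup O -> incl L D -> incl O D ->
  (forall p, In p P -> covered_by (fun c => In c L) p) ->
  (forall p, In p P -> covered_by (fun c => In c O) p) ->
  (forall As Ds, NoDup As -> incl As L -> length As = 3%nat ->
     incl Ds D -> (length Ds <= 2)%nat ->
     ~ forall p, In p P -> covered_by (fun c => (In c L /\ ~ In c As) \/ In c Ds) p) ->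
  (length L <= 9 * length O)%nat.
Proof.
  intros HP HnL HnO HLD HOD HcL HcO Hloc.
  (* With fewer than three disks there is no exchange, and the bound holds because [O] is not
     empty. *)
  destruct (le_lt_dec (length L) 2) as [Hsmall|Hbig].
  { destruct P as [|p P]; [easy|]. destruct (HcO p (or_introl eq_refl)) as (c & Hc & _).
    destruct O; [easy|simpl; lia]. }
  set (inb := fun (l : list point) c => if in_dec point_eq_dec c l then true else false).
  assert (Hinb : forall l c, inb l c = true <-> In c l).
  { intros l c; unfold inb; destruct (in_dec point_eq_dec c l); intuition congruence. }
  set (B := filter (fun c => negb (inb O c)) L).
  set (R := filter (fun c => negb (inb L c)) O).
  assert (HB : forall c, In c B <-> In c L /\ ~ In c O).
  { intros c. unfold B. rewrite filter_In, negb_true_iff, <- not_true_iff_false, Hinb. tauto. }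
  assert (HR : forall c, In c R <-> In c O /\ ~ In c L).
  { intros c. unfold R. rewrite filter_In, negb_true_iff, <- not_true_iff_false, Hinb. tauto. }
  assert (HnB : NoDup B) by now apply NoDup_filter.
  assert (HnR : NoDup R) by now apply NoDup_filter.
  assert (HLlen : length L = (length (filter (inb O) L) + length B)%nat)
    by (symmetry; apply filter_length).
  assert (HOlen : length O = (length (filter (inb L) O) + length R)%nat)
    by (symmetry; apply filter_length).
  assert (Hcommon : (length (filter (inb O) L) <= length (filter (inb L) O))%nat).
  { apply NoDup_incl_length; [now apply NoDup_filter|].
    intros c Hc. rewrite filter_In, Hinb in *. tauto. }
  enough (length B <= 9 * length R)%nat by lia.
  assert (Hdisj : forall c, In c B -> ~ In c R) by (intros c; rewrite HB, HR; tauto).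
  (* A point covered by a common disk gets no edge: that disk stays in place or is put back in every
     exchange below. *)
  set (P' := filter (fun p => if excluded_middle_informative
     (covered_by (fun c => In c L /\ In c O) p) then false else true) P).
  destruct (exchange_graph B R P' Hdisj) as (E & HnE & Hbip & HE & Hex).
  { intros p Hp. unfold P' in Hp. apply filter_In in Hp as [Hp Hno].
    destruct (excluded_middle_informative _) as [|Hno']; [easy|].
    destruct (HcL p Hp) as (l & Hl & Hlp). destruct (HcO p Hp) as (o & Ho & Hop).
    exists l, o. rewrite HB, HR.
    assert (~ In l O) by (intros H; apply Hno'; exists l; auto).
    assert (~ In o L) by (intros H'; apply Hno'; exists o; auto). auto. }
  apply (planar_hall B R E HnB HnE Hbip).
  { intros E' B' HE' HB' HnE' HnB' Hbip'. apply (exchange_sparse B R); auto.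
    apply incl_refl. }
  intros Bs Rs HnBs HBs HRs Hlen Hlt. apply NNPP; intros Hno.
  (* Padding: an exchange involves exactly three disks, so further disks of [L] are removed and put
     back at once. *)
  set (X := firstn (3 - length Bs) (filter (fun c => negb (inb Bs c)) L)).
  assert (HX : forall c, In c X -> In c L /\ ~ In c Bs).
  { intros c Hc. unfold X in Hc.
    assert (Hc' : In c (filter (fun c => negb (inb Bs c)) L)).
    { rewrite <- (firstn_skipn (3 - length Bs)). apply in_app_iff; auto. }
    rewrite filter_In, negb_true_iff, <- not_true_iff_false, Hinb in Hc'. auto. }
  assert (HlX : length X = (3 - length Bs)%nat).
  { unfold X. apply firstn_length_le.
    assert (Hl := filter_length (inb Bs) L).
    assert (length (filter (inb Bs) L) <= length Bs)%nat; [|lia].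
    apply NoDup_incl_length; [now apply NoDup_filter|].
    intros c Hc. rewrite filter_In, Hinb in Hc. tauto. }
  apply (Hloc (Bs ++ X) (Rs ++ X)).
  - apply NoDup_app; auto.
    + unfold X. assert (Hn : NoDup (filter (fun c => negb (inb Bs c)) L)) by now apply NoDup_filter.
      rewrite <- (firstn_skipn (3 - length Bs)) in Hn. now apply NoDup_app_remove_r in Hn.
    + intros c Hc Hc'. apply HX in Hc'. tauto.
  - intros c Hc. apply in_app_iff in Hc as [Hc|Hc]; [apply HBs, HB in Hc|apply HX in Hc]; tauto.
  - rewrite length_app. lia.
  - intros c Hc. apply in_app_iff in Hc as [Hc|Hc].
    + apply HRs, HR in Hc. apply HOD; tauto.
    + apply HX in Hc. apply HLD; tauto.
  - rewrite length_app. lia.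
  - assert (Hkeep : forall c, In c L -> ~ In c Bs ->
      (In c L /\ ~ In c (Bs ++ X)) \/ In c (Rs ++ X)).
    { intros c Hc Hn. rewrite !in_app_iff. destruct (in_dec point_eq_dec c X); tauto. }
    intros p Hp.
    destruct (excluded_middle_informative (covered_by (fun c => In c L /\ In c O) p))
      as [(c & [Hc1 Hc2] & Hcp)|Hno'].
    + exists c. split; auto. apply Hkeep; auto. intros Hb. apply HBs, HB in Hb. tauto.
    + destruct (Hex p) as (l & o & He & Hlp & Hop).
      { unfold P'. apply filter_In. split; auto.
        destruct (excluded_middle_informative _); [contradiction|auto]. }
      destruct (in_dec point_eq_dec l Bs) as [Hl|Hl].
      * exists o. split; auto. right. apply in_app_iff; left.
        apply NNPP; intros Hn. apply Hno. eauto.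
      * exists l. split; auto. apply Hkeep; auto.
        destruct (Hbip _ He) as [Hb _]. apply HB in Hb. tauto.
Qed.

(** * A structured language over the real RAM *)

Definition mem : Type := ((nat -> Z) * (nat -> R))%type.

Inductive com : Type :=
| Skip
| Op (i : instr)
| Seq (c1 c2 : com)
| IfLt (a b : nat) (c1 c2 : com)
| IfRLe (a b : nat) (c1 c2 : com)
| While (a b : nat) (c : com).

Notation "c1 ;; c2" := (Seq c1 c2) (at level 80, right associativity).

(** The effect of an instruction used as a plain statement. Jumps have no value here, since control
    flow comes from the commands alone. *)
Definition iop (i : instr) (m : mem) : option mem :=
  let (f, g) := m in
  match i with
  | IConst d z => Some (updZ f d z, g)
  | IAdd d a b => Some (updZ f d (f a + f b)%Z, g)
  | ISub d a b => Some (updZ f d (f a - f b)%Z, g)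
  | ILoadI d a => Some (updZ f d (f (Z.to_nat (f a))), g)
  | IStoreI a s => Some (updZ f (Z.to_nat (f a)) (f s), g)
  | RConst d z => Some (f, updR g d (IZR z))
  | RAdd d a b => Some (f, updR g d (g a + g b))
  | RSub d a b => Some (f, updR g d (g a - g b))
  | RMul d a b => Some (f, updR g d (g a * g b))
  | RLoadI d a => Some (f, updR g d (g (Z.to_nat (f a))))
  | RStoreI a s => Some (f, updR g (Z.to_nat (f a)) (g s))
  | _ => None
  end.

Fixpoint size (c : com) : nat :=
  match c with
  | Skip => 0
  | Op _ => 1
  | Seq c1 c2 => size c1 + size c2
  | IfLt _ _ c1 c2 | IfRLe _ _ c1 c2 => 2 + size c2 + size c1
  | While _ _ c => 3 + size c
  end.

(** Jump targets are absolute, so the code depends on its address [p]. Conditional jumps are taken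
    when the test succeeds, which is why the code of the negative branch comes first. *)
Fixpoint compile (p : nat) (c : com) : program :=
  match c with
  | Skip => []
  | Op i => [i]
  | Seq c1 c2 => compile p c1 ++ compile (p + size c1) c2
  | IfLt a b c1 c2 =>
      JmpILt a b (p + 2 + size c2) :: compile (p + 1) c2 ++
      Jmp (p + 2 + size c2 + size c1) :: compile (p + 2 + size c2) c1
  | IfRLe a b c1 c2 =>
      JmpRLe a b (p + 2 + size c2) :: compile (p + 1) c2 ++
      Jmp (p + 2 + size c2 + size c1) :: compile (p + 2 + size c2) c1
  | While a b c =>
      JmpILt a b (p + 2) :: Jmp (p + 3 + size c) :: compile (p + 2) c ++ [Jmp p]
  end.

Lemma length_compile c p : length (compile p c) = size c.
Proof.
  revert p; induction c; intros p; simpl; auto;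
    rewrite ?length_app; simpl; rewrite ?length_app; simpl; auto.
  - rewrite IHc2, IHc1. lia.
  - rewrite IHc2, IHc1. lia.
  - rewrite IHc. lia.
Qed.

(** The counter is the exact number of steps of the compiled code: a negative branch pays for the
    test and for the jump over the other branch, a test of a loop also for the jump that leaves or
    closes it. *)
Inductive exec : com -> mem -> mem -> nat -> Prop :=
| ExSkip m : exec Skip m m 0
| ExOp i m m' : iop i m = Some m' -> exec (Op i) m m' 1
| ExSeq c1 c2 m1 m2 m3 t1 t2 :
    exec c1 m1 m2 t1 -> exec c2 m2 m3 t2 -> exec (Seq c1 c2) m1 m3 (t1 + t2)
| ExLtT a b c1 c2 m m' t : (fst m a < fst m b)%Z ->
    exec c1 m m' t -> exec (IfLt a b c1 c2) m m' (1 + t)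
| ExLtF a b c1 c2 m m' t : (fst m b <= fst m a)%Z ->
    exec c2 m m' t -> exec (IfLt a b c1 c2) m m' (2 + t)
| ExRLeT a b c1 c2 m m' t : snd m a <= snd m b ->
    exec c1 m m' t -> exec (IfRLe a b c1 c2) m m' (1 + t)
| ExRLeF a b c1 c2 m m' t : snd m b < snd m a ->
    exec c2 m m' t -> exec (IfRLe a b c1 c2) m m' (2 + t)
| ExWhF a b c m : (fst m b <= fst m a)%Z -> exec (While a b c) m m 2
| ExWhT a b c m1 m2 m3 t1 t2 : (fst m1 a < fst m1 b)%Z ->
    exec c m1 m2 t1 -> exec (While a b c) m2 m3 t2 ->
    exec (While a b c) m1 m3 (2 + t1 + t2).

Definition code_at (prg : program) (p : nat) (l : program) : Prop :=
  forall k i, nth_error l k = Some i -> nth_error prg (p + k) = Some i.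

Lemma code_at_app prg p l1 l2 :
  code_at prg p (l1 ++ l2) -> code_at prg p l1 /\ code_at prg (p + length l1) l2.
Proof.
  intros H; split; intros k i Hk.
  - apply H. rewrite nth_error_app1; auto. apply nth_error_Some. congruence.
  - rewrite <- Nat.add_assoc. apply H. rewrite nth_error_app2 by lia.
    now replace (length l1 + k - length l1)%nat with k by lia.
Qed.

Lemma code_at_cons prg p i l :
  code_at prg p (i :: l) -> nth_error prg p = Some i /\ code_at prg (p + 1) l.
Proof.
  intros H; split.
  - rewrite <- (Nat.add_0_r p). now apply H.
  - intros k j Hk. replace (p + 1 + k)%nat with (p + S k)%nat by lia. now apply H.
Qed.

Definition st (p : nat) (m : mem) : mstate := MState p (fst m) (snd m).

Lemma run_add prg t1 t2 s : run prg (t1 + t2) s = run prg t2 (run prg t1 s).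
Proof. revert s; induction t1; simpl; auto. Qed.

Lemma run_eq prg t1 t2 s s' : t1 = t2 -> run prg t1 s = s' -> run prg t2 s = s'.
Proof. intros ->; auto. Qed.

Lemma step_jmp prg p t f g :
  nth_error prg p = Some (Jmp t) -> step prg (MState p f g) = MState t f g.
Proof. intros H. unfold step. now rewrite H. Qed.

Lemma exec_run prg c m m' t : exec c m m' t -> forall p,
  code_at prg p (compile p c) -> run prg t (st p m) = st (p + size c) m'.
Proof.
  induction 1 as [m|i [f g] m' Hi|c1 c2 m1 m2 m3 t1 t2 _ IH1 _ IH2
    |a b c1 c2 m m' t Hc _ IH|a b c1 c2 m m' t Hc _ IH
    |a b c1 c2 m m' t Hc _ IH|a b c1 c2 m m' t Hc _ IH
    |a b c m Hc|a b c m1 m2 m3 t1 t2 Hc _ IH1 _ IH2]; intros p Hcode; cbn [compile size] in *.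
  - simpl. now rewrite Nat.add_0_r.
  - apply code_at_cons in Hcode as [Hcode _]. unfold st; simpl. rewrite Hcode.
    rewrite Nat.add_1_r. destruct i; simpl in Hi; inversion Hi; reflexivity.
  - apply code_at_app in Hcode as [H1 H2]. rewrite length_compile in H2.
    rewrite run_add, (IH1 p H1), (IH2 _ H2). now rewrite Nat.add_assoc.
  - apply code_at_cons in Hcode as [H1 H2]. apply code_at_app in H2 as [H2 H3].
    apply code_at_cons in H3 as [H3 H4]. rewrite length_compile in *.
    unfold st at 1; simpl. rewrite H1.
    destruct (Z.ltb_spec (fst m a) (fst m b)); [|lia].
    replace (p + 1 + size c2 + 1)%nat with (p + 2 + size c2)%nat in H4 by lia.
    etransitivity; [exact (IH _ H4)|]. f_equal; lia.
  - apply code_at_cons in Hcode as [H1 H2]. apply code_at_app in H2 as [H2 H3].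
    apply code_at_cons in H3 as [H3 H4]. rewrite length_compile in *.
    apply (run_eq prg (1 + (t + 1))); [lia|]. rewrite run_add, run_add.
    unfold st at 1; simpl. rewrite H1.
    destruct (Z.ltb_spec (fst m a) (fst m b)); [lia|].
    rewrite <- Nat.add_1_r. rewrite (IH _ H2 : run prg t (MState _ _ _) = _).
    unfold st; simpl. rewrite H3. f_equal; lia.
  - apply code_at_cons in Hcode as [H1 H2]. apply code_at_app in H2 as [H2 H3].
    apply code_at_cons in H3 as [H3 H4]. rewrite length_compile in *.
    unfold st at 1; simpl. rewrite H1.
    destruct (Rle_dec (snd m a) (snd m b)); [|lra].
    replace (p + 1 + size c2 + 1)%nat with (p + 2 + size c2)%nat in H4 by lia.
    etransitivity; [exact (IH _ H4)|]. f_equal; lia.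
  - apply code_at_cons in Hcode as [H1 H2]. apply code_at_app in H2 as [H2 H3].
    apply code_at_cons in H3 as [H3 H4]. rewrite length_compile in *.
    apply (run_eq prg (1 + (t + 1))); [lia|]. rewrite run_add, run_add.
    unfold st at 1; simpl. rewrite H1.
    destruct (Rle_dec (snd m a) (snd m b)); [lra|].
    rewrite <- Nat.add_1_r. rewrite (IH _ H2 : run prg t (MState _ _ _) = _).
    unfold st; simpl. rewrite H3. f_equal; lia.
  - apply code_at_cons in Hcode as [H1 H2]. apply code_at_cons in H2 as [H2 _].
    unfold st at 1; simpl. rewrite H1.
    destruct (Z.ltb_spec (fst m a) (fst m b)); [lia|].
    rewrite Nat.add_1_r in H2. rewrite (step_jmp _ _ _ _ _ H2). unfold st; f_equal; lia.
  - assert (Hcode' := Hcode).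
    apply code_at_cons in Hcode as [H1 H2]. apply code_at_cons in H2 as [H2 H3].
    apply code_at_app in H3 as [H3 H4]. apply code_at_cons in H4 as [H4 _].
    rewrite length_compile in *.
    replace (p + 1 + 1)%nat with (p + 2)%nat in * by lia.
    apply (run_eq prg (1 + (t1 + (1 + t2)))); [lia|]. rewrite !run_add.
    unfold st at 1; simpl. rewrite H1.
    destruct (Z.ltb_spec (fst m1 a) (fst m1 b)); [|lia].
    rewrite (IH1 _ H3 : run prg t1 (MState _ _ _) = _).
    unfold st at 1; simpl. rewrite H4. exact (IH2 p Hcode').
Qed.

(** Total correctness with a time budget; an upper bound lets branches of different cost share one
    budget. *)
Definition wp (c : com) (m : mem) (Q : mem -> Prop) (T : nat) : Prop :=
  exists m' t, exec c m m' t /\ (t <= T)%nat /\ Q m'.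

Lemma wp_conseq c m (Q Q' : mem -> Prop) T T' :
  wp c m Q T -> (forall m', Q m' -> Q' m') -> (T <= T')%nat -> wp c m Q' T'.
Proof.
  intros (m' & t & He & Ht & HQ) HQ' HT. exists m', t. repeat split; auto. lia.
Qed.

Lemma wp_skip m (Q : mem -> Prop) T : Q m -> wp Skip m Q T.
Proof. exists m, 0%nat. repeat split; auto; [constructor|lia]. Qed.

Lemma wp_seq c1 c2 m Q T1 T2 :
  wp c1 m (fun m' => wp c2 m' Q T2) T1 -> wp (Seq c1 c2) m Q (T1 + T2).
Proof.
  intros (m1 & t1 & E1 & H1 & m2 & t2 & E2 & H2 & HQ).
  exists m2, (t1 + t2)%nat. repeat split; auto; [econstructor; eauto|lia].
Qed.

Lemma wp_op i m m' (Q : mem -> Prop) T :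
  iop i m = Some m' -> Q m' -> wp (Op i) m Q (S T).
Proof. intros Hi HQ. exists m', 1%nat. repeat split; auto; [now constructor|lia]. Qed.

Lemma wp_lt a b c1 c2 m Q T :
  ((fst m a < fst m b)%Z -> wp c1 m Q T) -> ((fst m b <= fst m a)%Z -> wp c2 m Q T) ->
  wp (IfLt a b c1 c2) m Q (2 + T).
Proof.
  intros H1 H2. destruct (Z_lt_le_dec (fst m a) (fst m b)) as [H|H].
  - destruct (H1 H) as (m' & t & E & Ht & HQ). exists m', (1 + t)%nat.
    repeat split; auto; [now apply ExLtT|lia].
  - destruct (H2 H) as (m' & t & E & Ht & HQ). exists m', (2 + t)%nat.
    repeat split; auto; [now apply ExLtF|lia].
Qed.

Lemma wp_rle a b c1 c2 m Q T :
  (snd m a <= snd m b -> wp c1 m Q T) -> (snd m b < snd m a -> wp c2 m Q T) ->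
  wp (IfRLe a b c1 c2) m Q (2 + T).
Proof.
  intros H1 H2. destruct (Rle_lt_dec (snd m a) (snd m b)) as [H|H].
  - destruct (H1 H) as (m' & t & E & Ht & HQ). exists m', (1 + t)%nat.
    repeat split; auto; [now apply ExRLeT|lia].
  - destruct (H2 H) as (m' & t & E & Ht & HQ). exists m', (2 + t)%nat.
    repeat split; auto; [now apply ExRLeF|lia].
Qed.

(* [k] is a variant: it bounds the number of remaining iterations. *)
Lemma wp_while a b c (Inv : nat -> mem -> Prop) T :
  (forall k m, Inv k m -> (fst m a < fst m b)%Z ->
     exists k', (k = S k')%nat /\ wp c m (fun m' => exists j, (j <= k')%nat /\ Inv j m') T) ->
  forall k m, Inv k m ->
  wp (While a b c) m (fun m' => (exists j, Inv j m') /\ (fst m' b <= fst m' a)%Z)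
     (k * (T + 2) + 2).
Proof.
  intros Hstep k. induction k as [k IH] using lt_wf_ind. intros m HI.
  destruct (Z_lt_le_dec (fst m a) (fst m b)) as [H|H].
  - destruct (Hstep k m HI H) as (k' & -> & m1 & t1 & E1 & H1 & j & Hj & HI1).
    destruct (IH j ltac:(lia) m1 HI1) as (m2 & t2 & E2 & H2 & HQ).
    exists m2, (2 + t1 + t2)%nat. repeat split; try tauto; [|nia].
    eapply ExWhT; eauto.
  - exists m, 2%nat. repeat split; eauto; [now constructor|lia].
Qed.

Definition For (r lim : nat) (c : com) : com :=
  Op (IConst r 0) ;; While r lim (c ;; Op (IAdd r r 3)).

(** [Inv j] describes the state after [j] rounds, with the counter already equal to [j]. Register 3
    must hold 1, as it serves as the increment. A round costs [T], one increment and two steps for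
    test and jump. *)
Lemma wp_for r lim c (k : nat) (Inv : nat -> mem -> Prop) f g T :
  Inv 0%nat (updZ f r 0, g) ->
  (forall j f g, Inv j (f, g) -> f r = Z.of_nat j /\ f lim = Z.of_nat k) ->
  (forall j f g, (j < k)%nat -> Inv j (f, g) ->
     wp c (f, g) (fun m => fst m r = Z.of_nat j /\ fst m 3%nat = Z.of_nat 1 /\
        Inv (S j) (updZ (fst m) r (Z.of_nat (S j)), snd m)) T) ->
  wp (For r lim c) (f, g) (Inv k) (k * (T + 3) + 3).
Proof.
  intros H0 Hr Hstep. unfold For.
  replace (k * (T + 3) + 3)%nat with (1 + (k * ((T + 1) + 2) + 2))%nat by lia.
  apply wp_seq. eapply wp_op; [reflexivity|].
  eapply wp_conseq.
  - apply (wp_while r lim _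
      (fun n m => exists j, (j + n = k)%nat /\ Inv j m) (T + 1)) with (k := k).
    + intros n [f1 g1] (j & Hj & HI) Hlt. destruct (Hr j f1 g1 HI) as [E1 E2].
      simpl in Hlt. rewrite E1, E2 in Hlt. exists (n - 1)%nat. split; [lia|].
      apply wp_seq. eapply wp_conseq; [apply (Hstep j); auto; lia| |apply Nat.le_refl].
      intros [f2 g2] (F1 & F2 & HI2). eapply wp_op; [reflexivity|].
      cbn [fst snd] in F1, F2, HI2. rewrite F1, F2, <- Nat2Z.inj_add.
      exists (n - 1)%nat. split; [lia|]. exists (S j). split; [lia|].
      now rewrite Nat.add_1_r.
    + exists 0%nat. auto.
  - simpl. intros [f1 g1] ((n & j & Hj & HI) & Hle). destruct (Hr j f1 g1 HI) as [E1 E2].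
    simpl in Hle. rewrite E1, E2 in Hle. now replace k with j by lia.
  - lia.
Qed.

Lemma updZ_same f k v : updZ f k v k = v.
Proof. unfold updZ. now rewrite Nat.eqb_refl. Qed.

Lemma updZ_other f k v i : i <> k -> updZ f k v i = f i.
Proof. unfold updZ. intros H. apply Nat.eqb_neq in H. now rewrite H. Qed.

Lemma updR_same f k v : updR f k v k = v.
Proof. unfold updR. now rewrite Nat.eqb_refl. Qed.

Lemma updR_other f k v i : i <> k -> updR f k v i = f i.
Proof. unfold updR. intros H. apply Nat.eqb_neq in H. now rewrite H. Qed.

(** This rule and the following ones are in continuation form and take the values of the operands
    through equations, so that a proof executes a block symbolically, instruction by instruction. *)
Lemma wp_const d z c f g Q T :
  wp c (updZ f d z, g) Q T -> wp (Op (IConst d z) ;; c) (f, g) Q (S T).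
Proof. intros H. apply (wp_seq _ _ _ _ 1). eapply wp_op; [reflexivity|auto]. Qed.

Lemma wp_add d a b c x y f g Q T :
  f a = x -> f b = y ->
  wp c (updZ f d (x + y)%Z, g) Q T -> wp (Op (IAdd d a b) ;; c) (f, g) Q (S T).
Proof. intros <- <- H. apply (wp_seq _ _ _ _ 1). eapply wp_op; [reflexivity|auto]. Qed.

(** Keeps the result in the form [Z.of_nat], which [wp_load] and [wp_store] require of addresses. *)
Lemma wp_addn d a b c (x y : nat) f g Q T :
  f a = Z.of_nat x -> f b = Z.of_nat y ->
  wp c (updZ f d (Z.of_nat (x + y)), g) Q T -> wp (Op (IAdd d a b) ;; c) (f, g) Q (S T).
Proof. rewrite Nat2Z.inj_add. apply wp_add. Qed.

Lemma wp_sub d a b c x y f g Q T :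
  f a = x -> f b = y ->
  wp c (updZ f d (x - y)%Z, g) Q T -> wp (Op (ISub d a b) ;; c) (f, g) Q (S T).
Proof. intros <- <- H. apply (wp_seq _ _ _ _ 1). eapply wp_op; [reflexivity|auto]. Qed.

Lemma wp_load d a c (k : nat) x f g Q T :
  f a = Z.of_nat k -> f k = x ->
  wp c (updZ f d x, g) Q T -> wp (Op (ILoadI d a) ;; c) (f, g) Q (S T).
Proof.
  intros Ha <- H. apply (wp_seq _ _ _ _ 1). eapply wp_op; [reflexivity|].
  now rewrite Ha, Nat2Z.id.
Qed.

Lemma wp_store a s c (k : nat) x f g Q T :
  f a = Z.of_nat k -> f s = x ->
  wp c (updZ f k x, g) Q T -> wp (Op (IStoreI a s) ;; c) (f, g) Q (S T).
Proof.
  intros Ha <- H. apply (wp_seq _ _ _ _ 1). eapply wp_op; [reflexivity|].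
  now rewrite Ha, Nat2Z.id.
Qed.

Lemma wp_rconst d z c f g Q T :
  wp c (f, updR g d (IZR z)) Q T -> wp (Op (RConst d z) ;; c) (f, g) Q (S T).
Proof. intros H. apply (wp_seq _ _ _ _ 1). eapply wp_op; [reflexivity|auto]. Qed.

Lemma wp_radd d a b c x y f g Q T :
  g a = x -> g b = y ->
  wp c (f, updR g d (x + y)) Q T -> wp (Op (RAdd d a b) ;; c) (f, g) Q (S T).
Proof. intros <- <- H. apply (wp_seq _ _ _ _ 1). eapply wp_op; [reflexivity|auto]. Qed.

Lemma wp_rsub d a b c x y f g Q T :
  g a = x -> g b = y ->
  wp c (f, updR g d (x - y)) Q T -> wp (Op (RSub d a b) ;; c) (f, g) Q (S T).
Proof. intros <- <- H. apply (wp_seq _ _ _ _ 1). eapply wp_op; [reflexivity|auto]. Qed.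

Lemma wp_rmul d a b c x y f g Q T :
  g a = x -> g b = y ->
  wp c (f, updR g d (x * y)) Q T -> wp (Op (RMul d a b) ;; c) (f, g) Q (S T).
Proof. intros <- <- H. apply (wp_seq _ _ _ _ 1). eapply wp_op; [reflexivity|auto]. Qed.

Lemma wp_rload d a c (k : nat) x f g Q T :
  f a = Z.of_nat k -> g k = x ->
  wp c (f, updR g d x) Q T -> wp (Op (RLoadI d a) ;; c) (f, g) Q (S T).
Proof.
  intros Ha <- H. apply (wp_seq _ _ _ _ 1). eapply wp_op; [reflexivity|].
  now rewrite Ha, Nat2Z.id.
Qed.

Lemma wp_rstore a s c (k : nat) x f g Q T :
  f a = Z.of_nat k -> g s = x ->
  wp c (f, updR g k x) Q T -> wp (Op (RStoreI a s) ;; c) (f, g) Q (S T).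
Proof.
  intros Ha <- H. apply (wp_seq _ _ _ _ 1). eapply wp_op; [reflexivity|].
  now rewrite Ha, Nat2Z.id.
Qed.

(** * The local search program *)

Lemma wp_time c m Q T T' : wp c m Q T -> (T <= T')%nat -> wp c m Q T'.
Proof. intros H HT. eapply wp_conseq; eauto. Qed.

Lemma wp_seq_post c1 c2 m (Q1 Q : mem -> Prop) T1 T2 :
  wp c1 m Q1 T1 -> (forall f g, Q1 (f, g) -> wp c2 (f, g) Q T2) ->
  wp (c1 ;; c2) m Q (T1 + T2).
Proof.
  intros H1 H2. apply wp_seq. eapply wp_conseq; [exact H1| |apply Nat.le_refl].
  intros [f g]; auto.
Qed.

(** The budgets of the branches are added, so that each is found by unification independently of the
    other. *)
Lemma wp_lt_val a b c1 c2 x y f g Q T1 T2 :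
  f a = x -> f b = y ->
  ((x < y)%Z -> wp c1 (f, g) Q T1) -> ((y <= x)%Z -> wp c2 (f, g) Q T2) ->
  wp (IfLt a b c1 c2) (f, g) Q (2 + (T1 + T2)).
Proof.
  intros <- <- H1 H2. apply wp_lt; intros H; eapply wp_time; eauto; lia.
Qed.

Lemma wp_rle_val a b c1 c2 x y f g Q T1 T2 :
  g a = x -> g b = y ->
  (x <= y -> wp c1 (f, g) Q T1) -> (y < x -> wp c2 (f, g) Q T2) ->
  wp (IfRLe a b c1 c2) (f, g) Q (2 + (T1 + T2)).
Proof.
  intros <- <- H1 H2. apply wp_rle; intros H; eapply wp_time; eauto; lia.
Qed.

Lemma wp_done m (Q : mem -> Prop) : Q m -> wp Skip m Q 0.
Proof. apply wp_skip. Qed.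

Ltac lookR := cbn [fst snd];
  repeat first [rewrite updR_same | rewrite updR_other by lia];
  first [eassumption | reflexivity].

(* Integer registers below 40 hold scalars.  Above them lie the membership bits of
   the current cover at [40 + j], the number of its disks containing point [i] at
   [40 + m + i], and the incidence matrix at [40 + m + n + i * m + j]. *)
Record core (n m : nat) (f : nat -> Z) : Prop := {
  c_n : f 0%nat = Z.of_nat n;
  c_m : f 1%nat = Z.of_nat m;
  c_0 : f 2%nat = Z.of_nat 0;
  c_1 : f 3%nat = Z.of_nat 1;
  c_in : f 15%nat = Z.of_nat 40;
  c_cnt : f 16%nat = Z.of_nat (40 + m);
  c_mat : f 17%nat = Z.of_nat (40 + m + n) }.

Ltac core_reg := match goal with
  | H : core _ _ ?f |- ?f _ = _ =>
      first [exact (c_n _ _ _ H) | exact (c_m _ _ _ H) | exact (c_0 _ _ _ H)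
            | exact (c_1 _ _ _ H) | exact (c_in _ _ _ H) | exact (c_cnt _ _ _ H)
            | exact (c_mat _ _ _ H)]
  end.
Ltac look := cbn [fst snd];
  repeat first [rewrite updZ_same | rewrite updZ_other by lia];
  first [eassumption | core_reg | reflexivity | apply (f_equal Z.of_nat); lia | lia].

Lemma core_upd n m f d v :
  core n m f -> d <> 0%nat -> d <> 1%nat -> d <> 2%nat -> d <> 3%nat -> d <> 15%nat ->
  d <> 16%nat -> d <> 17%nat -> core n m (updZ f d v).
Proof. intros [] ? ? ? ? ? ? ?. split; rewrite updZ_other by lia; auto. Qed.

Ltac conjs := cbn [fst snd]; repeat match goal with |- _ /\ _ => split end.
Ltac core_tac := repeat (apply core_upd; [|lia|lia|lia|lia|lia|lia|lia]); assumption.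

(** The target block starts at 16 + N with N = 2 (n + m), beyond the whole input, so that no unread
    entry is overwritten. *)
Definition phase_copy : com :=
  Op (IConst 2 0) ;; Op (IConst 3 1) ;; Op (IConst 4 16) ;; Op (IAdd 5 0 1) ;;
  Op (IAdd 5 5 5) ;; Op (IAdd 4 4 5) ;; Op (IConst 15 40) ;; Op (IAdd 16 15 1) ;;
  Op (IAdd 17 16 0) ;;
  For 11 5 (Op (RLoadI 0 11) ;; Op (IAdd 13 4 11) ;; Op (RStoreI 13 0) ;; Skip).

(* The input is moved past the first 16 real registers, which are then free;
   [R[0]] serves as the only temporary because it is moved first. *)
Lemma phase_copy_spec n m f (enc : nat -> R) :
  f 0%nat = Z.of_nat n -> f 1%nat = Z.of_nat m ->
  wp phase_copy (f, enc)
    (fun s => core n m (fst s) /\ fst s 4%nat = Z.of_nat (16 + (n + m + (n + m))) /\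
       forall k, (k < n + m + (n + m))%nat ->
         snd s (16 + (n + m + (n + m)) + k)%nat = enc k)
    (9 + ((n + m + (n + m)) * (3 + 3) + 3)).
Proof.
  intros Hn Hm. set (N := (n + m + (n + m))%nat). unfold phase_copy.
  eapply wp_const. eapply (wp_const 3 (Z.of_nat 1)). eapply (wp_const 4 (Z.of_nat 16)).
  eapply wp_addn; [look..|].
  eapply wp_addn; [look..|]. eapply wp_addn; [look..|].
  eapply (wp_const 15 (Z.of_nat 40)). eapply wp_addn; [look..|]. eapply wp_addn; [look..|].
  fold N.
  match goal with |- wp _ (?f', _) _ _ => set (f1 := f') end.
  assert (Hcore : core n m f1) by (unfold f1; split; look).
  assert (H4 : f1 4%nat = Z.of_nat (16 + N)) by (unfold f1; look).
  assert (H5 : f1 5%nat = Z.of_nat N) by (unfold f1; look).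
  clearbody f1.
  eapply wp_conseq.
  - apply (wp_for 11 5 _ N (fun j s => core n m (fst s) /\
       fst s 4%nat = Z.of_nat (16 + N) /\ fst s 5%nat = Z.of_nat N /\
       fst s 11%nat = Z.of_nat j /\
       (forall k, (k < j)%nat -> snd s (16 + N + k)%nat = enc k) /\
       (forall k, (j <= k < N)%nat -> snd s k = enc k)) f1 enc 3).
    + conjs; try look; try core_tac; auto.
    + cbn [fst snd]. tauto.
    + cbn [fst snd]. intros j f2 g2 Hj (Hc & F4 & F5 & F11 & Hlo & Hhi).
      eapply wp_rload; [look|reflexivity|].
      eapply wp_addn; [look..|].
      eapply wp_rstore; [look|lookR|].
      apply wp_skip. cbn [fst snd].
      conjs; try look; [core_tac| |].
      * intros k Hk. destruct (Nat.eq_dec k j) as [->|].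
        { rewrite updR_same. apply Hhi; lia. }
        rewrite !updR_other by lia. apply Hlo; lia.
      * intros k Hk. rewrite !updR_other by lia. apply Hhi; lia.
  - cbn [fst snd]. intros [f2 g2] (Hc & F4 & F5 & F11 & Hlo & Hhi). auto.
  - lia.
Qed.

(** Integer registers cannot be multiplied, so addresses are running pointers: register 8 at the
    current point, 9 at the current centre, 10 at the next matrix entry. *)
Definition phase_matrix : com :=
  Op (IAdd 8 4 2) ;; Op (IAdd 10 17 2) ;;
  For 11 0 (
    Op (IAdd 9 4 0) ;; Op (IAdd 9 9 0) ;;
    For 12 1 (
      Op (RLoadI 1 8) ;; Op (IAdd 13 8 3) ;; Op (RLoadI 2 13) ;;
      Op (RLoadI 3 9) ;; Op (IAdd 13 9 3) ;; Op (RLoadI 4 13) ;;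
      Op (RSub 1 1 3) ;; Op (RMul 1 1 1) ;; Op (RSub 2 2 4) ;; Op (RMul 2 2 2) ;;
      Op (RAdd 1 1 2) ;; Op (RConst 5 1) ;;
      IfRLe 1 5 (Op (IConst 14 1) ;; Skip) (Op (IConst 14 0) ;; Skip) ;;
      Op (IStoreI 10 14) ;; Op (IAdd 10 10 3) ;; Op (IAdd 9 9 3) ;; Op (IAdd 9 9 3) ;; Skip) ;;
    Op (IAdd 8 8 3) ;; Op (IAdd 8 8 3) ;; Skip).

Definition matrix_at (n m : nat) (mat : nat -> nat -> bool) (f : nat -> Z) : Prop :=
  forall i j, (i < n)%nat -> (j < m)%nat -> f (40 + m + n + i * m + j)%nat = Z.b2z (mat i j).

Lemma phase_matrix_spec n m f g (enc : nat -> R) mat :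
  (forall i j, (i < n)%nat -> (j < m)%nat -> mat i j = true <->
     (enc (2 * i)%nat - enc (2 * n + 2 * j)%nat) * (enc (2 * i)%nat - enc (2 * n + 2 * j)%nat) +
     (enc (2 * i + 1)%nat - enc (2 * n + 2 * j + 1)%nat) *
     (enc (2 * i + 1)%nat - enc (2 * n + 2 * j + 1)%nat) <= 1) ->
  core n m f -> f 4%nat = Z.of_nat (16 + (n + m + (n + m))) ->
  (forall k, (k < n + m + (n + m))%nat -> g (16 + (n + m + (n + m)) + k)%nat = enc k) ->
  wp phase_matrix (f, g) (fun s => core n m (fst s) /\ matrix_at n m mat (fst s))
    (2 + (n * (2 + (m * (21 + 3) + 3) + 2 + 3) + 3)).
Proof.
  intros Hmat Hc H4 Hg. set (N := (n + m + (n + m))%nat) in *. unfold phase_matrix.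
  eapply wp_addn; [look..|]. eapply wp_addn; [look..|].
  rewrite !Nat.add_0_r.
  set (P := fun i j (s : mem) => core n m (fst s) /\ fst s 4%nat = Z.of_nat (16 + N) /\
     (forall k, (k < N)%nat -> snd s (16 + N + k)%nat = enc k) /\
     fst s 8%nat = Z.of_nat (16 + N + 2 * i) /\
     fst s 10%nat = Z.of_nat (40 + m + n + i * m + j) /\
     fst s 11%nat = Z.of_nat i /\
     (forall i' j', (j' < m)%nat -> (i' < i)%nat \/ (i' = i /\ (j' < j)%nat) ->
        fst s (40 + m + n + i' * m + j')%nat = Z.b2z (mat i' j'))).
  eapply wp_conseq.
  - apply (wp_for 11 0 _ n (fun i s => P i 0%nat s)) with
      (T := (2 + (m * (21 + 3) + 3) + 2)%nat).
    + unfold P. conjs; try look; try core_tac; auto.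
    + unfold P; cbn [fst snd]. intros i f1 g1 Hi. split; [tauto|].
      destruct Hi as (Hi & _). apply Hi.
    + intros i f1 g1 Hi (C1 & F4 & G1 & F8 & F10 & F11 & M1); cbn [fst snd] in *.
      change (2 + (m * (21 + 3) + 3) + 2)%nat with (S (S ((m * (21 + 3) + 3) + 2))).
      eapply wp_addn; [look..|]. eapply wp_addn; [look..|].
      eapply (wp_seq_post _ _ _ (fun s => P i m s /\ fst s 12%nat = Z.of_nat m)).
      * eapply wp_conseq.
        { apply (wp_for 12 1 _ m (fun j s => P i j s /\ fst s 12%nat = Z.of_nat j /\
             fst s 9%nat = Z.of_nat (16 + N + (2 * n + 2 * j)))) with (T := 21%nat).
          - unfold P. conjs; try look; try core_tac; auto.
          - unfold P; cbn [fst snd]. intros j f2 g2 Hj. split; [tauto|]. apply Hj.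
          - clear f1 g1 C1 F4 G1 F8 F10 F11 M1.
            intros j f1 g1 Hj ((C1 & F4 & G1 & F8 & F10 & F11 & M1) & F12 & F9);
              cbn [fst snd] in *.
            eapply wp_time.
            { eapply wp_rload; [look|apply G1; lia|].
              eapply wp_addn; [look..|].
              eapply (wp_rload _ _ _ (16 + N + (2 * i + 1))%nat);
                [look|rewrite !updR_other by lia; apply G1; lia|].
              eapply wp_rload; [look|rewrite !updR_other by lia; apply G1; lia|].
              eapply wp_addn; [look..|].
              eapply (wp_rload _ _ _ (16 + N + (2 * n + 2 * j + 1))%nat);
                [look|rewrite !updR_other by lia; apply G1; lia|].
              eapply wp_rsub; [lookR..|]. eapply wp_rmul; [lookR..|].
              eapply wp_rsub; [lookR..|]. eapply wp_rmul; [lookR..|].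
              eapply wp_radd; [lookR..|]. eapply wp_rconst.
              match goal with |- wp _ (?f', ?g') _ _ => set (f2 := f'); set (g2 := g') end.
              assert (G2 : forall k, (k < N)%nat -> g2 (16 + N + k)%nat = enc k).
              { intros k Hk. unfold g2. rewrite !updR_other by lia. auto. }
              eapply (wp_seq_post _ _ _ (fun s => s = (updZ f2 14 (Z.b2z (mat i j)), g2))).
              - eapply wp_rle_val; [unfold g2; lookR..| |].
                + intros Hle. eapply wp_const. apply wp_done.
                  assert (mat i j = true) as -> by (apply Hmat; auto). reflexivity.
                + intros Hlt. eapply wp_const. apply wp_done.
                  assert (mat i j = false) as ->; [|reflexivity].
                  apply not_true_is_false. intros Ht. apply Hmat in Ht; auto. lra.
              - intros f3 g3 E3. inversion E3; subst f3 g3; clear E3. clearbody g2.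
                unfold f2.
                eapply wp_store; [look..|]. eapply wp_addn; [look..|].
                eapply wp_addn; [look..|]. eapply wp_addn; [look..|].
                apply wp_done. unfold P.
                conjs; try look; try core_tac; auto.
                intros i' j' Hj' Hij.
                (* Different pairs have different addresses because both column indices are below
                   [m]. *)
                destruct (Nat.eq_dec (i' * m + j') (i * m + j)) as [E|E].
                + assert (i' = i) as -> by nia. assert (j' = j) as -> by nia.
                  repeat first [rewrite updZ_same | rewrite updZ_other by lia]. reflexivity.
                + rewrite !updZ_other by lia. apply M1; auto.
                  destruct Hij as [|[]]; [auto|right; split; auto; nia]. }
            simpl; lia. }
        { cbn [fst snd]. tauto. }
        { lia. }
      * clear f1 g1 C1 F4 G1 F8 F10 F11 M1.
        intros f1 g1 ((C1 & F4 & G1 & F8 & F10 & F11 & M1) & F12); cbn [fst snd] in *.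
        eapply wp_addn; [look..|]. eapply wp_addn; [look..|].
        apply wp_done. unfold P. conjs; try look; try core_tac; auto.
        intros i' j' Hj' Hij. rewrite !updZ_other by lia. apply M1; auto. lia.
  - intros [f1 g1] (C1 & F4 & G1 & F8 & F10 & F11 & M1); cbn [fst snd] in *.
    split; auto. intros i j Hi Hj. apply M1; auto.
  - lia.
Qed.

Record data (n m : nat) (mat : nat -> nat -> bool) (S : nat -> bool) (f : nat -> Z) : Prop := {
  d_core : core n m f;
  d_inl : forall j, (j < m)%nat -> f (40 + j)%nat = Z.b2z (S j);
  d_mat : matrix_at n m mat f }.

Lemma data_upd n m mat S f d v :
  data n m mat S f -> (d < 40)%nat ->
  d <> 0%nat -> d <> 1%nat -> d <> 2%nat -> d <> 3%nat -> d <> 15%nat ->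
  d <> 16%nat -> d <> 17%nat -> data n m mat S (updZ f d v).
Proof.
  intros [H1 H2 H3] Hd ? ? ? ? ? ? ?. split.
  - core_tac.
  - intros j Hj. rewrite updZ_other by lia. auto.
  - intros i j Hi Hj. rewrite updZ_other by lia. auto.
Qed.

Ltac data_tac := repeat (apply data_upd; [|lia|lia|lia|lia|lia|lia|lia|lia]); assumption.

Definition phase_init : com :=
  For 12 1 (Op (IAdd 13 15 12) ;; Op (IStoreI 13 3) ;; Skip).

Lemma phase_init_spec n m mat f g :
  core n m f -> matrix_at n m mat f ->
  wp phase_init (f, g) (fun s => data n m mat (fun _ => true) (fst s)) (m * (2 + 3) + 3).
Proof.
  intros Hc Hm. unfold phase_init. eapply wp_conseq.
  - apply (wp_for 12 1 _ m (fun j s => core n m (fst s) /\ matrix_at n m mat (fst s) /\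
      fst s 12%nat = Z.of_nat j /\
      forall j', (j' < j)%nat -> fst s (40 + j')%nat = 1%Z)) with (T := 2%nat).
    + conjs; try look; try core_tac.
    + cbn [fst snd]. intros j f1 g1 (C & _ & F & _). split; [auto|apply C].
    + clear f g Hc Hm. intros j f g Hj (C & M & F & L); cbn [fst snd] in *.
      eapply wp_addn; [look..|]. eapply wp_store; [look..|]. apply wp_done.
      conjs; try look; try core_tac.
      * intros i' j' Hi' Hj'. rewrite !updZ_other by lia. auto.
      * intros j' Hj'. destruct (Nat.eq_dec j' j) as [->|].
        { repeat first [rewrite updZ_same | rewrite updZ_other by lia]. reflexivity. }
        rewrite !updZ_other by lia. apply L; lia.
  - intros [f1 g1] (C & M & F & L); cbn [fst snd] in *. split; auto.
  - lia.
Qed.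

Fixpoint zsum (h : nat -> Z) (k : nat) : Z :=
  match k with O => 0%Z | S k' => (zsum h k' + h k')%Z end.

Definition cnt (m : nat) (mat : nat -> nat -> bool) (S : nat -> bool) (i : nat) : Z :=
  zsum (fun j => Z.b2z (S j && mat i j)) m.

Definition phase_count : com :=
  Op (IAdd 18 17 2) ;;
  For 11 0 (
    Op (IConst 13 0) ;;
    For 12 1 (
      Op (IAdd 14 15 12) ;; Op (ILoadI 14 14) ;;
      IfLt 2 14 (Op (IAdd 14 18 12) ;; Op (ILoadI 14 14) ;; Op (IAdd 13 13 14) ;; Skip) Skip ;;
      Skip) ;;
    Op (IAdd 14 16 11) ;; Op (IStoreI 14 13) ;; Op (IAdd 18 18 1) ;; Skip).

Definition count_at (n m : nat) (mat : nat -> nat -> bool) (S : nat -> bool)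
    (f : nat -> Z) : Prop :=
  forall i, (i < n)%nat -> f (40 + m + i)%nat = cnt m mat S i.

Lemma phase_count_spec n m mat S f g :
  data n m mat S f ->
  wp phase_count (f, g) (fun s => data n m mat S (fst s) /\ count_at n m mat S (fst s) /\
      fst s 20%nat = f 20%nat)
    (1 + (n * (1 + (m * (7 + 3) + 3) + 3 + 3) + 3)).
Proof.
  intros Hd. assert (Hc := d_core _ _ _ _ _ Hd). unfold phase_count.
  eapply wp_addn; [look..|]. rewrite Nat.add_0_r.
  set (P := fun i (s : mem) => data n m mat S (fst s) /\ fst s 11%nat = Z.of_nat i /\
     fst s 18%nat = Z.of_nat (40 + m + n + i * m) /\ fst s 20%nat = f 20%nat /\
     forall i', (i' < i)%nat -> fst s (40 + m + i')%nat = cnt m mat S i').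
  eapply wp_conseq.
  - apply (wp_for 11 0 _ n P) with (T := (1 + (m * (7 + 3) + 3) + 3)%nat).
    + unfold P. conjs; try look. data_tac.
    + unfold P; cbn [fst snd]. intros i f1 g1 (D & F & _). split; [auto|apply D].
    + intros i f1 g1 Hi (D1 & F11 & F18 & F20 & Cn); cbn [fst snd] in *.
      change (1 + (m * (7 + 3) + 3) + 3)%nat with (Datatypes.S ((m * (7 + 3) + 3) + 3)).
      assert (C1 := d_core _ _ _ _ _ D1).
      apply wp_const.
      eapply (wp_seq_post _ _ _ (fun s => P i s /\ fst s 13%nat = cnt m mat S i)).
      * eapply wp_conseq.
        { apply (wp_for 12 1 _ m (fun j s => P i s /\ fst s 12%nat = Z.of_nat j /\
             fst s 13%nat = zsum (fun j => Z.b2z (S j && mat i j)) j)) with (T := 7%nat).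
          - unfold P. conjs; try look; try data_tac.
          - unfold P; cbn [fst snd]. intros j f2 g2 ((D & _) & F & _). split; [auto|apply D].
          - clear f1 g1 D1 F11 F18 F20 Cn C1.
            intros j f1 g1 Hj ((D1 & F11 & F18 & F20 & Cn) & F12 & F13); cbn [fst snd] in *.
            assert (C1 := d_core _ _ _ _ _ D1).
            assert (EL := d_inl _ _ _ _ _ D1 j Hj). assert (EM := d_mat _ _ _ _ _ D1 i j Hi Hj).
            eapply wp_time.
            { eapply wp_addn; [look..|]. eapply wp_load; [look|look|].
              eapply (wp_seq_post _ _ _ (fun s => P i s /\ fst s 12%nat = Z.of_nat j /\
                fst s 13%nat = zsum (fun j => Z.b2z (S j && mat i j)) (Datatypes.S j))).
              - eapply wp_lt_val; [look|look| |].
                + intros Hlt. eapply wp_addn; [look..|].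
                  eapply wp_load; [look|look|]. eapply wp_add; [look|look|].
                  apply wp_done. unfold P. conjs; try look; try data_tac.
                  rewrite updZ_same. cbn [zsum]. destruct (S j); [reflexivity|].
                  cbn [Z.b2z] in Hlt; lia.
                + intros Hle. apply wp_done. unfold P. conjs; try look; try data_tac.
                  rewrite !updZ_other by lia. cbn [zsum]. rewrite F13.
                  destruct (S j); cbn [Z.b2z andb] in Hle |- *; lia.
              - intros f2 g2 ((D2 & F11' & F18' & F20' & Cn') & F12' & F13');
                  cbn [fst snd] in *. assert (C2 := d_core _ _ _ _ _ D2).
                apply wp_done. unfold P. conjs; try look; try data_tac. }
            simpl; lia. }
        { cbn [fst snd]. intros s (HP & _ & H13). auto. } { lia. }
      * clear f1 g1 D1 F11 F18 F20 Cn C1.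
        intros f1 g1 ((D1 & F11 & F18 & F20 & Cn) & F13); cbn [fst snd] in *.
        assert (C1 := d_core _ _ _ _ _ D1).
        eapply wp_addn; [look..|]. eapply wp_store; [look..|]. eapply wp_addn; [look..|].
        apply wp_done. unfold P. conjs; try look.
        { split.
          - core_tac.
          - intros j Hj. rewrite !updZ_other by lia. now apply D1.
          - intros i' j Hi' Hj. rewrite !updZ_other by lia. now apply D1. }
        intros i' Hi'. destruct (Nat.eq_dec i' i) as [->|].
        { repeat first [rewrite updZ_same | rewrite updZ_other by lia]. reflexivity. }
        rewrite !updZ_other by lia. apply Cn; lia.
  - intros [f1 g1] (D1 & F11 & F18 & F20 & Cn); cbn [fst snd] in *. split; auto.
  - lia.
Qed.

(** For distinct chosen [a], [b], [c], the multiplicity with which point [i] is covered after the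
    exchange, found in constant time from the stored count. A disk [d] or [e] that is still chosen
    is counted again, which does not affect positivity. *)
Definition score (m : nat) mat S (a b c d e i : nat) : Z :=
  (cnt m mat S i - Z.b2z (mat i a) - Z.b2z (mat i b) - Z.b2z (mat i c)
   + Z.b2z (mat i d) + Z.b2z (mat i e))%Z.

(** The order of [a], [b], [c] makes them distinct. [d] and [e] may coincide with each other or with
    chosen disks, which accounts for exchanges that add fewer than two. *)
Definition valid_swap (n m : nat) mat S (a b c d e : nat) : Prop :=
  (a < b)%nat /\ (b < c)%nat /\ S a = true /\ S b = true /\ S c = true /\
  forall i, (i < n)%nat -> (1 <= score m mat S a b c d e i)%Z.

(** Register 26 is the verdict, 13 the score of the current point and 18 the address of its matrix
    row. *)
Definition check_loop : com :=
  Op (IConst 26 1) ;; Op (IAdd 18 17 2) ;;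
  For 11 0 (
    Op (IAdd 14 16 11) ;; Op (ILoadI 13 14) ;;
    Op (IAdd 14 18 21) ;; Op (ILoadI 14 14) ;; Op (ISub 13 13 14) ;;
    Op (IAdd 14 18 22) ;; Op (ILoadI 14 14) ;; Op (ISub 13 13 14) ;;
    Op (IAdd 14 18 23) ;; Op (ILoadI 14 14) ;; Op (ISub 13 13 14) ;;
    Op (IAdd 14 18 24) ;; Op (ILoadI 14 14) ;; Op (IAdd 13 13 14) ;;
    Op (IAdd 14 18 25) ;; Op (ILoadI 14 14) ;; Op (IAdd 13 13 14) ;;
    IfLt 13 3 (Op (IConst 26 0) ;; Skip) Skip ;;
    Op (IAdd 18 18 1) ;; Skip).

Lemma count_at_upd n m mat S f d v :
  count_at n m mat S f -> (d < 40)%nat -> count_at n m mat S (updZ f d v).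
Proof. intros H Hd i Hi. rewrite updZ_other by lia. auto. Qed.

Ltac count_tac := repeat (apply count_at_upd; [|lia]); assumption.

Lemma check_loop_spec n m mat S a b c d e f g :
  (a < m)%nat -> (b < m)%nat -> (c < m)%nat -> (d < m)%nat -> (e < m)%nat ->
  data n m mat S f -> count_at n m mat S f ->
  f 21%nat = Z.of_nat a -> f 22%nat = Z.of_nat b -> f 23%nat = Z.of_nat c ->
  f 24%nat = Z.of_nat d -> f 25%nat = Z.of_nat e ->
  wp check_loop (f, g) (fun s => data n m mat S (fst s) /\ count_at n m mat S (fst s) /\
      (forall r, (20 <= r < 26 \/ 31 <= r < 36)%nat -> fst s r = f r) /\
      ((fst s 26%nat = 1%Z /\ forall i, (i < n)%nat -> (1 <= score m mat S a b c d e i)%Z) \/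
       (fst s 26%nat = 0%Z /\ ~ forall i, (i < n)%nat -> (1 <= score m mat S a b c d e i)%Z)))
    (2 + (n * (21 + 3) + 3)).
Proof.
  intros Ha Hb Hc0 Hd0 He D Cn F21 F22 F23 F24 F25. assert (C := d_core _ _ _ _ _ D).
  unfold check_loop. apply wp_const. eapply wp_addn; [look..|]. rewrite Nat.add_0_r.
  set (keep := fun s : mem => forall r, (20 <= r < 26 \/ 31 <= r < 36)%nat -> fst s r = f r).
  set (P := fun i (s : mem) => data n m mat S (fst s) /\ count_at n m mat S (fst s) /\
     keep s /\ fst s 11%nat = Z.of_nat i /\ fst s 18%nat = Z.of_nat (40 + m + n + i * m)).
  set (R := fun i (s : mem) => 
      ((fst s 26%nat = 1%Z /\ forall i', (i' < i)%nat -> (1 <= score m mat S a b c d e i')%Z) \/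
       (fst s 26%nat = 0%Z /\ ~ forall i', (i' < n)%nat -> (1 <= score m mat S a b c d e i')%Z))).
  eapply wp_conseq.
  - apply (wp_for 11 0 _ n (fun i s => P i s /\ R i s)) with (T := 21%nat).
    + unfold P, R, keep. conjs; try look; try data_tac; try count_tac.
      * intros r Hr. rewrite !updZ_other by lia. reflexivity.
      * left. split; [look|lia].
    + unfold P; cbn [fst snd]. intros i f1 g1 ((D1 & _ & _ & F & _) & _). split; [auto|apply D1].
    + intros i f1 g1 Hi ((D1 & Cn1 & K1 & F11 & F18) & R1). cbn [fst snd] in *.
      assert (C1 := d_core _ _ _ _ _ D1).
      assert (G21 : f1 21%nat = Z.of_nat a) by (rewrite <- F21; apply K1; lia).
      assert (G22 : f1 22%nat = Z.of_nat b) by (rewrite <- F22; apply K1; lia).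
      assert (G23 : f1 23%nat = Z.of_nat c) by (rewrite <- F23; apply K1; lia).
      assert (G24 : f1 24%nat = Z.of_nat d) by (rewrite <- F24; apply K1; lia).
      assert (G25 : f1 25%nat = Z.of_nat e) by (rewrite <- F25; apply K1; lia).
      assert (Ec := Cn1 i Hi).
      assert (Ma := d_mat _ _ _ _ _ D1 i a Hi Ha). assert (Mb := d_mat _ _ _ _ _ D1 i b Hi Hb).
      assert (Mc := d_mat _ _ _ _ _ D1 i c Hi Hc0). assert (Md := d_mat _ _ _ _ _ D1 i d Hi Hd0).
      assert (Me := d_mat _ _ _ _ _ D1 i e Hi He).
      clear F21 F22 F23 F24 F25 D Cn C.
      eapply wp_time.
      { eapply wp_addn; [look..|]. eapply wp_load; [look|look|].
        eapply wp_addn; [look..|]. eapply wp_load; [look|look|]. eapply wp_sub; [look|look|].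
        eapply wp_addn; [look..|]. eapply wp_load; [look|look|]. eapply wp_sub; [look|look|].
        eapply wp_addn; [look..|]. eapply wp_load; [look|look|]. eapply wp_sub; [look|look|].
        eapply wp_addn; [look..|]. eapply wp_load; [look|look|]. eapply wp_add; [look|look|].
        eapply wp_addn; [look..|]. eapply wp_load; [look|look|]. eapply wp_add; [look|look|].
        fold (score m mat S a b c d e i).
        match goal with |- wp _ (?f', _) _ _ => set (f2 := f') end.
        assert (H13 : f2 13%nat = score m mat S a b c d e i) by (unfold f2; look).
        assert (H2 : P i (f2, g1)).
        { unfold P, keep. unfold f2. conjs; try look; try data_tac; try count_tac.
          intros r Hr. rewrite !updZ_other by lia. apply K1; lia. }
        assert (R2 : R i (f2, g1)).
        { unfold R in *; cbn [fst snd] in *. unfold f2. rewrite !updZ_other by lia. exact R1. }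
        clearbody f2. clear f1 D1 Cn1 K1 F11 F18 R1 C1 G21 G22 G23 G24 G25 Ec Ma Mb Mc Md Me.
        destruct H2 as (D1 & Cn1 & K1 & F11 & F18). cbn [fst snd] in *.
        assert (C1 := d_core _ _ _ _ _ D1).
        eapply (wp_seq_post _ _ _ (fun s => P i s /\ R (Datatypes.S i) s)).
        - eapply wp_lt_val; [look|look| |].
          + intros Hlt. apply wp_const. apply wp_done.
            unfold P, R, keep. conjs; try look; try data_tac; try count_tac.
            * intros r Hr. rewrite !updZ_other by lia. apply K1; lia.
            * right. split; [look|]. intros Hall. specialize (Hall i Hi). lia.
          + intros Hle. apply wp_done. split.
            * unfold P. conjs; auto.
            * unfold R in *; cbn [fst snd] in *. destruct R2 as [[E G]|[E G]]; [left|right; auto].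
              split; auto. intros i' Hi'. destruct (Nat.eq_dec i' i) as [->|]; [lia|].
              apply G; lia.
        - clear f2 D1 Cn1 K1 F11 F18 R2 C1 H13.
          intros f1 g2 ((D1 & Cn1 & K1 & F11 & F18) & R1). cbn [fst snd] in *.
          assert (C1 := d_core _ _ _ _ _ D1).
          eapply wp_addn; [look..|]. apply wp_done.
          unfold P, keep, R in *. cbn [fst snd] in *. conjs; try look; try data_tac; try count_tac.
          intros r Hr. rewrite !updZ_other by lia. apply K1; lia.
        }
      simpl; lia.
  - unfold P, R, keep. intros [f1 g1] ((D1 & Cn1 & K1 & F11 & F18) & R1). auto.
  - lia.
Qed.

(** Registers 31 to 35 record the exchange found, because the loop registers 21 to 25 run on. *)
Definition found_ok (n m : nat) mat S (f : nat -> Z) : Prop :=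
  f 20%nat = 0%Z \/
  (f 20%nat = 1%Z /\ exists a b c d e, (a < m)%nat /\ (b < m)%nat /\ (c < m)%nat /\
     (d < m)%nat /\ (e < m)%nat /\
     f 31%nat = Z.of_nat a /\ f 32%nat = Z.of_nat b /\ f 33%nat = Z.of_nat c /\
     f 34%nat = Z.of_nat d /\ f 35%nat = Z.of_nat e /\ valid_swap n m mat S a b c d e).

Lemma found_ok_ext n m mat S f f' :
  (forall r, (r = 20 \/ 31 <= r < 36)%nat -> f' r = f r) ->
  found_ok n m mat S f -> found_ok n m mat S f'.
Proof. intros H. unfold found_ok. rewrite !H by lia. auto. Qed.

(* [rho] lists the loop registers in force with their values. *)
Definition frame (n m : nat) mat S (rho : list (nat * nat)) (f : nat -> Z) : Prop :=
  data n m mat S f /\ count_at n m mat S f /\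
  forall r v, In (r, v) rho -> f r = Z.of_nat v.

(** [X] is what a failed search proves: if the flag in register 20 is 0 at the end, it was 0 before
    and [X] holds. In this form nested loops compose, each turning [X j] into a universal statement
    over [j]. *)
Definition searches (n m : nat) mat S (rho : list (nat * nat)) (c : com)
    (X : Prop) (T : nat) : Prop :=
  forall f g, frame n m mat S rho f -> found_ok n m mat S f ->
  wp c (f, g) (fun s => frame n m mat S rho (fst s) /\ found_ok n m mat S (fst s) /\
     (fst s 20%nat = 0%Z -> f 20%nat = 0%Z /\ X)) T.

Lemma searches_for n m mat S rho r c (X : nat -> Prop) T :
  (20 < r < 26)%nat -> (forall v, ~ In (r, v) rho) ->
  (forall j, (j < m)%nat -> searches n m mat S ((r, j) :: rho) c (X j) T) ->
  searches n m mat S rho (For r 1 c) (forall j, (j < m)%nat -> X j) (m * (T + 3) + 3).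
Proof.
  intros Hr Hrho Hc f g Hf Hok.
  assert (Hupd : forall f1 v j, frame n m mat S rho f1 -> v = Z.of_nat j ->
     frame n m mat S ((r, j) :: rho) (updZ f1 r v)).
  { intros f1 v j (D & C & Hp) ->. split; [data_tac|split; [count_tac|]].
    intros r' v' [E|Hin].
    - inversion E; subst. apply updZ_same.
    - rewrite updZ_other; auto. intros ->. eapply Hrho; eauto. }
  assert (Htl : forall f1 j, frame n m mat S ((r, j) :: rho) f1 -> frame n m mat S rho f1).
  { intros f1 j (D & C & Hp). split; [auto|split; [auto|]]. intros; apply Hp; simpl; auto. }
  eapply wp_conseq.
  - apply (wp_for r 1 _ m (fun j s => frame n m mat S ((r, j) :: rho) (fst s) /\
      found_ok n m mat S (fst s) /\
      (fst s 20%nat = 0%Z -> f 20%nat = 0%Z /\ forall j', (j' < j)%nat -> X j'))) with (T := T).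
    + conjs.
      * apply Hupd; auto.
      * revert Hok. apply found_ok_ext. intros; apply updZ_other; lia.
      * rewrite updZ_other by lia. intros H; split; auto. lia.
    + cbn [fst snd]. intros j f1 g1 ((D & _ & Hp) & _). split.
      * apply Hp; simpl; auto.
      * apply D.
    + intros j f1 g1 Hj (Fr & Ok & Hx); cbn [fst snd] in *.
      eapply wp_conseq; [apply (Hc j Hj); auto| |apply Nat.le_refl].
      intros [f2 g2] (Fr2 & Ok2 & Hx2); cbn [fst snd] in *.
      assert (D2 := proj1 Fr2). assert (C2 := d_core _ _ _ _ _ D2).
      conjs.
      * apply (proj2 (proj2 Fr2)); simpl; auto.
      * look.
      * apply Hupd; eauto.
      * revert Ok2. apply found_ok_ext. intros; apply updZ_other; lia.
      * rewrite updZ_other by lia. intros H. destruct (Hx2 H) as [H' HX].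
        destruct (Hx H') as [H'' HX']. split; auto.
        intros j' Hj'. destruct (Nat.eq_dec j' j) as [->|]; auto. apply HX'; lia.
  - cbn [fst snd]. intros s (Fr & Ok & Hx). split; eauto.
  - lia.
Qed.

(** The loops have no early exit; the test of flag 20 makes the remaining candidates cheap and
    protects the exchange already recorded. *)
Definition search_body : com :=
  IfLt 20 3 (IfLt 21 22 (IfLt 22 23 (
    Op (IAdd 13 15 21) ;; Op (ILoadI 13 13) ;;
    IfLt 2 13 (Op (IAdd 13 15 22) ;; Op (ILoadI 13 13) ;;
    IfLt 2 13 (Op (IAdd 13 15 23) ;; Op (ILoadI 13 13) ;;
    IfLt 2 13 (check_loop ;;
      IfLt 2 26 (Op (IConst 20 1) ;; Op (IAdd 31 21 2) ;; Op (IAdd 32 22 2) ;;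
                 Op (IAdd 33 23 2) ;; Op (IAdd 34 24 2) ;; Op (IAdd 35 25 2) ;; Skip)
      Skip) Skip) Skip) Skip) Skip) Skip) Skip.

Lemma search_body_spec n m mat S a b c d e :
  (a < m)%nat -> (b < m)%nat -> (c < m)%nat -> (d < m)%nat -> (e < m)%nat ->
  searches n m mat S [(25, e); (24, d); (23, c); (22, b); (21, a)]%nat search_body
    (~ valid_swap n m mat S a b c d e) (40 + n * 24).
Proof.
  intros Ha Hb Hc Hd He f g Fr Ok.
  set (rho := [(25, e); (24, d); (23, c); (22, b); (21, a)]%nat) in *.
  destruct Fr as (D & Cn & Hp).
  assert (G21 : f 21%nat = Z.of_nat a) by (apply Hp; simpl; tauto).
  assert (G22 : f 22%nat = Z.of_nat b) by (apply Hp; simpl; tauto).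
  assert (G23 : f 23%nat = Z.of_nat c) by (apply Hp; simpl; tauto).
  assert (G24 : f 24%nat = Z.of_nat d) by (apply Hp; simpl; tauto).
  assert (G25 : f 25%nat = Z.of_nat e) by (apply Hp; simpl; tauto).
  assert (C := d_core _ _ _ _ _ D).
  assert (La := d_inl _ _ _ _ _ D a Ha). assert (Lb := d_inl _ _ _ _ _ D b Hb).
  assert (Lc := d_inl _ _ _ _ _ D c Hc).
  (* Common ending of the rejections that precede [check_loop]: only the scratch register 13 has
     changed. *)
  assert (Hrej : forall f1 g1, (forall r, r <> 13%nat -> f1 r = f r) ->
     ~ valid_swap n m mat S a b c d e -> data n m mat S f1 -> count_at n m mat S f1 ->
     wp Skip (f1, g1) (fun s => frame n m mat S rho (fst s) /\ found_ok n m mat S (fst s) /\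
       (fst s 20%nat = 0%Z -> f 20%nat = 0%Z /\ ~ valid_swap n m mat S a b c d e)) 0).
  { intros f1 g1 H Hv D1 C1. apply wp_done. cbn [fst snd]. split; [|split].
    - split; [auto|split; [auto|]]. intros r v Hin. rewrite H; auto.
      intros ->. unfold rho in Hin. simpl in Hin. intuition congruence.
    - revert Ok. apply found_ok_ext. intros; apply H; lia.
    - rewrite H by lia. auto. }
  unfold search_body. eapply wp_time.
  { eapply wp_lt_val; [look|look| |].
    2: { intros Hf. apply wp_done. cbn [fst snd]. split; [split; auto|split; auto].
         intros H0. rewrite H0 in Hf. cbn in Hf. lia. }
    intros _. eapply wp_lt_val; [look|look| |].
    2: { intros Hle. apply Hrej; auto. unfold valid_swap. lia. }
    intros Hab. eapply wp_lt_val; [look|look| |].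
    2: { intros Hle. apply Hrej; auto. unfold valid_swap. lia. }
    intros Hbc. eapply wp_addn; [look..|]. eapply wp_load; [look|look|].
    eapply wp_lt_val; [look|look| |].
    2: { intros Hle. apply Hrej; try data_tac; try count_tac.
         - intros r Hr. rewrite !updZ_other by lia. auto.
         - intros (_ & _ & Sa & _). rewrite Sa in Hle. cbn in Hle. lia. }
    intros Sa. eapply wp_addn; [look..|]. eapply wp_load; [look|look|].
    eapply wp_lt_val; [look|look| |].
    2: { intros Hle. apply Hrej; try data_tac; try count_tac.
         - intros r Hr. rewrite !updZ_other by lia. auto.
         - intros (_ & _ & _ & Sb & _). rewrite Sb in Hle. cbn in Hle. lia. }
    intros Sb. eapply wp_addn; [look..|]. eapply wp_load; [look|look|].
    eapply wp_lt_val; [look|look| |].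
    2: { intros Hle. apply Hrej; try data_tac; try count_tac.
         - intros r Hr. rewrite !updZ_other by lia. auto.
         - intros (_ & _ & _ & _ & Sc & _). rewrite Sc in Hle. cbn in Hle. lia. }
    intros Sc.
    match goal with |- wp _ (?f', _) _ _ => set (f1 := f') end.
    assert (H1 : forall r, r <> 13%nat -> f1 r = f r).
    { intros r Hr. unfold f1. rewrite !updZ_other by lia. auto. }
    eapply wp_seq_post.
    - apply (check_loop_spec n m mat S a b c d e); auto;
        try (rewrite H1 by lia; assumption); unfold f1; first [data_tac|count_tac].
    - clearbody f1. intros f2 g2 (D2 & Cn2 & K2 & R2). cbn [fst snd] in *.
      assert (K3 : forall r, (20 <= r < 26 \/ 31 <= r < 36)%nat -> f2 r = f r).
      { intros r Hr. rewrite K2 by lia. apply H1; lia. }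
      assert (C2 := d_core _ _ _ _ _ D2).
      assert (I21 : f2 21%nat = Z.of_nat a) by (rewrite K3 by lia; auto).
      assert (I22 : f2 22%nat = Z.of_nat b) by (rewrite K3 by lia; auto).
      assert (I23 : f2 23%nat = Z.of_nat c) by (rewrite K3 by lia; auto).
      assert (I24 : f2 24%nat = Z.of_nat d) by (rewrite K3 by lia; auto).
      assert (I25 : f2 25%nat = Z.of_nat e) by (rewrite K3 by lia; auto).
      assert (Hrho : forall r v, In (r, v) rho -> (21 <= r < 26)%nat).
      { intros r v Hin. unfold rho in Hin. simpl in Hin.
        destruct Hin as [E|[E|[E|[E|[E|[]]]]]]; inversion E; lia. }
      eapply wp_lt_val; [look|look| |].
      + intros Hlt. destruct R2 as [[E26 Hsc]|[E26 Hsc]]; [|rewrite E26 in Hlt; cbn in Hlt; lia].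
        apply wp_const. eapply wp_addn; [look..|]. eapply wp_addn; [look..|].
        eapply wp_addn; [look..|]. eapply wp_addn; [look..|]. eapply wp_addn; [look..|].
        apply wp_done. rewrite !Nat.add_0_r. cbn [fst snd]. split; [|split].
        * split; [data_tac|split; [count_tac|]]. intros r v Hin.
          assert (Hr := Hrho r v Hin). rewrite !updZ_other by lia. rewrite K3 by lia. auto.
        * right. split; [look|]. exists a, b, c, d, e. conjs; auto; try look.
          unfold valid_swap. conjs; auto; try lia.
          { destruct (S a); [auto|cbn in Sa; lia]. }
          { destruct (S b); [auto|cbn in Sb; lia]. }
          { destruct (S c); [auto|cbn in Sc; lia]. }
        * repeat first [rewrite updZ_same | rewrite updZ_other by lia]. lia.
      + intros Hle. destruct R2 as [[E26 Hsc]|[E26 Hsc]]; [rewrite E26 in Hle; cbn in Hle; lia|].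
        apply wp_done. cbn [fst snd]. split; [|split].
        * split; [auto|split; [auto|]]. intros r v Hin.
          assert (Hr := Hrho r v Hin). rewrite K3 by lia. auto.
        * revert Ok. apply found_ok_ext. intros; apply K3; lia.
        * rewrite K3 by lia. intros H0; split; auto. unfold valid_swap. tauto. }
  simpl; lia.
Qed.

Definition phase_search : com :=
  For 21 1 (For 22 1 (For 23 1 (For 24 1 (For 25 1 search_body)))).

Definition loop_time (m T : nat) : nat := m * (T + 3) + 3.

Lemma phase_search_spec n m mat S :
  searches n m mat S [] phase_search
    (forall a, (a < m)%nat -> forall b, (b < m)%nat -> forall c, (c < m)%nat ->
     forall d, (d < m)%nat -> forall e, (e < m)%nat -> ~ valid_swap n m mat S a b c d e)
    (loop_time m (loop_time m (loop_time m (loop_time m (loop_time m (40 + n * 24)))))).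
Proof.
  unfold phase_search, loop_time.
  apply searches_for; [lia|simpl; intuition congruence|]. intros a Ha.
  apply searches_for; [lia|simpl; intuition congruence|]. intros b Hb.
  apply searches_for; [lia|simpl; intuition congruence|]. intros c Hc.
  apply searches_for; [lia|simpl; intuition congruence|]. intros d Hd.
  apply searches_for; [lia|simpl; intuition congruence|]. intros e He.
  now apply search_body_spec.
Qed.

(** * The effect of an exchange on counts and cardinality *)

Definition without (S : nat -> bool) (a b c : nat) : nat -> bool :=
  fun j => S j && negb (Nat.eqb j a) && negb (Nat.eqb j b) && negb (Nat.eqb j c).

(** Insertion follows deletion, so a disk among [a], [b], [c] that is also [d] or [e] stays. *)
Definition swap (S : nat -> bool) (a b c d e : nat) : nat -> bool :=
  fun j => Nat.eqb j d || Nat.eqb j e || without S a b c j.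

Lemma zsum_ext h h' k : (forall j, (j < k)%nat -> h j = h' j) -> zsum h k = zsum h' k.
Proof. induction k; simpl; intros H; auto. rewrite IHk, H; auto. Qed.

Lemma zsum_remove h a k : (a < k)%nat ->
  zsum h k = (h a + zsum (fun j => if Nat.eqb j a then 0 else h j) k)%Z.
Proof.
  induction k as [|k IH]; intros Ha; [lia|]. cbn [zsum].
  destruct (Nat.eqb_spec k a) as [->|Hne].
  - rewrite (zsum_ext (fun j => if Nat.eqb j a then 0%Z else h j) h a); [lia|].
    intros j Hj. destruct (Nat.eqb_spec j a); [lia|auto].
  - rewrite IH by lia. lia.
Qed.

Lemma zsum_b2z (h : nat -> bool) k :
  (0 <= zsum (fun j => Z.b2z (h j)) k)%Z /\
  ((1 <= zsum (fun j => Z.b2z (h j)) k)%Z <-> exists j, (j < k)%nat /\ h j = true).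
Proof.
  induction k as [|k [IH1 IH2]]; cbn [zsum].
  - split; [lia|]. split; [lia|intros (j & Hj & _); lia].
  - destruct (h k) eqn:E; cbn [Z.b2z].
    + split; [lia|]. split; [|lia]. intros _. exists k; auto.
    + split; [lia|]. rewrite Z.add_0_r, IH2. split; intros (j & Hj & H); exists j.
      * split; auto.
      * split; auto. destruct (Nat.eq_dec j k); [congruence|lia].
Qed.

(** As [a], [b], [c] are distinct and chosen, subtracting their matrix entries deletes exactly their
    terms from the count. *)
Lemma score_without m mat S a b c d e i :
  (a < b)%nat -> (b < c)%nat -> (c < m)%nat -> S a = true -> S b = true -> S c = true ->
  score m mat S a b c d e i =
  (zsum (fun j => Z.b2z (without S a b c j && mat i j)) m
   + Z.b2z (mat i d) + Z.b2z (mat i e))%Z.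
Proof.
  intros Hab Hbc Hc Sa Sb Sc. unfold score, cnt.
  rewrite (zsum_remove _ a) by lia.
  rewrite (zsum_remove _ b) by lia.
  rewrite (zsum_remove _ c) by lia. cbn beta.
  destruct (Nat.eqb_spec b a); [lia|]. destruct (Nat.eqb_spec c a); [lia|].
  destruct (Nat.eqb_spec c b); [lia|]. rewrite Sa, Sb, Sc, !andb_true_l.
  match goal with |- (_ + (_ + (_ + ?x)) - _ - _ - _ + _ + _ = ?y + _ + _)%Z =>
    enough (x = y) by lia end.
  apply zsum_ext. intros j _. unfold without.
  destruct (Nat.eqb j c), (Nat.eqb j b), (Nat.eqb j a), (S j); reflexivity.
Qed.

Lemma score_pos m mat S a b c d e i :
  (a < b)%nat -> (b < c)%nat -> (c < m)%nat -> S a = true -> S b = true -> S c = true ->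
  (d < m)%nat -> (e < m)%nat ->
  (1 <= score m mat S a b c d e i)%Z <->
  exists j, (j < m)%nat /\ swap S a b c d e j = true /\ mat i j = true.
Proof.
  intros Hab Hbc Hc Sa Sb Sc Hd He. rewrite score_without by auto.
  destruct (zsum_b2z (fun j => without S a b c j && mat i j) m) as [H0 H1].
  unfold swap. split.
  - intros H. destruct (mat i d) eqn:Ed.
    { exists d. rewrite Nat.eqb_refl. auto. }
    destruct (mat i e) eqn:Ee.
    { exists e. rewrite Nat.eqb_refl, orb_true_r. auto. }
    cbn [Z.b2z] in H. destruct (proj1 H1) as (j & Hj & Hw); [lia|].
    apply andb_true_iff in Hw as [Hw Hm]. exists j. rewrite Hw, orb_true_r. auto.
  - intros (j & Hj & Hs & Hm).
    assert (0 <= Z.b2z (mat i d))%Z by (destruct (mat i d); cbn; lia).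
    assert (0 <= Z.b2z (mat i e))%Z by (destruct (mat i e); cbn; lia).
    apply orb_true_iff in Hs as [Hs|Hs].
    + apply orb_true_iff in Hs as [Hs|Hs]; apply Nat.eqb_eq in Hs; subst j;
        rewrite Hm in *; cbn [Z.b2z] in *; lia.
    + enough (1 <= zsum (fun j => Z.b2z (without S a b c j && mat i j)) m)%Z by lia.
      apply H1. exists j. rewrite Hs, Hm. auto.
Qed.

Definition chosen (m : nat) (S : nat -> bool) : list nat := filter S (seq 0 m).

Lemma in_chosen m S j : In j (chosen m S) <-> (j < m)%nat /\ S j = true.
Proof. unfold chosen. rewrite filter_In, in_seq. intuition lia. Qed.

Lemma NoDup_chosen m S : NoDup (chosen m S).
Proof. apply NoDup_filter, seq_NoDup. Qed.

(** Three are deleted and at most two inserted; this strict decrease bounds the number of passes. *)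
Lemma chosen_swap m S a b c d e :
  (a < b)%nat -> (b < c)%nat -> (c < m)%nat -> S a = true -> S b = true -> S c = true ->
  (length (chosen m (swap S a b c d e)) < length (chosen m S))%nat.
Proof.
  intros Hab Hbc Hc Sa Sb Sc.
  assert (H1 : (length (chosen m (swap S a b c d e)) <=
     length (d :: e :: chosen m (without S a b c)))%nat).
  { apply NoDup_incl_length; [apply NoDup_chosen|]. intros j Hj.
    apply in_chosen in Hj as [Hj Hs]. unfold swap in Hs.
    apply orb_true_iff in Hs as [Hs|Hs].
    - apply orb_true_iff in Hs as [Hs|Hs]; apply Nat.eqb_eq in Hs; simpl; auto.
    - right; right. apply in_chosen; auto. }
  assert (H2 : (length (a :: b :: c :: chosen m (without S a b c)) <= length (chosen m S))%nat).
  { assert (Hw : forall j, In j (chosen m (without S a b c)) ->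
       (j < m)%nat /\ S j = true /\ j <> a /\ j <> b /\ j <> c).
    { intros j Hj. apply in_chosen in Hj as [Hj Hs]. unfold without in Hs.
      apply andb_true_iff in Hs as [Hs E1]. apply andb_true_iff in Hs as [Hs E2].
      apply andb_true_iff in Hs as [Hs E3].
      apply negb_true_iff, Nat.eqb_neq in E1, E2, E3. auto. }
    apply NoDup_incl_length.
    - constructor; [|constructor; [|constructor; [|apply NoDup_chosen]]]; simpl.
      + intros [H|[H|H]]; [lia|lia|apply Hw in H; tauto].
      + intros [H|H]; [lia|apply Hw in H; tauto].
      + intros H; apply Hw in H; tauto.
    - intros j [<-|[<-|[<-|H]]]; apply in_chosen; [split; [lia|auto]..|].
      apply Hw in H; tauto. }
  simpl in H1, H2. lia.
Qed.

(** * Passes, the main loop and the output *)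

(** Bits are cleared before any is set, in agreement with [swap] when [d] or [e] is among the disks
    removed. *)
Definition phase_apply : com :=
  IfLt 2 20 (
    Op (IAdd 13 15 31) ;; Op (IStoreI 13 2) ;; Op (IAdd 13 15 32) ;; Op (IStoreI 13 2) ;;
    Op (IAdd 13 15 33) ;; Op (IStoreI 13 2) ;; Op (IAdd 13 15 34) ;; Op (IStoreI 13 3) ;;
    Op (IAdd 13 15 35) ;; Op (IStoreI 13 3) ;; Skip) Skip.

Definition pass : com :=
  phase_count ;; Op (IConst 20 0) ;; phase_search ;; phase_apply.

Definition pass_time (n m : nat) : nat :=
  1 + (n * (1 + (m * (7 + 3) + 3) + 3 + 3) + 3) + (1 +
  (loop_time m (loop_time m (loop_time m (loop_time m (loop_time m (40 + n * 24))))) + 12)).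

Definition locally_optimal (n m : nat) mat S : Prop :=
  forall a b c d e, (a < m)%nat -> (b < m)%nat -> (c < m)%nat -> (d < m)%nat -> (e < m)%nat ->
    ~ valid_swap n m mat S a b c d e.

Lemma pass_spec n m mat S f g :
  data n m mat S f ->
  wp pass (f, g) (fun s =>
    (fst s 20%nat = 0%Z /\ data n m mat S (fst s) /\ locally_optimal n m mat S) \/
    (fst s 20%nat = 1%Z /\ exists a b c d e, (c < m)%nat /\ (d < m)%nat /\ (e < m)%nat /\
       valid_swap n m mat S a b c d e /\ data n m mat (swap S a b c d e) (fst s)))
    (pass_time n m).
Proof.
  intros D. unfold pass, pass_time.
  eapply wp_seq_post; [exact (phase_count_spec n m mat S f g D)|].
  intros f1 g1 (D1 & Cn & _). clear f g D. cbn [fst snd] in *.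
  apply wp_const. eapply wp_seq_post.
  { apply (phase_search_spec n m mat S).
    - split; [data_tac|split; [count_tac|easy]].
    - left. apply updZ_same. }
  intros f g ((D & Cn' & _) & Ok & Hx). cbn [fst snd] in *.
  assert (C := d_core _ _ _ _ _ D). unfold phase_apply.
  eapply wp_time.
  { destruct Ok as [E20|[E20 (a & b & c & d & e & Ha & Hb & Hc & Hd & He
      & F31 & F32 & F33 & F34 & F35 & Hv)]].
    - eapply wp_lt_val; [look|look| |].
      + intros H. cbn in H; lia.
      + intros _. apply wp_done. left. cbn [fst snd]. split; [auto|split; [auto|]].
        intros a b c d e Ha Hb Hc Hd He. now apply (Hx E20).
    - eapply wp_lt_val; [look|look| |].
      2: intros H; cbn in H; lia.
      intros _.
      eapply wp_addn; [look..|]. eapply wp_store; [look..|].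
      eapply wp_addn; [look..|]. eapply wp_store; [look..|].
      eapply wp_addn; [look..|]. eapply wp_store; [look..|].
      eapply wp_addn; [look..|]. eapply wp_store; [look..|].
      eapply wp_addn; [look..|]. eapply wp_store; [look..|].
      apply wp_done. right. cbn [fst snd]. split; [look|].
      exists a, b, c, d, e. conjs; auto. split.
      + core_tac.
      + intros j Hj. assert (Lj := d_inl _ _ _ _ _ D j Hj).
        unfold updZ, swap, without. cbn [Nat.eqb Nat.add] in *.
        destruct (Nat.eqb j e), (Nat.eqb j d), (Nat.eqb j c), (Nat.eqb j b), (Nat.eqb j a);
          cbn [orb andb negb]; rewrite ?andb_false_r, ?andb_true_r; try reflexivity; exact Lj.
      + intros i j Hi Hj. rewrite !updZ_other by lia. now apply D. }
  simpl; lia.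
Qed.

Definition feasible (n m : nat) (mat : nat -> nat -> bool) (S : nat -> bool) : Prop :=
  forall i, (i < n)%nat -> exists j, (j < m)%nat /\ S j = true /\ mat i j = true.

Definition main_loop : com := Op (IConst 20 1) ;; While 2 20 pass.

Lemma main_loop_spec n m mat f g :
  data n m mat (fun _ => true) f -> feasible n m mat (fun _ => true) ->
  wp main_loop (f, g) (fun s => exists S, data n m mat S (fst s) /\ feasible n m mat S /\
     locally_optimal n m mat S)
    (1 + ((m + 1) * (pass_time n m + 2) + 2)).
Proof.
  intros D Hcov. unfold main_loop. apply wp_const.
  eapply wp_conseq.
  (* While the flag is 1, the variant exceeds the size of the cover: at most [m] exchanges, and one
     last pass that finds none. *)
  - apply (wp_while 2 20 _ (fun k s => exists S, data n m mat S (fst s) /\ feasible n m mat S /\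
      ((fst s 20%nat = 1%Z /\ (length (chosen m S) + 1 <= k)%nat) \/
       (fst s 20%nat = 0%Z /\ locally_optimal n m mat S))) (pass_time n m)) with (k := (m + 1)%nat).
    + clear f g D Hcov. intros k [f g] (S & D & Hcov & Hor) Hlt. cbn [fst snd] in *.
      assert (C := d_core _ _ _ _ _ D). rewrite (c_0 _ _ _ C) in Hlt.
      destruct Hor as [[E20 Hk]|[E20 _]]; [|rewrite E20 in Hlt; cbn in Hlt; lia].
      exists (k - 1)%nat. split; [lia|].
      eapply wp_conseq; [now apply (pass_spec n m mat S)| |apply Nat.le_refl].
      intros s [(E0 & D' & Hloc)|(E1 & a & b & c & d & e & Hc & Hd & He & Hv & D')].
      * exists 0%nat. split; [lia|]. exists S. auto.
      * exists (k - 1)%nat. split; [lia|]. exists (swap S a b c d e).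
        destruct Hv as (Hab & Hbc & Sa & Sb & Sc & Hs).
        split; [auto|split].
        -- intros i Hi. apply (score_pos m mat S a b c d e i); auto.
        -- left. split; auto.
           assert (H := chosen_swap m S a b c d e Hab Hbc Hc Sa Sb Sc). lia.
    + exists (fun _ => true). cbn [fst snd]. split; [data_tac|split; [auto|]].
      left. split; [look|].
      assert (H := filter_length_le (fun _ => true) (seq 0 m)). unfold chosen.
      rewrite length_seq in H. lia.
  - intros [f1 g1] ((j & S & D1 & Hc & Hor) & Hle). cbn [fst snd] in *.
    exists S. split; [auto|split; [auto|]].
    destruct Hor as [[E20 _]|[_ H]]; auto.
    rewrite E20, (c_0 _ _ _ (d_core _ _ _ _ _ D1)) in Hle. cbn in Hle. lia.
  - lia.
Qed.

(* The result is first laid out from address [40 + m + n] on, since writing it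
   to its final place [I[0], I[1], ...] destroys the working registers. *)
Definition phase_collect : com :=
  Op (IConst 13 0) ;;
  For 12 1 (
    Op (IAdd 14 15 12) ;; Op (ILoadI 14 14) ;;
    IfLt 2 14 (Op (IAdd 13 13 3) ;; Op (IAdd 14 17 13) ;; Op (IStoreI 14 12) ;; Skip) Skip ;;
    Skip) ;;
  Op (IStoreI 17 13) ;; Skip.

Lemma chosen_S m S :
  chosen (Datatypes.S m) S = chosen m S ++ (if S m then [m] else []).
Proof. unfold chosen. rewrite seq_S, filter_app. reflexivity. Qed.

Lemma phase_collect_spec n m mat S f g :
  data n m mat S f ->
  wp phase_collect (f, g) (fun s => core n m (fst s) /\
      fst s (40 + m + n)%nat = Z.of_nat (length (chosen m S)) /\
      forall t, (t < length (chosen m S))%nat ->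
        fst s (40 + m + n + (1 + t))%nat = Z.of_nat (nth t (chosen m S) 0%nat))
    (1 + ((m * (7 + 3) + 3) + 1)).
Proof.
  intros D. unfold phase_collect. apply wp_const. eapply wp_seq_post.
  - apply (wp_for 12 1 _ m (fun j s => core n m (fst s) /\ fst s 12%nat = Z.of_nat j /\
      (forall j, (j < m)%nat -> fst s (40 + j)%nat = Z.b2z (S j)) /\
      fst s 13%nat = Z.of_nat (length (chosen j S)) /\
      forall t, (t < length (chosen j S))%nat ->
        fst s (40 + m + n + (1 + t))%nat = Z.of_nat (nth t (chosen j S) 0%nat))) with (T := 7%nat).
    + assert (C := d_core _ _ _ _ _ D). conjs; try look; try core_tac.
      * intros j Hj. rewrite !updZ_other by lia. now apply D.
      * intros t Ht. unfold chosen in Ht. simpl in Ht. lia.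
    + cbn [fst snd]. intros j f1 g1 (C & F & _). split; [auto|apply C].
    + clear f g D. intros j f g Hj (C & F12 & L & F13 & Ht). cbn [fst snd] in *.
      assert (Lj := L j Hj). rewrite chosen_S, length_app.
      eapply wp_time.
      { eapply wp_addn; [look..|]. eapply wp_load; [look|look|].
        eapply (wp_seq_post _ _ _ (fun s => core n m (fst s) /\ fst s 12%nat = Z.of_nat j /\
          (forall j, (j < m)%nat -> fst s (40 + j)%nat = Z.b2z (S j)) /\
          fst s 13%nat = Z.of_nat (length (chosen j S) + length (if S j then [j] else [])) /\
          forall t, (t < length (chosen j S) + length (if S j then [j] else []))%nat ->
            fst s (40 + m + n + (1 + t))%nat =
            Z.of_nat (nth t (chosen j S ++ (if S j then [j] else [])) 0%nat))).
        - eapply wp_lt_val; [look|look| |].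
          + intros Hlt. destruct (S j) eqn:ES; [|cbn in Hlt; lia].
            eapply wp_addn; [look..|]. eapply wp_addn; [look..|]. eapply wp_store; [look..|].
            apply wp_done. cbn [length]. conjs; try look; try core_tac.
            * intros j' Hj'. rewrite !updZ_other by lia. auto.
            * intros t Hlt'. destruct (Nat.eq_dec t (length (chosen j S))) as [->|Hne].
              { rewrite nth_middle. rewrite (Nat.add_comm 1 (length (chosen j S))).
                now rewrite updZ_same. }
              rewrite !updZ_other by lia. rewrite app_nth1 by lia. apply Ht; lia.
          + intros Hle. destruct (S j) eqn:ES; [cbn in Hle; lia|].
            apply wp_done. cbn [length]. rewrite Nat.add_0_r, app_nil_r.
            conjs; try look; try core_tac.
        - clear f g C F12 L F13 Ht Lj. intros f g (C & F12 & L & F13 & Ht). cbn [fst snd] in *.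
          apply wp_done. conjs; try look; try core_tac. }
      simpl; lia.
  - clear f g D. intros f g (C & F12 & L & F13 & Ht). cbn [fst snd] in *.
    eapply wp_store; [look..|]. apply wp_done. conjs; try look; try core_tac.
    intros t Hlt. rewrite updZ_other by lia. auto.
Qed.

(** Moves the words destined for addresses from 40 on, over the membership bits. The source starts
    at 40 + m + n, above every target, so it stays intact, and the working registers below 40 are
    still available. *)
Definition phase_shift : com :=
  For 36 1 (Op (IAdd 14 15 36) ;; Op (IAdd 13 17 14) ;; Op (ILoadI 13 13) ;;
            Op (IStoreI 14 13) ;; Skip).

Lemma phase_shift_spec n m f g :
  core n m f ->
  wp phase_shift (f, g) (fun s => core n m (fst s) /\
     (forall a, (40 + m + n <= a)%nat -> fst s a = f a) /\
     (forall r, (r < m)%nat -> fst s (40 + r)%nat = f (40 + m + n + (40 + r))%nat))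
    (m * (4 + 3) + 3).
Proof.
  intros C. unfold phase_shift. eapply wp_conseq.
  - apply (wp_for 36 1 _ m (fun j s => core n m (fst s) /\ fst s 36%nat = Z.of_nat j /\
      (forall a, (40 + m + n <= a)%nat -> fst s a = f a) /\
      (forall r, (r < j)%nat -> fst s (40 + r)%nat = f (40 + m + n + (40 + r))%nat)))
      with (T := 4%nat).
    + conjs; try look; try core_tac. intros a Ha. rewrite updZ_other by lia. auto.
    + cbn [fst snd]. intros j f1 g1 (C1 & F & _). split; [auto|apply C1].
    + intros j f1 g1 Hj (C1 & F36 & Hhi & Hlo). cbn [fst snd] in *.
      eapply wp_addn; [look..|]. eapply wp_addn; [look..|].
      eapply (wp_load _ _ _ (40 + m + n + (40 + j))%nat (f (40 + m + n + (40 + j))%nat));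
        [look|rewrite !updZ_other by lia; apply Hhi; lia|].
      eapply wp_store; [look..|]. apply wp_done. conjs; try look; try core_tac.
      * intros a Ha. rewrite !updZ_other by lia. auto.
      * intros r Hr. destruct (Nat.eq_dec r j) as [->|].
        { repeat first [rewrite updZ_same | rewrite updZ_other by lia]. reflexivity. }
        rewrite !updZ_other by lia. apply Hlo; lia.
  - cbn [fst snd]. intros s (C1 & F & Hhi & Hlo). auto.
  - lia.
Qed.

(** Fills registers [d], [d + 1], ... without any other register as counter or pointer: each one
    receives its own index, becomes the source address by adding the base in register 0, and then
    loads its final value. The copy is unrolled because register numbers are constants of the
    code. *)
Fixpoint low_copy (d k : nat) : com :=
  match k with
  | O => Skip
  | S k' => Op (IConst d (Z.of_nat d)) ;; Op (IAdd d d 0) ;; Op (ILoadI d d) ;;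
            low_copy (S d) k'
  end.

Lemma low_copy_spec src k : (40 <= src)%nat -> forall d f g,
  (1 <= d)%nat -> (d + k = 40)%nat -> f 0%nat = Z.of_nat src ->
  wp (low_copy d k) (f, g) (fun s => fst s 0%nat = Z.of_nat src /\
     (forall a, (1 <= a < d \/ 40 <= a)%nat -> fst s a = f a) /\
     (forall a, (d <= a < 40)%nat -> fst s a = f (src + a)%nat)) (3 * k).
Proof.
  intros Hsrc. induction k as [|k IH]; intros d f g Hd Hk F0.
  - apply wp_done. cbn [fst snd]. split; [auto|split; [auto|lia]].
  - replace (3 * S k)%nat with (S (S (S (3 * k)))) by lia. cbn [low_copy].
    apply wp_const. eapply wp_addn; [look..|].
    eapply (wp_load _ _ _ (src + d)%nat); [look|rewrite !updZ_other by lia; reflexivity|].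
    eapply wp_conseq.
    + apply IH; [lia|lia|look].
    + intros s (G0 & G1 & G2). split; [auto|split].
      * intros a Ha. rewrite G1 by lia. now rewrite !updZ_other by lia.
      * intros a Ha. destruct (Nat.eq_dec a d) as [->|Hne].
        { rewrite G1 by lia. rewrite updZ_same. f_equal; lia. }
        rewrite G2 by lia. now rewrite !updZ_other by lia.
    + apply Nat.le_refl.
Qed.

Definition phase_low : com := Op (IAdd 0 17 2) ;; low_copy 1 39 ;; Op (ILoadI 0 0) ;; Skip.

Definition main : com :=
  phase_copy ;; phase_matrix ;; phase_init ;; main_loop ;;
  phase_collect ;; phase_shift ;; phase_low.

Definition main_time (n m : nat) : nat :=
  (9 + ((n + m + (n + m)) * (3 + 3) + 3)) +
  ((2 + (n * (2 + (m * (21 + 3) + 3) + 2 + 3) + 3)) +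
  ((m * (2 + 3) + 3) + ((1 + ((m + 1) * (pass_time n m + 2) + 2)) +
  ((1 + ((m * (7 + 3) + 3) + 1)) + ((m * (4 + 3) + 3) + 119))))).

Lemma main_spec n m (enc : nat -> R) mat f :
  (forall i j, (i < n)%nat -> (j < m)%nat -> mat i j = true <->
     (enc (2 * i)%nat - enc (2 * n + 2 * j)%nat) * (enc (2 * i)%nat - enc (2 * n + 2 * j)%nat) +
     (enc (2 * i + 1)%nat - enc (2 * n + 2 * j + 1)%nat) *
     (enc (2 * i + 1)%nat - enc (2 * n + 2 * j + 1)%nat) <= 1) ->
  f 0%nat = Z.of_nat n -> f 1%nat = Z.of_nat m ->
  feasible n m mat (fun _ => true) ->
  wp main (f, enc) (fun s => exists S, feasible n m mat S /\ locally_optimal n m mat S /\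
     fst s 0%nat = Z.of_nat (length (chosen m S)) /\
     forall t, (t < length (chosen m S))%nat ->
       fst s (Datatypes.S t) = Z.of_nat (nth t (chosen m S) 0%nat)) (main_time n m).
Proof.
  intros Hmat F0 F1 Hcov. unfold main, main_time.
  eapply wp_seq_post; [exact (phase_copy_spec n m f enc F0 F1)|].
  clear f F0 F1. intros f g (C & F4 & G). cbn [fst snd] in *.
  eapply wp_seq_post; [exact (phase_matrix_spec n m f g enc mat Hmat C F4 G)|].
  clear f g C F4 G. intros f g (C & M). cbn [fst snd] in *.
  eapply wp_seq_post; [exact (phase_init_spec n m mat f g C M)|].
  clear f g C M. intros f g D. cbn [fst snd] in *.
  eapply wp_seq_post; [exact (main_loop_spec n m mat f g D Hcov)|].
  clear f g D. intros f g (S & D & HS & Hloc). cbn [fst snd] in *.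
  eapply wp_seq_post; [exact (phase_collect_spec n m mat S f g D)|].
  clear f g D. intros f g (C & Hlen & Hent). cbn [fst snd] in *.
  eapply wp_seq_post; [exact (phase_shift_spec n m f g C)|].
  intros f1 g1 (C1 & Hhi & Hlo). cbn [fst snd] in *. unfold phase_low.
  (* One step sets the base, three steps fill each of the registers 1 to 39, and the last step
     replaces the base by the length of the output. *)
  change 119%nat with (Datatypes.S (3 * 39 + 1)).
  eapply wp_addn; [look..|]. rewrite Nat.add_0_r. eapply wp_seq_post.
  { apply (low_copy_spec (40 + m + n) 39); [lia|lia|lia|look]. }
  intros f2 g2 (G0 & G1 & G2). cbn [fst snd] in *.
  eapply (wp_load _ _ _ (40 + m + n)%nat); [look|reflexivity|]. apply wp_done.
  exists S. split; [auto|split; [auto|split]]; cbn [fst snd].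
  - rewrite updZ_same, G1 by lia. rewrite updZ_other by lia. rewrite Hhi by lia. auto.
  - intros t Ht. rewrite updZ_other by lia.
    assert (Htm : (t < m)%nat).
    { assert (H := filter_length_le S (seq 0 m)). rewrite length_seq in H.
      unfold chosen in Ht. lia. }
    rewrite <- Hent by auto.
    destruct (le_lt_dec 40 (Datatypes.S t)) as [Hge|Hlt].
    + rewrite G1 by lia. rewrite updZ_other by lia.
      replace (Datatypes.S t) with (40 + (Datatypes.S t - 40))%nat at 1 by lia.
      rewrite Hlo by lia. f_equal; lia.
    + rewrite G2 by lia. rewrite updZ_other by lia. rewrite Hhi by lia. f_equal; lia.
Qed.

(** * Running time *)

(** A loop multiplies the bound by [m] and adds an overhead of 3 m + 3, absorbed by raising the
    constant by 6. *)
Lemma loop_time_le m T c x :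
  (1 <= m)%nat -> (1 <= x)%nat -> (T <= c * x)%nat -> (loop_time m T <= (c + 6) * (m * x))%nat.
Proof.
  intros Hm Hx HT. unfold loop_time.
  assert (m * T <= m * (c * x))%nat by (apply Nat.mul_le_mono_l; auto).
  assert (m <= m * x)%nat by nia. nia.
Qed.

Lemma main_time_le n m : (1 <= n)%nat -> (1 <= m)%nat ->
  (main_time n m <= 1000 * (m * (m * (m * (m * (m * (m * n)))))))%nat.
Proof.
  intros Hn Hm.
  assert (X1 : (1 <= m * n)%nat) by nia.
  assert (X2 : (m * n <= m * (m * n))%nat) by nia.
  assert (X3 : (m * (m * n) <= m * (m * (m * n)))%nat) by nia.
  assert (X4 : (m * (m * (m * n)) <= m * (m * (m * (m * n))))%nat) by nia.
  assert (X5 : (m * (m * (m * (m * n))) <= m * (m * (m * (m * (m * n)))))%nat) by nia.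
  assert (X0 : (m <= m * n /\ n <= m * n)%nat) by nia.
  (* Five loops take the constant from 64 to 94; the lower terms of a pass then fit below 160. *)
  assert (Y0 : (40 + n * 24 <= 64 * n)%nat) by lia.
  apply (loop_time_le m) in Y0; [|lia|lia].
  apply (loop_time_le m) in Y0; [|lia|lia].
  apply (loop_time_le m) in Y0; [|lia|lia].
  apply (loop_time_le m) in Y0; [|lia|lia].
  apply (loop_time_le m) in Y0; [|lia|lia].
  unfold main_time, pass_time. revert Y0.
  generalize (loop_time m (loop_time m (loop_time m (loop_time m (loop_time m (40 + n * 24)))))).
  intros T Y0.
  set (x5 := (m * (m * (m * (m * (m * n)))))%nat) in *.
  assert (Hp : (1 + (n * (1 + (m * (7 + 3) + 3) + 3 + 3) + 3) + (1 + (T + 12)) + 2 <= 160 * x5)%nat).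
  { ring_simplify. nia. }
  assert (Hq : ((m + 1) * (1 + (n * (1 + (m * (7 + 3) + 3) + 3 + 3) + 3) + (1 + (T + 12)) + 2)
     <= 320 * (m * x5))%nat).
  { transitivity ((m + 1) * (160 * x5))%nat; [now apply Nat.mul_le_mono_l|]. nia. }
  assert (x5 <= m * x5)%nat by nia.
  assert (n * m = m * n)%nat by lia.
  nia.
Qed.

(** * From registers and indices to points and disks *)

Definition pt (l : list point) (i : nat) : point := nth i l (0, 0).

Lemma nth_error_pt l i : (i < length l)%nat -> nth_error l i = Some (pt l i).
Proof. apply nth_error_nth'. Qed.

Lemma encode_point P D i : (i < length P)%nat ->
  encode_real P D (2 * i) = fst (pt P i) /\ encode_real P D (2 * i + 1) = snd (pt P i).
Proof.
  intros Hi. unfold encode_real.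
  destruct (Nat.ltb_spec (2 * i) (2 * length P)); [|lia].
  destruct (Nat.ltb_spec (2 * i + 1) (2 * length P)); [|lia].
  replace (Nat.div (2 * i) 2) with i by (apply Nat.div_unique with 0%nat; lia).
  replace (Nat.div (2 * i + 1) 2) with i by (apply Nat.div_unique with 1%nat; lia).
  rewrite nth_error_pt by auto. rewrite Nat.even_even, Nat.even_odd. auto.
Qed.

Lemma encode_disk P D j : (j < length D)%nat ->
  encode_real P D (2 * length P + 2 * j) = fst (pt D j) /\
  encode_real P D (2 * length P + 2 * j + 1) = snd (pt D j).
Proof.
  intros Hj. unfold encode_real.
  destruct (Nat.ltb_spec (2 * length P + 2 * j) (2 * length P)); [lia|].
  destruct (Nat.ltb_spec (2 * length P + 2 * j + 1) (2 * length P)); [lia|].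
  replace (Nat.div (2 * length P + 2 * j - 2 * length P) 2) with j
    by (apply Nat.div_unique with 0%nat; lia).
  replace (Nat.div (2 * length P + 2 * j + 1 - 2 * length P) 2) with j
    by (apply Nat.div_unique with 1%nat; lia).
  rewrite nth_error_pt by auto. rewrite <- Nat.mul_add_distr_l.
  rewrite Nat.even_even, Nat.even_odd. auto.
Qed.

Definition disk_matrix (P D : list point) (i j : nat) : bool :=
  if Rle_dec (sqdist (pt D j) (pt P i)) 1 then true else false.

Lemma disk_matrix_true P D i j :
  disk_matrix P D i j = true <-> in_unit_disk (pt D j) (pt P i).
Proof.
  unfold disk_matrix, in_unit_disk, sqdist. destruct (Rle_dec _ _); intuition congruence.
Qed.

Lemma map_nth_seq (l : list nat) : map (fun i => nth i l 0%nat) (seq 0 (length l)) = l.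
Proof.
  induction l as [|a l IH]; simpl; auto. f_equal.
  rewrite <- seq_shift, map_map. exact IH.
Qed.

(** The search runs over increasing triples, while three disks of a cover come in any order. *)
Lemma sort3 a b c : a <> b -> a <> c -> b <> c ->
  exists a' b' c', (a' < b' < c')%nat /\
    forall x, (x = a' \/ x = b' \/ x = c') <-> (x = a \/ x = b \/ x = c).
Proof.
  intros. destruct (lt_dec a b), (lt_dec b c), (lt_dec a c); try lia.
  - exists a, b, c; split; [lia|intros; lia].
  - exists a, c, b; split; [lia|intros; lia].
  - exists c, a, b; split; [lia|intros; lia].
  - exists b, a, c; split; [lia|intros; lia].
  - exists b, c, a; split; [lia|intros; lia].
  - exists c, b, a; split; [lia|intros; lia].
Qed.

(** Transfers the bound from lists of centres to lists of indices: [NoDup D] makes the passage from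
    an index to its centre injective, so cardinalities agree. *)
Lemma locally_optimal_ratio P D S (S' : list nat) :
  NoDup D -> P <> [] ->
  feasible (length P) (length D) (disk_matrix P D) S ->
  locally_optimal (length P) (length D) (disk_matrix P D) S ->
  NoDup S' -> covers P D S' ->
  (length (chosen (length D) S) <= 9 * length S')%nat.
Proof.
  intros HD HP Hcov Hloc HnS' [HS'1 HS'2].
  set (n := length P) in *. set (m := length D) in *.
  assert (Hin : forall j, (j < m)%nat -> In (pt D j) D) by (intros; now apply nth_In).
  assert (Hinj : forall i j, (i < m)%nat -> (j < m)%nat -> pt D i = pt D j -> i = j).
  { intros i j Hi Hj. apply (proj1 (NoDup_nth D (0, 0)) HD); auto. }
  assert (HP' : forall p, In p P -> exists i, (i < n)%nat /\ p = pt P i).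
  { intros p Hp. destruct (In_nth P p (0, 0) Hp) as (i & Hi & E). exists i; auto. }
  rewrite <- (length_map (pt D) (chosen m S)), <- (length_map (pt D) S').
  apply (local_optimum_ratio P D); auto.
  - apply NoDup_map_inj; [|apply NoDup_chosen].
    intros x y Hx Hy. apply in_chosen in Hx, Hy. apply Hinj; tauto.
  - apply NoDup_map_inj; auto.
  - intros c Hc. apply in_map_iff in Hc as (j & <- & Hj). apply in_chosen in Hj.
    apply Hin; tauto.
  - intros c Hc. apply in_map_iff in Hc as (j & <- & Hj). auto.
  - intros p Hp. destruct (HP' p Hp) as (i & Hi & ->).
    destruct (Hcov i Hi) as (j & Hj & Sj & Hm). exists (pt D j). split.
    + apply in_map, in_chosen; auto.
    + now apply disk_matrix_true.
  - intros p Hp. destruct (HS'2 p Hp) as (j & c & Hj & Hc & Hd).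
    rewrite nth_error_pt in Hc by auto. inversion Hc; subst c.
    exists (pt D j). split; auto. now apply in_map.
  - intros As Ds HnA HA HlA HDs HlD Hall.
    assert (HDi : forall c, In c D -> exists j, (j < m)%nat /\ c = pt D j).
    { intros c Hc. destruct (In_nth D c (0, 0) Hc) as (j & Hj & E). exists j; auto. }
    assert (HAi : forall c, In c As -> exists j, (j < m)%nat /\ S j = true /\ c = pt D j).
    { intros c Hc. apply HA in Hc. apply in_map_iff in Hc as (j & <- & Hj).
      apply in_chosen in Hj. exists j; tauto. }
    destruct As as [|ca [|cb [|cc [|]]]]; simpl in HlA; try lia.
    destruct (HAi ca) as (a & Ha & Sa & Ea); [simpl; auto|].
    destruct (HAi cb) as (b & Hb & Sb & Eb); [simpl; auto|].
    destruct (HAi cc) as (c & Hc & Sc & Ec); [simpl; auto|]. subst ca cb cc.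
    inversion HnA as [|? ? N1 HnA1]; subst. inversion HnA1 as [|? ? N2 _]; subst.
    simpl in N1, N2.
    destruct (sort3 a b c) as (a' & b' & c' & Hlt & Heq); try (intros ->; tauto).
    assert (Hex : forall x, x = a' \/ x = b' \/ x = c' -> (x < m)%nat /\ S x = true).
    { intros x Hx. apply Heq in Hx as [-> | [-> | ->]]; auto. }
    destruct (Hex a') as [Ha' Sa']; auto. destruct (Hex b') as [Hb' Sb']; auto.
    destruct (Hex c') as [Hc' Sc']; auto.
    (* The program always inserts two indices: a single disk is repeated, and if there is none [a']
       is put back, which only enlarges the cover. *)
    assert (HDd : exists d e, (d < m)%nat /\ (e < m)%nat /\
       forall x, In x Ds -> x = pt D d \/ x = pt D e).
    { destruct Ds as [|x [|y [|]]]; simpl in HlD; try lia.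
      - exists a', a'. split; [auto|split; [auto|easy]].
      - destruct (HDi x) as (d & Hd & ->); [apply HDs; simpl; auto|].
        exists d, d. split; [auto|split; [auto|]]. intros z [<-|[]]; auto.
      - destruct (HDi x) as (d & Hd & ->); [apply HDs; simpl; auto|].
        destruct (HDi y) as (e & He & ->); [apply HDs; simpl; auto|].
        exists d, e. split; [auto|split; [auto|]]. intros z [<-|[<-|[]]]; auto. }
    destruct HDd as (d & e & Hd & He & Hde).
    apply (Hloc a' b' c' d e); auto.
    unfold valid_swap. split; [lia|split; [lia|split; [auto|split; [auto|split; [auto|]]]]].
    intros i Hi. apply score_pos; auto; try lia.
    destruct (Hall (pt P i)) as (x & Hx & Hdx); [now apply nth_In|].
    destruct Hx as [[Hx HxA]|Hx].
    + apply in_map_iff in Hx as (j & <- & Hj). apply in_chosen in Hj as [Hj Sj].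
      exists j. split; [auto|split; [|now apply disk_matrix_true]].
      unfold swap, without. rewrite Sj.
      assert (Hne : ~ (j = a' \/ j = b' \/ j = c')).
      { rewrite Heq. intros H. apply HxA. simpl. destruct H as [-> | [-> | ->]]; auto. }
      destruct (Nat.eqb_spec j a'), (Nat.eqb_spec j b'), (Nat.eqb_spec j c'); try tauto.
      simpl. apply orb_true_r.
    + destruct (Hde x Hx) as [-> | ->].
      * exists d. split; [auto|split; [|now apply disk_matrix_true]].
        unfold swap. now rewrite Nat.eqb_refl.
      * exists e. split; [auto|split; [|now apply disk_matrix_true]].
        unfold swap. now rewrite Nat.eqb_refl, orb_true_r.
Qed.

Theorem theorem2 :
  forall eps : R, 0 < eps <= 6 ->
  exists (prg : program) (C : R), 0 < C /\
    forall P D : list point,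
      NoDup P -> NoDup D -> (1 <= length P)%nat ->
      covers P D (seq 0 (length D)) ->
      let n := INR (length P) in
      let m := INR (length D) in
      exists (t : nat) (S : list nat),
        INR t <= C * Rmax (m ^ 6 * n) (Rpower m (2 * (1 + 6 / eps)) * n) /\
        outputs_within prg P D t S /\
        NoDup S /\ covers P D S /\
        forall S' : list nat, NoDup S' -> covers P D S' ->
          INR (length S) <= (9 + eps) * INR (length S').
Proof.
  (* Neither the program nor the constant depends on [eps]. *)
  intros eps Heps. exists (compile 0 main), 1000. split; [lra|].
  intros P D HnP HnD HP [_ Hcov] n m.
  assert (HPne : P <> []) by (intros ->; simpl in HP; lia).
  (* Some point exists and is covered, so there is a disk; the time bound relies on this. *)
  assert (HD : (1 <= length D)%nat).
  { destruct P as [|p P]; [easy|]. destruct (Hcov p (or_introl eq_refl)) as (j & c & Hj & _).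
    apply in_seq in Hj. lia. }
  destruct (main_spec (length P) (length D) (encode_real P D) (disk_matrix P D) (encode_int P D))
    as ([f g] & t & He & Ht & S & HS & Hloc & Hout & Hent); try reflexivity.
  { intros i j Hi Hj. rewrite disk_matrix_true. unfold in_unit_disk.
    destruct (encode_point P D i Hi) as [-> ->]. destruct (encode_disk P D j Hj) as [-> ->].
    rewrite <- !Rsqr_pow2. unfold Rsqr. tauto. }
  { intros i Hi. destruct (Hcov (pt P i)) as (j & c & Hj & Hc & Hd); [now apply nth_In|].
    apply in_seq in Hj. exists j. split; [lia|split; [auto|]].
    rewrite nth_error_pt in Hc by lia. inversion Hc; subst. now apply disk_matrix_true. }
  cbn [fst snd] in *.
  exists t, (chosen (length D) S). split; [|split; [|split; [|split]]].
  - apply Rle_trans with (1000 * (m ^ 6 * n)).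
    + assert (H := main_time_le (length P) (length D) HP HD).
      assert (H' := le_INR _ _ (Nat.le_trans _ _ _ Ht H)).
      rewrite !mult_INR in H'. rewrite (INR_IZR_INZ 1000) in H'.
      change (IZR (Z.of_nat 1000)) with 1000 in H'. fold n m in H'.
      replace (m ^ 6 * n) with (m * (m * (m * (m * (m * (m * n)))))) by ring. exact H'.
    + apply Rmult_le_compat_l; [lra|apply Rmax_l].
  - assert (Hrun : run (compile 0 main) t (init_state P D) = st (size main) (f, g)).
    { apply (exec_run (compile 0 main) main _ _ _ He 0). intros k i Hk. exact Hk. }
    exists t. rewrite Hrun. split; [lia|]. split; [|split; [|]].
    (* The machine halts by running past the end of the code. *)
    + unfold halted, st. cbn [pc]. rewrite (proj2 (nth_error_None _ _)); [exact I|].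
      rewrite length_compile. lia.
    + unfold st; cbn [imem fst]. rewrite Hout. lia.
    + assert (Hmap : output (st (size main) (f, g)) = map Z.of_nat (chosen (length D) S)).
      { unfold output, st; cbn [imem fst]. rewrite Hout, Nat2Z.id.
        rewrite <- (map_nth_seq (chosen (length D) S)) at 2. rewrite map_map.
        apply map_ext_in. intros i Hi. apply in_seq in Hi. apply Hent. lia. }
      rewrite Hmap. split; [|reflexivity].
      apply Forall_forall. intros z Hz. apply in_map_iff in Hz as (j & <- & _). lia.
  - apply NoDup_chosen.
  - split.
    + intros j Hj. apply in_chosen in Hj. tauto.
    + intros p Hp. destruct (In_nth P p (0, 0) Hp) as (i & Hi & <-).
      destruct (HS i Hi) as (j & Hj & Sj & Hm). exists j, (pt D j). split; [|split].
      * now apply in_chosen.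
      * now apply nth_error_pt.
      * now apply disk_matrix_true.
  - intros S' HnS' HS'.
    assert (H := locally_optimal_ratio P D S S' HnD HPne HS Hloc HnS' HS').
    apply le_INR in H. rewrite mult_INR in H. replace (INR 9) with 9 in H by (simpl; lra).
    assert (0 <= INR (length S')) by apply pos_INR. nra.
Qed.
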